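(* Let $L>0$ be fixed and let $B_1,B_2,B_3,B_4\in\mathbb{R}$. Suppose that $\mu\in\mathbb{R}$ is a real solution of $$\mu(B_1+B_2\mu+B_3\mu^2)=\tfrac12B_2+2B_3\mu+B_4\mu^2,$$ that $\xi:=2(B_1+B_2\mu+B_3\mu^2)\neq0$, and that $\det D<\frac12$, where $$D=\frac1\xi\begin{pmatrix}2B_1+\mu B_2& B_2+2\mu B_3\\ B_2+2\mu B_3&2B_3+2\mu B_4\end{pmatrix}.$$ For $k\in(0,1)$ let $\phi=(\varphi,\mu\varphi)=\frac1\xi(\widetilde\varphi,\mu\widetilde\varphi)$ with $$\widetilde\varphi(x)=\frac{16K^2}{L^2}\left(\sqrt{1-k^2+k^4}+1-2k^2\right)+\frac{48K^2k^2}{L^2}\,\mathrm{cn}^2\left(\frac{2K}{L}x,k\right).$$ Then $\phi$ is orbitally stable in $X=H^1_{per}([0,L])\times H^1_{per}([0,L])$ by the periodic flow of $$\begin{cases}\partial_tu_1+\partial_x\left(B_1u_1^2+B_2u_1u_2+B_3u_2^2+\partial_x^2u_1\right)=0,\\ \partial_tu_2+\partial_x\left(\frac12B_2u_1^2+2B_3u_1u_2+B_4u_2^2+\partial_x^2u_2\right)=0.\end{cases}$$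
   Context: $\mathrm{cn}(\cdot,k)$ is the Jacobi cnoidal elliptic function with modulus $k\in(0,1)$ and $K=K(k)$ is the complete elliptic integral of the first kind. $\phi$ is the profile of a traveling wave $\phi(x-ct)$ of the system, with speed $c=c(k)=\frac{16K^2}{L^2}\sqrt{1-k^2+k^4}$ and $-\widetilde\varphi''+c\widetilde\varphi-\frac12\widetilde\varphi^2=0$. Standing assumption: the $L$-periodic Cauchy problem for the system is globally well-posed in $X$, and the system conserves its energy $E(u)=\int_0^L\{\frac12((\partial_xu_1)^2+(\partial_xu_2)^2)-R(u)\}dx$ with $R(u_1,u_2)=\frac13B_1u_1^3+\frac12B_2u_1^2u_2+B_3u_1u_2^2+\frac13B_4u_2^3$, its momentum $F(u)=\frac12\int_0^L(u_1^2+u_2^2)dx$ and its mass $M(u)=\int_0^L(u_1+u_2)dx$. Orbital stability: let $\rho(u,v)=\inf_{y\in\mathbb{R}}\|u-v(\cdot+y)\|_X$. $\phi$ is orbitally stable in $X$ by the periodic flow if for every $\varepsilon>0$ there is $\delta>0$ such that whenever $u_0\in X$ and $\|u_0-\phi\|_X<\delta$, the solution $u(t)$ with initial data $u_0$ exists globally and satisfies $\rho(u(t),\phi)<\varepsilon$ for all $t\ge0$. *)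

(* Defs.v *)
From HB Require Import structures.
From mathcomp Require Import all_boot all_order all_algebra.
From mathcomp Require Import all_classical all_reals all_analysis.
Set Implicit Arguments.
Unset Strict Implicit.
Unset Printing Implicit Defensive.
Import Order.TTheory GRing.Theory Num.Theory.
Import numFieldNormedType.Exports.
Local Open Scope classical_set_scope.
Local Open Scope ring_scope.

Definition ellip_integrand (R : realType) (k t : R) : R :=
  (Num.sqrt (1 - k ^+ 2 * sin t ^+ 2))^-1.

Definition ellipK (R : realType) (k : R) : R :=
  \int[lebesgue_measure]_(t in `[0, pi / 2]) ellip_integrand k t.

(* Incomplete elliptic integral of the first kind, oriented:
   the integral from 0 to [a] for either sign of [a]. *)
Definition ellipF (R : realType) (k a : R) : R :=
  if 0 <= a then \int[lebesgue_measure]_(t in `[0, a]) ellip_integrand k t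
  else - \int[lebesgue_measure]_(t in `[a, 0]) ellip_integrand k t.

(* For 0 < k < 1 the map [ellipF k] is an increasing bijection of the line,
   so the amplitude is its inverse; the default value 0 is then never used. *)
Definition jacobi_am (R : realType) (k x : R) : R :=
  xget 0 [set a | ellipF k a = x].

Definition jacobi_cn (R : realType) (k x : R) : R := cos (jacobi_am k x).

Definition int_per (R : realType) (L : R) (f : R -> R) : R :=
  \int[lebesgue_measure]_(x in `[0, L]) f x.

Definition L2per (R : realType) (L : R) (f : R -> R) : Prop :=
  [/\ periodic f L, measurable_fun setT f &
      (@lebesgue_measure R).-integrable `[0, L] (EFin \o (fun x => f x ^+ 2))].

(* [g] is a weak derivative of [f]: the L-periodic function [f] is an
   indefinite integral of [g], which is L-periodic and square integrable on
   a period. *)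
Definition weak_derivative (R : realType) (L : R) (f g : R -> R) : Prop :=
  L2per L g /\
  forall a b : R, a <= b ->
    f b - f a = \int[lebesgue_measure]_(x in `[a, b]) g x.

(* Elements of H^1_per are represented by their (unique) absolutely continuous
   representative, so that equality in H^1_per is equality of functions. *)
Definition H1per (R : realType) (L : R) (f : R -> R) : Prop :=
  periodic f L /\ exists g : R -> R, weak_derivative L f g.

(* The weak derivative, unique up to a null set when [H1per L f] holds. *)
Definition wderiv (R : realType) (L : R) (f : R -> R) : R -> R :=
  xget (fun=> 0) [set g | weak_derivative L f g].

Definition H1norm2 (R : realType) (L : R) (f : R -> R) : R :=
  int_per L (fun x => f x ^+ 2) + int_per L (fun x => wderiv L f x ^+ 2).

Definition vfun (R : realType) : Type := ((R -> R) * (R -> R))%type.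

Definition inX (R : realType) (L : R) (u : vfun R) : Prop :=
  H1per L u.1 /\ H1per L u.2.

Definition vsub (R : realType) (u v : vfun R) : vfun R :=
  (fun x => u.1 x - v.1 x, fun x => u.2 x - v.2 x).

Definition translate (R : realType) (y : R) (u : vfun R) : vfun R :=
  (fun x => u.1 (x + y), fun x => u.2 (x + y)).

Definition Xnorm (R : realType) (L : R) (u : vfun R) : R :=
  Num.sqrt (H1norm2 L u.1 + H1norm2 L u.2).

Definition Xdist (R : realType) (L : R) (u v : vfun R) : R :=
  Xnorm L (vsub u v).

Definition rho (R : realType) (L : R) (u v : vfun R) : R :=
  inf [set Xdist L u (translate y v) | y in [set: R]].

Definition flux1 (R : realType) (B1 B2 B3 : R) (u1 u2 : R) : R :=
  B1 * u1 ^+ 2 + B2 * u1 * u2 + B3 * u2 ^+ 2.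

Definition flux2 (R : realType) (B2 B3 B4 : R) (u1 u2 : R) : R :=
  2^-1 * B2 * u1 ^+ 2 + 2 * B3 * u1 * u2 + B4 * u2 ^+ 2.

Definition potential (R : realType) (B1 B2 B3 B4 : R) (u1 u2 : R) : R :=
  3^-1 * B1 * u1 ^+ 3 + 2^-1 * B2 * u1 ^+ 2 * u2
  + B3 * u1 * u2 ^+ 2 + 3^-1 * B4 * u2 ^+ 3.

Definition energy (R : realType) (L B1 B2 B3 B4 : R) (u : vfun R) : R :=
  int_per L (fun x =>
    2^-1 * (wderiv L u.1 x ^+ 2 + wderiv L u.2 x ^+ 2)
    - potential B1 B2 B3 B4 (u.1 x) (u.2 x)).

Definition momentum (R : realType) (L : R) (u : vfun R) : R :=
  2^-1 * int_per L (fun x => u.1 x ^+ 2 + u.2 x ^+ 2).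

Definition mass (R : realType) (L : R) (u : vfun R) : R :=
  int_per L (fun x => u.1 x + u.2 x).

Definition test_function (R : realType) (L : R) (psi : R -> R) : Prop :=
  periodic psi L /\ forall (n : nat) (x : R), derivable (derive1n n psi) x 1.

(* The equation  d_t v + d_x (N + d_x^2 v) = 0  at the positive time [t],
   tested against periodic smooth functions [psi]:
   d/dt <v, psi> = <N, psi'> + <v, psi'''>. *)
Definition weak_eq_at (R : realType) (L : R) (v : R -> R -> R)
    (N : R -> R) (t : R) : Prop :=
  forall psi : R -> R, test_function L psi ->
    is_derive t (1 : R) (fun s : R => int_per L (fun x => v s x * psi x))
      (int_per L (fun x => N x * derive1n 1 psi x + v t x * derive1n 3 psi x)).

(* Global solutions on t >= 0: continuous curves in X satisfying the system in
   the sense of periodic distributions. Values at negative times play no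
   role. *)
Definition global_solution (R : realType) (L B1 B2 B3 B4 : R)
    (u : R -> vfun R) : Prop :=
  [/\ forall t : R, 0 <= t -> inX L (u t),
      forall t : R, 0 <= t -> forall e : R, 0 < e ->
        exists2 d : R, 0 < d &
          forall s : R, 0 <= s -> `|s - t| < d -> Xdist L (u s) (u t) < e,
      forall t : R, 0 < t ->
        weak_eq_at L (fun s => (u s).1)
          (fun x => flux1 B1 B2 B3 ((u t).1 x) ((u t).2 x)) t &
      forall t : R, 0 < t ->
        weak_eq_at L (fun s => (u s).2)
          (fun x => flux2 B2 B3 B4 ((u t).1 x) ((u t).2 x)) t].

Definition globally_wellposed (R : realType) (L B1 B2 B3 B4 : R) : Prop :=
  let sol := global_solution L B1 B2 B3 B4 in
  [/\ forall u0 : vfun R, inX L u0 ->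
        exists2 u : R -> vfun R, sol u & u 0 = u0,
      forall u v : R -> vfun R, sol u -> sol v -> u 0 = v 0 ->
        forall t : R, 0 <= t -> u t = v t &
      forall u : R -> vfun R, sol u ->
        forall T e : R, 0 <= T -> 0 < e ->
        exists2 d : R, 0 < d &
          forall v : R -> vfun R, sol v -> Xdist L (v 0) (u 0) < d ->
          forall t : R, 0 <= t <= T -> Xdist L (v t) (u t) < e].

Definition conserved (R : realType) (L B1 B2 B3 B4 : R)
    (G : vfun R -> R) : Prop :=
  forall u : R -> vfun R, global_solution L B1 B2 B3 B4 u ->
    forall t : R, 0 <= t -> G (u t) = G (u 0).

Definition orbitally_stable (R : realType) (L B1 B2 B3 B4 : R)
    (phi : vfun R) : Prop :=
  inX L phi /\
  forall e : R, 0 < e -> exists2 d : R, 0 < d &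
    forall u0 : vfun R, inX L u0 -> Xdist L u0 phi < d ->
      (exists2 u : R -> vfun R,
         global_solution L B1 B2 B3 B4 u & u 0 = u0) /\
      (forall u : R -> vfun R,
         global_solution L B1 B2 B3 B4 u -> u 0 = u0 ->
         forall t : R, 0 <= t -> rho L (u t) phi < e).

Definition xi (R : realType) (B1 B2 B3 mu : R) : R :=
  2 * (B1 + B2 * mu + B3 * mu ^+ 2).

Definition mx22 (R : realType) (a b c d : R) : 'M[R]_2 :=
  \matrix_(i < 2, j < 2)
    if i == 0 then (if j == 0 then a else b) else (if j == 0 then c else d).

Definition Dmx (R : realType) (B1 B2 B3 B4 mu : R) : 'M[R]_2 :=
  (xi B1 B2 B3 mu)^-1 *:
    mx22 (2 * B1 + mu * B2)   (B2 + 2 * mu * B3)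
         (B2 + 2 * mu * B3)   (2 * B3 + 2 * mu * B4).

Definition tvarphi (R : realType) (L k x : R) : R :=
  let K := ellipK k in
  16 * K ^+ 2 / L ^+ 2 * (Num.sqrt (1 - k ^+ 2 + k ^+ 4) + 1 - 2 * k ^+ 2)
  + 48 * K ^+ 2 * k ^+ 2 / L ^+ 2 * jacobi_cn k (2 * K / L * x) ^+ 2.

Definition cnoidal_wave (R : realType) (L B1 B2 B3 mu k : R) : vfun R :=
  let c := (xi B1 B2 B3 mu)^-1 in
  (fun x => c * tvarphi L k x, fun x => c * (mu * tvarphi L k x)).

(* Main.v *)
Require Import Defs.
From HB Require Import structures.
From mathcomp Require Import all_boot all_order all_algebra.
From mathcomp Require Import all_classical all_reals all_analysis.
From mathcomp Require Import measurable_realfun.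
From mathcomp Require Import ring lra.
Set Implicit Arguments.
Unset Strict Implicit.
Unset Printing Implicit Defensive.
Import Order.TTheory GRing.Theory Num.Theory.
Import numFieldNormedType.Exports.
Local Open Scope classical_set_scope.
Local Open Scope ring_scope.

(** The wave is a critical point of the conserved quantity [E + c F], and the
proof is Lyapunov's method with modulation.

Along [(1, mu)] and [(- mu, 1)] the Hessian of the cubic potential at the wave is
[psi] and [(\det D) psi], where [psi] is the scalar profile
([hessian_diagonal]). The second variation at the wave is therefore the sum of
the forms of two Hill operators, [L1 = - d^2/dx^2 + c - psi] in the direction of
the wave and [- d^2/dx^2 + c - (\det D) psi] in the transverse direction
([lyapunov_expansion]).

The transverse operator is positive since [psi > 0] is a null function of
[- d^2/dx^2 + c - psi / 2] and [\det D < 1 / 2] ([transversal_coercive]).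

[L1] has a kernel, spanned by [psi'], and a negative direction. Instead of its
spectral theory the proof uses one explicit Lame function [chi], with
[L1 chi = lam chi], [lam > 0], and two nodes in a period: by Picone's identity the
form of [L1] is at least [lam] times the squared [L^2] norm on the functions
vanishing at the two nodes ([picone_nodes], [node_form_ge]). There is also an
explicit periodic [eta] with [L1 eta = kappa psi] and [kappa > 0]. Once
[<eta, psi>] is known to be negative, every function can be corrected by a
combination of [eta] and [psi'] so as to vanish at the nodes, and this yields
coercivity of [L1] on the functions orthogonal to [psi'], up to the square of
their product with [psi] ([longitudinal_coercive]). The sign of [<eta, psi>],
which expresses that the momentum of the wave grows with its speed, follows
from two inequalities for the mean of [psi] which come from Cauchy-Schwarz and
the profile equation ([mean_lt], [mean_sqr_ge], [inner_eta_psi_lt0]).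

Translating a state so that it is as close as possible to the wave in [L^2]
makes the difference orthogonal to [psi'] ([best_translation]), and conservation
of momentum controls the product with [psi]. The cubic remainder is small
compared with the form when the [L^2] distance is small ([apriori_estimate]), and
continuity in time prevents this distance from leaving the small regime
([wave_orbitally_stable]). *)

(** * Integrals over compact intervals *)

Definition integrable_on (R : realType) (a b : R) (f : R -> R) : Prop :=
  (@lebesgue_measure R).-integrable `[a, b] (EFin \o f).

Definition integral_on (R : realType) (a b : R) (f : R -> R) : R :=
  \int[lebesgue_measure]_(x in `[a, b]) f x.

Notation "\I_[ a , b ] f" := (integral_on a b f)
  (at level 10, f at level 9, a, b at level 0, format "\I_[ a , b ]  f").

Section IntegralOn.
Context {R : realType}.
Implicit Types (a b r : R) (f g : R -> R).

Let mI a b : measurable (`[a, b] : set (measurableTypeR R)).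
Proof. exact: measurable_itv. Qed.

Lemma eq_integrable_on a b f g :
  (forall x, a <= x <= b -> f x = g x) -> integrable_on a b f -> integrable_on a b g.
Proof.
move=> fg; apply: eq_integrable => // x; rewrite inE/= in_itv/= => /fg /= ->//.
Qed.

Lemma eq_integral_on a b f g :
  (forall x, a <= x <= b -> f x = g x) -> \I_[a, b] f = \I_[a, b] g.
Proof. by move=> fg; apply: eq_Rintegral => x; rewrite inE/= in_itv/= => /fg. Qed.

Lemma integrable_onD a b f g : integrable_on a b f -> integrable_on a b g ->
  integrable_on a b (fun x => f x + g x).
Proof. by move=> hf hg; exact: (integrableD (mI a b) hf hg). Qed.

Lemma integrable_onZ a b r f : integrable_on a b f ->
  integrable_on a b (fun x => r * f x).
Proof. by move=> hf; exact: (integrableZl (mI a b) r hf). Qed.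

Lemma integrable_onN a b f : integrable_on a b f ->
  integrable_on a b (fun x => - f x).
Proof. by move=> hf; exact: (integrableN hf). Qed.

Lemma integrable_onB a b f g : integrable_on a b f -> integrable_on a b g ->
  integrable_on a b (fun x => f x - g x).
Proof. by move=> hf hg; exact: (integrableB (mI a b) hf hg). Qed.

Lemma integrable_on_norm a b f : integrable_on a b f ->
  integrable_on a b (fun x => `|f x|).
Proof. by move=> hf; exact: (integrable_norm hf). Qed.

Lemma integrable_on_sub a b a' b' f : a <= a' -> b' <= b ->
  integrable_on a b f -> integrable_on a' b' f.
Proof.
move=> aa bb; apply: integrableS => // x /=; rewrite !in_itv/= => /andP[ax xb].
by rewrite (le_trans aa)//= (le_trans xb).
Qed.

Lemma measurable_integrable_on a b f :
  integrable_on a b f -> measurable_fun `[a, b] f.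
Proof. by move/(measurable_int _)/measurable_EFinP. Qed.

Lemma integrable_on_continuous a b f :
  {within `[a, b], continuous f} -> integrable_on a b f.
Proof. by move=> cf; apply: continuous_compact_integrable cf; exact: segment_compact. Qed.

Lemma le_integrable_on a b f g : measurable_fun `[a, b] f ->
  (forall x, a <= x <= b -> `|f x| <= g x) -> integrable_on a b g ->
  integrable_on a b f.
Proof.
move=> mf fg; apply: le_integrable => //; first exact/measurable_EFinP.
move=> x /=; rewrite in_itv/= => /fg fgx; rewrite lee_fin.
by rewrite (le_trans fgx)// ler_norm.
Qed.

Lemma integral_onD a b f g : integrable_on a b f -> integrable_on a b g ->
  \I_[a, b] (fun x => f x + g x) = \I_[a, b] f + \I_[a, b] g.
Proof. by move=> hf hg; exact: (RintegralD (mI a b) hf hg). Qed.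

Lemma integral_onB a b f g : integrable_on a b f -> integrable_on a b g ->
  \I_[a, b] (fun x => f x - g x) = \I_[a, b] f - \I_[a, b] g.
Proof. by move=> hf hg; exact: (RintegralB (mI a b) hf hg). Qed.

Lemma integral_onZ a b r f : integrable_on a b f ->
  \I_[a, b] (fun x => r * f x) = r * \I_[a, b] f.
Proof. by move=> hf; exact: (RintegralZl r (mI a b) hf). Qed.

Lemma integral_on_ge0 a b f : (forall x, a <= x <= b -> 0 <= f x) ->
  0 <= \I_[a, b] f.
Proof. by move=> f0; apply: Rintegral_ge0 => x /=; rewrite in_itv/=; exact: f0. Qed.

Lemma le_integral_on a b f g : integrable_on a b f -> integrable_on a b g ->
  (forall x, a <= x <= b -> f x <= g x) -> \I_[a, b] f <= \I_[a, b] g.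
Proof.
move=> hf hg fg; apply: (le_Rintegral (mI a b) hf hg) => x /=.
by rewrite in_itv/=; exact: fg.
Qed.

Lemma normr_integral_on a b f : integrable_on a b f ->
  `|\I_[a, b] f| <= \I_[a, b] (fun x => `|f x|).
Proof. by move=> hf; exact: le_normr_Rintegral. Qed.

Lemma integral_on_cst a b r : a <= b -> \I_[a, b] (fun=> r) = r * (b - a).
Proof.
move=> ab; rewrite /integral_on Rintegral_cst//= lebesgue_measure_itv/= lte_fin.
case: ltP => // ba; have -> : a = b by apply/le_anti; rewrite ab ba.
by rewrite subrr.
Qed.

Lemma integral_on_pt a f : \I_[a, a] f = 0.
Proof. by rewrite /integral_on set_itv1 Rintegral_set1. Qed.

Lemma integral_on_split c a b f : a <= c -> c <= b -> integrable_on a b f ->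
  \I_[a, b] f = \I_[a, c] f + \I_[c, b] f.
Proof.
move=> ac cb hf; rewrite /integral_on.
have := @Rintegral_itvB R f (BLeft a) (BRight b) c hf.
rewrite !bnd_simp => /(_ ac cb) H.
rewrite -(@Rintegral_itv_obnd_cbnd R c) -?H; first by rewrite addrC subrK.
apply: integrableS hf => //= x /=; rewrite !in_itv/= => /andP[cx ->].
by rewrite (le_trans ac)// ltW.
Qed.

Lemma integral_on_le_sub a b a' b' f : a <= a' -> a' <= b' -> b' <= b ->
  integrable_on a b f -> (forall x, a <= x <= b -> 0 <= f x) ->
  \I_[a', b'] f <= \I_[a, b] f.
Proof.
move=> aa ab bb hf f0.
have ab' := le_trans ab bb.
rewrite (integral_on_split aa ab' hf).
rewrite (integral_on_split ab bb); last exact: integrable_on_sub hf.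
rewrite [leLHS](_ : _ = 0 + (\I_[a',b'] f + 0)); last by rewrite add0r addr0.
apply: lerD; last apply: lerD => //; apply: integral_on_ge0 => x /andP[h1 h2];
  apply: f0; apply/andP; split => //.
- exact: le_trans h2 ab'.
- by apply: le_trans h1; exact: le_trans ab.
Qed.

End IntegralOn.

(** * Square-integrable functions *)

Definition sq_integrable (R : realType) (a b : R) (f : R -> R) : Prop :=
  measurable_fun `[a, b] f /\ integrable_on a b (fun x => f x ^+ 2).

Section SquareIntegrable.
Context {R : realType}.
Implicit Types (a b r : R) (f g : R -> R).

Lemma quadratic_discriminant (A B C : R) : 0 <= C ->
  (forall t, 0 <= A + 2 * t * B + t ^+ 2 * C) -> B ^+ 2 <= A * C.
Proof.
move=> C0 H.
have [C1|C1] := eqVneq C 0.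
  rewrite C1 mulr0; suff -> : B = 0 by rewrite expr0n.
  apply: contrapT => /eqP B0.
  have := H (- (A + 1) / (2 * B)); rewrite C1 mulr0 addr0.
  have -> : 2 * (- (A + 1) / (2 * B)) * B = - (A + 1) by field.
  by lra.
have Cp : 0 < C by rewrite lt_def C1.
have := H (- B / C).
have -> : A + 2 * (- B / C) * B + (- B / C) ^+ 2 * C = (A * C - B ^+ 2) / C by field.
by rewrite pmulr_lge0 ?invr_gt0// subr_ge0.
Qed.

Lemma integrable_on_mul a b f g : sq_integrable a b f -> sq_integrable a b g ->
  integrable_on a b (fun x => f x * g x).
Proof.
move=> [mf f2] [mg g2]; apply: (le_integrable_on _ _ (integrable_onD f2 g2)).
  exact: measurable_funM.
move=> x _; rewrite ler_norml; nra.
Qed.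

Lemma sq_integrableD a b f g : sq_integrable a b f -> sq_integrable a b g ->
  sq_integrable a b (fun x => f x + g x).
Proof.
move=> hf hg; split; first by apply: measurable_funD; [case: hf|case: hg].
apply: (@eq_integrable_on _ _ _ (fun x => f x ^+ 2 + 2 * (f x * g x) + g x ^+ 2)).
  by move=> x _; ring.
apply: integrable_onD; last by case: hg.
apply: integrable_onD; first by case: hf.
by apply: integrable_onZ; exact: integrable_on_mul.
Qed.

Lemma sq_integrableM a b (h : R -> R) f (M : R) : measurable_fun `[a, b] h ->
  (forall x, a <= x <= b -> `|h x| <= M) ->
  sq_integrable a b f -> sq_integrable a b (fun x => h x * f x).
Proof.
move=> mh hM [mf f2]; split; first exact: measurable_funM.
apply: (@le_integrable_on _ _ _ _ (fun x => M ^+ 2 * f x ^+ 2)).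
- by apply: measurable_funX; exact: measurable_funM.
- move=> x xab; rewrite ger0_norm ?sqr_ge0// exprMn ler_wpM2r ?sqr_ge0//.
  by rewrite -[leLHS]real_normK ?num_real// ler_pXn2r ?nnegrE// ?hM// (le_trans _ (hM x xab)).
- exact: integrable_onZ.
Qed.

Lemma sq_integrableZ a b r f : sq_integrable a b f ->
  sq_integrable a b (fun x => r * f x).
Proof.
by move=> hf; apply: (@sq_integrableM _ _ (cst r) _ `|r|) => //; exact: measurable_cst.
Qed.

Lemma sq_integrableB a b f g : sq_integrable a b f -> sq_integrable a b g ->
  sq_integrable a b (fun x => f x - g x).
Proof.
move=> hf hg; have -> : (fun x => f x - g x) = (fun x => f x + (-1) * g x).
  by apply/funext => x; rewrite mulN1r.
by apply: sq_integrableD => //; exact: sq_integrableZ.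
Qed.

Lemma sq_integrable_continuous a b f :
  {within `[a, b], continuous f} -> sq_integrable a b f.
Proof.
move=> cf; split; first by apply: measurable_integrable_on; exact: integrable_on_continuous.
apply: integrable_on_continuous => x; rewrite (_ : (fun _ => _) = f \* f)//.
by apply: continuousM; exact: cf.
Qed.

Lemma sq_integrable_sub a b a' b' f : a <= a' -> b' <= b ->
  sq_integrable a b f -> sq_integrable a' b' f.
Proof.
move=> aa bb [mf f2]; split; last exact: integrable_on_sub f2.
apply: measurable_funS mf => // x /=; rewrite !in_itv/= => /andP[ax xb].
by rewrite (le_trans aa)//= (le_trans xb).
Qed.

Lemma sq_integrable_integrable a b f : sq_integrable a b f -> integrable_on a b f.
Proof.
move=> hf; apply: (@eq_integrable_on _ _ _ (fun x => f x * cst 1 x)).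
  by move=> x _; rewrite mulr1.
apply: integrable_on_mul => //; apply: sq_integrable_continuous.
by apply: continuous_subspaceT => x; exact: cvg_cst.
Qed.

Lemma integral_on_sqD a b f g r : sq_integrable a b f -> sq_integrable a b g ->
  \I_[a, b] (fun x => (f x + r * g x) ^+ 2) =
  \I_[a, b] (fun x => f x ^+ 2) + 2 * r * \I_[a, b] (fun x => f x * g x)
  + r ^+ 2 * \I_[a, b] (fun x => g x ^+ 2).
Proof.
move=> hf hg.
have fg := integrable_onZ (2 * r) (integrable_on_mul hf hg).
have [_ f2] := hf; have [_ g2] := hg; have g2r := integrable_onZ (r ^+ 2) g2.
rewrite -(integral_onZ _ (integrable_on_mul hf hg)) -(integral_onZ _ g2).
rewrite -(integral_onD f2 fg) -(integral_onD (integrable_onD f2 fg) g2r).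
by apply: eq_integral_on => x _; ring.
Qed.

Lemma cauchy_schwarz_on a b f g : sq_integrable a b f -> sq_integrable a b g ->
  (\I_[a, b] (fun x => f x * g x)) ^+ 2 <=
  \I_[a, b] (fun x => f x ^+ 2) * \I_[a, b] (fun x => g x ^+ 2).
Proof.
move=> hf hg; apply: quadratic_discriminant => [|t].
  by apply: integral_on_ge0 => x _; exact: sqr_ge0.
rewrite -integral_on_sqD//.
by apply: integral_on_ge0 => x _; exact: sqr_ge0.
Qed.

End SquareIntegrable.

(** * Indefinite integrals of square-integrable functions *)

(** The graph of the weak derivative from [a] to [b]: carrying the derivative
along as a second function avoids choosing a representative of it. *)
Definition primitive_on (R : realType) (a b : R) (f g : R -> R) : Prop :=
  sq_integrable a b g /\
  forall x y, a <= x -> x <= y -> y <= b -> f y - f x = \I_[x, y] g.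

Section PrimitiveOn.
Context {R : realType}.
Implicit Types (a b r : R) (f g p q : R -> R).

Lemma primitive_on_sub a b a' b' f g : a <= a' -> b' <= b ->
  primitive_on a b f g -> primitive_on a' b' f g.
Proof.
move=> aa bb [hg fg]; split; first exact: sq_integrable_sub hg.
by move=> x y ax xy yb; apply: fg => //; [exact: le_trans ax|exact: le_trans bb].
Qed.

(** Cauchy-Schwarz for [g] and [1]. *)
Lemma primitive_holder a b f g x y : primitive_on a b f g ->
  a <= x -> x <= y -> y <= b ->
  (f y - f x) ^+ 2 <= (y - x) * \I_[x, y] (fun z => g z ^+ 2).
Proof.
move=> [hg fg] ax xy yb; rewrite fg//.
have c1 : sq_integrable x y (cst 1 : R -> R).
  by apply: sq_integrable_continuous; apply: continuous_subspaceT => z; exact: cvg_cst.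
have := cauchy_schwarz_on c1 (sq_integrable_sub ax yb hg).
rewrite (@eq_integral_on _ _ _ (fun x => _ * _) g); last by move=> z _; rewrite mul1r.
rewrite (@eq_integral_on _ _ _ (fun x => cst 1 x ^+ 2) (fun=> 1)); last first.
  by move=> z _; rewrite expr1n.
by rewrite integral_on_cst// mul1r.
Qed.

Lemma primitive_holder_norm a b f g x y : primitive_on a b f g ->
  a <= x <= b -> a <= y <= b ->
  (f y - f x) ^+ 2 <= `|y - x| * \I_[a, b] (fun z => g z ^+ 2).
Proof.
move=> fg; wlog xy : x y / x <= y => [hw|] /andP[ax xb] /andP[ay yb].
  have /orP[xy|yx] := le_total x y; first by apply: hw => //; apply/andP.
  by rewrite -sqrrN opprB distrC; apply: hw => //; apply/andP.
rewrite (le_trans (primitive_holder fg ax xy yb))// ger0_norm ?subr_ge0//.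
rewrite ler_wpM2l ?subr_ge0// integral_on_le_sub//; last by move=> *; exact: sqr_ge0.
by case: fg => -[].
Qed.

Lemma primitive_continuous a b f g : primitive_on a b f g ->
  {within `[a, b], continuous f}.
Proof.
move=> fg; apply/subspace_continuousP => x /= xab.
have {}xab : a <= x <= b by move: xab; rewrite in_itv.
pose N := \I_[a, b] (fun z => g z ^+ 2) + 1.
have N0 : 0 < N by rewrite ltr_wpDl// integral_on_ge0// => z _; exact: sqr_ge0.
apply/cvgrPdist_lt => e e0; rewrite near_withinE.
have d0 : 0 < e ^+ 2 / N by rewrite divr_gt0// exprn_gt0.
near=> y => /=.
rewrite in_itv/= => yab.
rewrite distrC -ltr_sqr ?nnegrE ?(ltW e0)// real_normK ?num_real//.
rewrite (le_lt_trans (primitive_holder_norm fg xab yab))//.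
have yx : `|y - x| < e ^+ 2 / N.
  by near: y; rewrite near_simpl; exact: cvgr_distC_lt d0.
rewrite (@le_lt_trans _ _ (`|y - x| * N))//; first by rewrite ler_wpM2l// lerDl.
by rewrite -ltr_pdivlMr.
Unshelve. all: by end_near. Qed.

Lemma primitive_sq_integrable a b f g : primitive_on a b f g -> sq_integrable a b f.
Proof. by move=> /primitive_continuous; exact: sq_integrable_continuous. Qed.

Lemma primitive_bounded a b f g : primitive_on a b f g ->
  exists M, forall x, a <= x <= b -> `|f x| <= M.
Proof.
move=> fg; have [ab|ba] := leP a b; last first.
  exists 0 => x /andP[ax xb]; have := le_trans ax xb; by rewrite leNgt ba.
exists (`|f a| + 1 + (b - a) * \I_[a, b] (fun z => g z ^+ 2)) => x /andP[ax xb].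
have := primitive_holder_norm (x:=a) (y:=x) fg; rewrite lexx ab ax xb => /(_ isT isT).
rewrite ger0_norm ?subr_ge0// => H.
have I0 : 0 <= \I_[a, b] (fun z => g z ^+ 2) by apply: integral_on_ge0 => z _; exact: sqr_ge0.
have {}H : (f x - f a) ^+ 2 <= (b - a) * \I_[a, b] (fun z => g z ^+ 2).
  by rewrite (le_trans H)// ler_wpM2r// lerD2r.
rewrite (_ : f x = f a + (f x - f a)); last by ring.
rewrite (le_trans (ler_normD _ _))// -addrA lerD2l.
apply: le_trans (_ : _ <= 1 + (f x - f a) ^+ 2) _; last by rewrite lerD2l.
have := real_normK (num_real (f x - f a)).
have := sqr_ge0 (`|f x - f a| - 1); have := sqr_ge0 `|f x - f a|.
by move: (f x - f a) => v; move: `|v| => z; nra.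
Qed.

(** The estimate adds up along a subdivision into intervals shorter than [d]. It
shows that a function is constant when its increments are negligible with
respect to those of [W], which need not be differentiable. *)
Lemma small_increments_chain a b d e (F W : R -> R) : 0 < d -> a <= b ->
  (forall x y, a <= x -> x <= y -> y <= b -> y - x <= d ->
     `|F y - F x| <= e * (W y - W x)) ->
  `|F b - F a| <= e * (W b - W a).
Proof.
move=> d0 ab H.
have key (n : nat) : forall x y, a <= x -> x <= y -> y <= b -> y - x <= n%:R * d ->
     `|F y - F x| <= e * (W y - W x).
  elim: n => [|n IH] x y ax xy yb.
    rewrite mul0r subr_le0 => yx; apply: H => //; lra.
  have [yxd|yxd] := leP (y - x) d; first by move=> _; exact: H.
  rewrite -natr1 mulrDl mul1r => yxn.
  have IHn : `|F (y - d) - F x| <= e * (W (y - d) - W x) by apply: IH; lra.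
  have Hn : `|F y - F (y - d)| <= e * (W y - W (y - d)) by apply: H; lra.
  rewrite (_ : F y - F x = (F y - F (y - d)) + (F (y - d) - F x)); last by ring.
  rewrite (le_trans (ler_normD _ _))//; lra.
have dn : 0 <= (b - a) / d by rewrite divr_ge0 ?subr_ge0// ltW.
apply: (key (Num.Def.archi_bound ((b - a) / d))) => //.
by rewrite -ler_pdivrMr// ltW// archi_boundP.
Qed.

Lemma primitiveD a b p q gp gq : primitive_on a b p gp -> primitive_on a b q gq ->
  primitive_on a b (fun x => p x + q x) (fun x => gp x + gq x).
Proof.
move=> [hp pp] [hq qq]; split; first exact: sq_integrableD.
move=> x y ax xy yb; rewrite integral_onD -?pp -?qq//; first by ring.
- exact/sq_integrable_integrable/(sq_integrable_sub ax yb).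
- exact/sq_integrable_integrable/(sq_integrable_sub ax yb).
Qed.

Lemma primitiveZ a b r p gp : primitive_on a b p gp ->
  primitive_on a b (fun x => r * p x) (fun x => r * gp x).
Proof.
move=> [hp pp]; split; first exact: sq_integrableZ.
move=> x y ax xy yb; rewrite integral_onZ -?pp//; first by ring.
exact/sq_integrable_integrable/(sq_integrable_sub ax yb).
Qed.

Lemma primitiveB a b p q gp gq : primitive_on a b p gp -> primitive_on a b q gq ->
  primitive_on a b (fun x => p x - q x) (fun x => gp x - gq x).
Proof.
move=> hp /(primitiveZ (-1)) hq; have := primitiveD hp hq.
by congr (primitive_on _ _ _ _); apply/funext => x; rewrite mulN1r.
Qed.

(** With [F] the difference of the two sides of the product rule, the increment
of [F] from [x] to a nearby [y] is the integral of
[gp s (q y - q s) + gq s (p x - p s)], and the increments of [p] and [q] are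
uniformly small; hence the increments of [F] are negligible with respect to
those of the integral of [|gp| + |gq|]. *)
Lemma primitiveM a b p q gp gq : primitive_on a b p gp -> primitive_on a b q gq ->
  primitive_on a b (fun x => p x * q x) (fun x => gp x * q x + p x * gq x).
Proof.
move=> hp hq.
have [Mp pM] := primitive_bounded hp.
have [Mq qM] := primitive_bounded hq.
have sp := primitive_sq_integrable hp.
have sq := primitive_sq_integrable hq.
have sgp : sq_integrable a b gp by case: hp.
have sgq : sq_integrable a b gq by case: hq.
have s1 : sq_integrable a b (fun x => gp x * q x).
  under eq_fun do rewrite mulrC.
  by apply: sq_integrableM qM _ => //; case: sq.
have s2 : sq_integrable a b (fun x => p x * gq x).
  by apply: sq_integrableM pM _ => //; case: sp.
split; first exact: sq_integrableD.
pose g x := gp x * q x + p x * gq x.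
have ig : integrable_on a b g by exact/sq_integrable_integrable/sq_integrableD.
move=> x0 y0 ax0 xy0 yb0.
pose w x := `|gp x| + `|gq x|.
have iw : integrable_on a b w.
  by apply: integrable_onD; apply/integrable_on_norm/sq_integrable_integrable.
have w0 x : 0 <= w x by rewrite addr_ge0.
pose F x := p x * q x - \I_[a, x] g.
pose W x := \I_[a, x] w.
have splitI h x y : integrable_on a b h -> a <= x -> x <= y -> y <= b ->
    \I_[a, y] h = \I_[a, x] h + \I_[x, y] h.
  move=> ih ax xy yb; apply: integral_on_split => //.
  exact: integrable_on_sub ih.
suff : `|F y0 - F x0| <= 0.
  rewrite normr_le0 subr_eq0 => /eqP; rewrite /F (splitI g x0 y0)//.
  by move: (\I_[x0, y0] g) (\I_[a, x0] g) => u v; lra.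
rewrite leNgt; apply/negP => F0.
pose D := W y0 - W x0 + 1.
have D0 : 0 < D.
  have -> : D = \I_[x0, y0] w + 1.
    by rewrite /D /W (splitI w x0 y0)//; congr (_ + 1); rewrite addrAC subrr add0r.
  by rewrite ltr_wpDl// integral_on_ge0.
pose e := `|F y0 - F x0| / D.
have e0 : 0 < e by rewrite divr_gt0.
pose N := \I_[a, b] (fun z => gp z ^+ 2) + \I_[a, b] (fun z => gq z ^+ 2) + 1.
have Np0 : 0 <= \I_[a, b] (fun z => gp z ^+ 2).
  by apply: integral_on_ge0 => z _; exact: sqr_ge0.
have Nq0 : 0 <= \I_[a, b] (fun z => gq z ^+ 2).
  by apply: integral_on_ge0 => z _; exact: sqr_ge0.
have N0 : 0 < N by rewrite /N; lra.
have d0 : 0 < e ^+ 2 / N by rewrite divr_gt0// exprn_gt0.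
have osc h gh : primitive_on a b h gh -> \I_[a, b] (fun z => gh z ^+ 2) <= N ->
    forall x y, a <= x <= b -> a <= y <= b -> `|y - x| <= e ^+ 2 / N ->
    `|h y - h x| <= e.
  move=> hh hN x y xab yab xyd.
  rewrite -ler_sqr ?nnegrE ?(ltW e0)// real_normK ?num_real//.
  rewrite (le_trans (primitive_holder_norm hh xab yab))//.
  rewrite (@le_trans _ _ (`|y - x| * N))//; first by rewrite ler_wpM2l.
  by rewrite -ler_pdivlMr.
have : `|F y0 - F x0| <= e * (W y0 - W x0).
  apply: (small_increments_chain d0) => // x y x0x xy yy0 xyd.
  have ax := le_trans ax0 x0x; have yb := le_trans yy0 yb0.
  have xab : a <= x <= b by rewrite ax (le_trans xy).
  have yab : a <= y <= b by rewrite yb (le_trans ax).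
  have subxy h : integrable_on a b h -> integrable_on x y h.
    exact: integrable_on_sub.
  have -> : F y - F x = \I_[x, y] (fun s => gp s * (q y - q s) + gq s * (p x - p s)).
    rewrite /F (splitI g x y)//.
    transitivity ((q y * \I_[x, y] gp + p x * \I_[x, y] gq) - \I_[x, y] g).
      case: hp => _ /(_ x y ax xy yb) <-; case: hq => _ /(_ x y ax xy yb) <-.
      move: (\I_[x, y] g) (\I_[a, x] g) => u v; ring.
    rewrite -!integral_onZ//; try exact/subxy/sq_integrable_integrable.
    rewrite -integral_onD; try exact/integrable_onZ/subxy/sq_integrable_integrable.
    rewrite -integral_onB; last 2 first.
      by apply: integrable_onD; exact/integrable_onZ/subxy/sq_integrable_integrable.
      exact: subxy.
    by apply: eq_integral_on => s _; rewrite /g; ring.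
  have iF : integrable_on x y (fun s => gp s * (q y - q s) + gq s * (p x - p s)).
    apply: (@eq_integrable_on _ _ _ (fun s => q y * gp s + p x * gq s - g s)).
      by move=> s _; rewrite /g; ring.
    apply: integrable_onB; last exact: subxy.
    by apply: integrable_onD; exact/integrable_onZ/subxy/sq_integrable_integrable.
  rewrite (le_trans (normr_integral_on iF))//.
  rewrite /W (splitI w x y)// addrAC subrr add0r -integral_onZ; last exact: subxy.
  apply: le_integral_on; [exact: integrable_on_norm|exact/integrable_onZ/subxy|].
  move=> s /andP[xs sy].
  have sab : a <= s <= b by rewrite (le_trans ax)//= (le_trans sy).
  rewrite (le_trans (ler_normD _ _))// !normrM /w mulrDr.
  apply: lerD; rewrite mulrC ler_wpM2r//.
    apply: (osc _ _ hq) => //; first by rewrite /N; lra.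
    rewrite ger0_norm; lra.
  apply: (osc _ _ hp) => //; first by rewrite /N; lra.
  rewrite ler0_norm; lra.
rewrite leNgt => /negP; apply.
rewrite -[ltRHS](divfK (lt0r_neq0 D0)) -/e ltr_pM2l// /D; lra.
Qed.

Lemma primitive_derivable a b f g : a <= b ->
  (forall x, a <= x <= b -> is_derive x (1 : R) f (g x)) ->
  (forall x, a <= x <= b -> {for x, continuous g}) ->
  primitive_on a b f g.
Proof.
move=> ab df cg.
have wc (h : R -> R) x y : a <= x -> y <= b -> (forall x, a <= x <= b -> {for x, continuous h}) ->
    {within `[x, y], continuous h}.
  move=> ax yb ch; apply: continuous_in_subspaceT => z; rewrite inE/= in_itv/= => /andP[xz zy].
  by apply: ch; rewrite (le_trans ax)//= (le_trans zy).
have cf x : a <= x <= b -> {for x, continuous f}.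
  by move=> xab; apply: differentiable_continuous; apply/derivable1_diffP; case: (df x xab).
split; first by apply/sq_integrable_continuous/wc.
move=> x y ax; rewrite le_eqVlt => /predU1P[<-|xy] yb.
  by rewrite integral_on_pt subrr.
rewrite /integral_on /Rintegral (@continuous_FTC2 _ g f)//.
- exact: wc.
- split.
  + move=> z; rewrite in_itv/= => /andP[xz zy].
    suff [] : is_derive z (1 : R) f (g z) by [].
    by apply: df; apply/andP; split; lra.
  + by apply: cvg_at_right_filter; apply: cf; apply/andP; split; lra.
  + by apply: cvg_at_left_filter; apply: cf; apply/andP; split; lra.
- move=> z; rewrite in_itv/= => /andP[xz zy].
  have [_ <-] : is_derive z (1 : R) f (g z) by apply: df; apply/andP; split; lra.
  by rewrite derive1E.
Qed.

End PrimitiveOn.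

(** * Periodic functions and translations *)

Section Shift.
Context {R : realType}.
Implicit Types (a b y L : R) (f g : R -> R).
Local Notation mu := (@lebesgue_measure R).

Let mshift y : measurable_fun [set: R] ((fun x => x + y) : R -> R).
Proof. by apply: measurable_funD => //; exact: measurable_id. Qed.

Lemma lebesgue_measure_shift y (A : set R) : measurable A ->
  pushforward mu ((fun x => x + y) : R -> measurableTypeR R) A = mu A.
Proof.
move=> mA; apply/esym/lebesgue_measure_unique => //=; first exact: mshift.
move=> ? _ [[a b]] _ <-.
rewrite /pushforward (_ : _ @^-1` _ = `]a - y, b - y]%classic); last first.
  by apply/seteqP; split => x /=; rewrite !in_itv/= ltrBlDr lerBrDr.
rewrite /= !lebesgue_measure_itv/= !lte_fin ltrD2r.
by case: ifP => // _; rewrite -!EFinD; congr EFin; ring.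
Qed.

Lemma integrable_on_shift a b y f : measurable_fun setT f ->
  integrable_on (a + y) (b + y) f <-> integrable_on a b (fun x => f (x + y)).
Proof.
have pre c d z : (fun x => x + z) @^-1` `[c + z, d + z] = `[c, d]%classic :> set R.
  by apply/seteqP; split => x /=; rewrite !in_itv/= !lerD2r.
have key c d z (h : R -> R) : measurable_fun setT h ->
    integrable_on c d (fun x => h (x + z)) -> integrable_on (c + z) (d + z) h.
  move=> mh ih.
  have mE : measurable_fun setT (EFin \o h) by exact/measurable_EFinP.
  have := @integrable_pushforward _ _ (measurableTypeR R) (measurableTypeR R) R (fun x : R => x + z)
    (mshift z) mu `[c + z, d + z]%classic (EFin \o h) mE.
  rewrite pre => /(_ ih (measurable_itv _)) /integrableP[m1 m2].
  apply/integrableP; split => //.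
  apply: le_lt_trans m2; rewrite le_eqVlt; apply/orP; left; apply/eqP.
  apply: eq_measure_integral; first exact: mshift.
  by move=> mz A mA _; apply/esym/lebesgue_measure_shift.
move=> mf; split; last exact: key.
move=> ih; have := key (a + y) (b + y) (- y) (fun x => f (x + y)).
rewrite !addrK; apply.
  exact: measurableT_comp mf (mshift y).
by apply: eq_integrable_on ih => x _; rewrite subrK.
Qed.

Lemma integral_on_shift a b y f : measurable_fun setT f ->
  integrable_on (a + y) (b + y) f ->
  \I_[a + y, b + y] f = \I_[a, b] (fun x => f (x + y)).
Proof.
move=> mf /(integrable_on_shift _ _ _ mf) ih; rewrite /integral_on /Rintegral; congr fine.
have mE : measurable_fun setT (EFin \o f) by exact/measurable_EFinP.
have := @integral_pushforward _ _ (measurableTypeR R) (measurableTypeR R) R (fun x : R => x + y)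
    (mshift y) mu `[a + y, b + y]%classic (EFin \o f) mE.
have -> : (fun x => x + y) @^-1` `[a + y, b + y] = `[a, b]%classic :> set R.
  by apply/seteqP; split => x /=; rewrite !in_itv/= !lerD2r.
move=> /(_ ih (measurable_itv _)) <-.
apply: eq_measure_integral; first exact: mshift.
  by move=> mz A mA _; apply/esym/lebesgue_measure_shift.
Qed.

Lemma integrable_on_glue a c b f : a <= c -> c <= b ->
  integrable_on a c f -> integrable_on c b f -> integrable_on a b f.
Proof.
move=> ac cb f1 f2.
have E : `[a, b]%classic = `[a, c] `|` `]c, b] :> set R.
  by rewrite (@itv_bndbnd_setU _ _ _ (BRight c))// bnd_simp.
have f2' : mu.-integrable `]c, b] (EFin \o f).
  apply: integrableS f2 => // x /=; rewrite !in_itv/= => /andP[/ltW -> ->]//.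
move: f1 f2' => /integrableP[m1 i1] /integrableP[m2 i2].
have mU : measurable_fun (`[a, c] `|` `]c, b]) (EFin \o f).
  by apply/measurable_funU.
apply/integrableP; split; first by rewrite E.
rewrite E ge0_integral_setU//=.
- exact: lte_add_pinfty.
- apply/measurable_EFinP; apply: measurableT_comp => //; exact/measurable_EFinP.
- apply/disj_setPS => y [/=]; rewrite 2!in_itv/= => /andP[_ yx] /andP[].
  by rewrite ltNge yx.
Qed.

Context {L : R} (L0 : 0 < L).

Lemma periodic_integrable_on a b f : measurable_fun setT f -> periodic f L ->
  integrable_on 0 L f -> integrable_on a b f.
Proof.
move=> mf pf f0.
have H (n : nat) : integrable_on 0 (L *+ n) f.
  elim: n => [|n IH].
    by apply: (@integrable_on_sub _ 0 L) => //; rewrite mulr0n ltW.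
  apply: (@integrable_on_glue _ (L *+ n)) => //.
  - by rewrite mulrn_wge0// ltW.
  - by rewrite mulrS lerDr ltW.
  rewrite mulrS -[X in integrable_on X]add0r; apply/integrable_on_shift => //.
  by apply: eq_integrable_on f0 => x _; rewrite periodicn.
pose n := Num.Def.archi_bound (`|a| / L); pose m := Num.Def.archi_bound (`|b| / L).
have an : - a <= L *+ n.
  rewrite (@le_trans _ _ `|a|)//; first by rewrite -normrN ler_norm.
  by rewrite -mulr_natl -ler_pdivrMr// ltW// archi_boundP// divr_ge0// ltW.
have bm : b <= L *+ m.
  rewrite (@le_trans _ _ `|b|)//; first by rewrite ler_norm.
  by rewrite -mulr_natl -ler_pdivrMr// ltW// archi_boundP// divr_ge0// ltW.
apply: (@eq_integrable_on _ _ _ (fun x => f (x + L *+ n))).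
  by move=> x _; rewrite periodicn.
apply/integrable_on_shift => //; apply: integrable_on_sub (H (m + n)%N).
  lra.
by rewrite mulrnDr lerD2r.
Qed.

(** For [z >= 0] compare the two ways of splitting the interval from 0 to [z + L]; the general
case follows by adding periods to [z]. *)
Lemma periodic_integral_on z f : measurable_fun setT f -> periodic f L ->
  integrable_on 0 L f -> \I_[z, z + L] f = \I_[0, L] f.
Proof.
move=> mf pf f0; have fi a b := @periodic_integrable_on a b f mf pf f0.
have shL (n : nat) a b : \I_[a + L *+ n, b + L *+ n] f = \I_[a, b] f.
  by rewrite integral_on_shift//; apply: eq_integral_on => x _; rewrite periodicn.
have pos x : 0 <= x -> \I_[x, x + L] f = \I_[0, L] f.
  move=> x0.
  have xL : x <= x + L by rewrite lerDl ltW.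
  have Lx : L <= x + L by rewrite lerDr.
  have := integral_on_split x0 xL (fi _ _).
  rewrite (integral_on_split (ltW L0) Lx (fi _ _)).
  have := shL 1%N 0 x; rewrite add0r => ->.
  by rewrite addrC => /addrI.
pose n := Num.Def.archi_bound (`|z| / L).
have an : - z <= L *+ n.
  rewrite (@le_trans _ _ `|z|)//; first by rewrite -normrN ler_norm.
  by rewrite -mulr_natl -ler_pdivrMr// ltW// archi_boundP// divr_ge0// ltW.
by rewrite -(shL n) addrAC pos//; lra.
Qed.

Lemma periodic_integral_shift y f : measurable_fun setT f -> periodic f L ->
  integrable_on 0 L f -> \I_[0, L] (fun x => f (x + y)) = \I_[0, L] f.
Proof.
move=> mf pf f0; rewrite -integral_on_shift//; last exact: periodic_integrable_on.
by rewrite add0r addrC periodic_integral_on.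
Qed.

End Shift.

(** * Weak derivatives *)

Section WeakDerivative.
Context {R : realType} {L : R} (L0 : 0 < L).
Implicit Types (a b y : R) (f g : R -> R).
Local Notation mu := (@lebesgue_measure R).

Lemma L2per_sq_integrable a b g : L2per L g -> sq_integrable a b g.
Proof.
move=> [pg mg ig]; split; first exact: measurable_funTS.
apply: (periodic_integrable_on L0) => //; first exact: measurable_funX.
by move=> x; rewrite pg.
Qed.

Lemma weak_derivative_primitive a b f g :
  weak_derivative L f g -> primitive_on a b f g.
Proof.
move=> [hg fg]; split; first exact: L2per_sq_integrable.
by move=> x y _ xy _; exact: fg.
Qed.

(** By Lebesgue's differentiation theorem [k] is almost everywhere the derivative
of its indefinite integral, which is constant. *)
Lemma null_primitive a b c k : primitive_on a b (cst c) k ->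
  \I_[a, b] (fun x => k x ^+ 2) = 0.
Proof.
move=> [hk ck].
have ik := sq_integrable_integrable hk.
have mab : measurable (`[a, b] : set (measurableTypeR R)) by exact: measurable_itv.
pose k' := k \_ `[a, b].
have ik' : mu.-integrable setT (EFin \o k').
  by rewrite -restrict_EFin; apply/integrable_restrict => //=; rewrite setTI.
have := @FTC1Ny R k' _ (integrable_locally mab ik).
have F0 x : (\int[mu]_(t in [set` `]-oo, x]]) k' t = 0)%R.
  rewrite -Rintegral_mkcondr.
  have -> : `]-oo, x] `&` `[a, b] = `[a, Num.min x b]%classic :> set R.
    apply/seteqP; split => t /=; rewrite !in_itv/= le_min.
      by move=> [-> /andP[-> ->]].
    by move=> /and3P[-> -> ->].
  have [am|am] := leP a (Num.min x b).
    have := ck a (Num.min x b) (lexx _) am.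
    by rewrite ge_min lexx orbT subrr => /(_ isT).
  by rewrite set_itv_ge ?Rintegral_set0// bnd_simp -ltNge.
under eq_fun do rewrite F0.
have iy y : mu.-integrable `]-oo, y] (EFin \o k').
  by apply: integrableS ik' => //; exact: measurable_itv.
move=> /(_ iy) H.
rewrite /integral_on /Rintegral.
rewrite (@ae_eq_integral _ _ _ mu `[a, b]%classic (cst 0%E))//.
- by rewrite integral0.
- by case: hk => mk _; apply/measurable_EFinP; exact: measurable_funX.
- move: H; apply: filterS; first exact: (ae_filter_ringOfSetsType mu).
  move=> x /= [_ +] xab.
  rewrite derive1_cst /k' patchE mem_set// => <-.
  by rewrite expr0n.
Qed.

Lemma weak_derivative_unique f g h : weak_derivative L f g ->
  weak_derivative L f h ->
  \I_[0, L] (fun x => (g x - h x) ^+ 2) = 0.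
Proof.
move=> /(weak_derivative_primitive 0 L) fg /(weak_derivative_primitive 0 L) fh.
apply: (@null_primitive _ _ 0); have := primitiveB fg fh.
by congr (primitive_on _ _ _ _); apply/funext => x; rewrite subrr.
Qed.

(** [\int g^2 - \int h^2] is the integral of [(g - h) (g + h)], to which
Cauchy-Schwarz applies. *)
Lemma weak_derivative_norm f g h : weak_derivative L f g ->
  weak_derivative L f h ->
  \I_[0, L] (fun x => g x ^+ 2) = \I_[0, L] (fun x => h x ^+ 2).
Proof.
move=> fg fh; have gh := weak_derivative_unique fg fh.
have [/(L2per_sq_integrable 0 L) sg _] := fg.
have [/(L2per_sq_integrable 0 L) sh _] := fh.
have := cauchy_schwarz_on (sq_integrableB sg sh) (sq_integrableD sg sh).
rewrite gh mul0r exprn_even_le0//=.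
rewrite (@eq_integral_on _ _ _ (fun x => _ * _) (fun x => g x ^+ 2 - h x ^+ 2)); last first.
  by move=> x _; ring.
rewrite integral_onB; [|by case: sg|by case: sh].
by rewrite subr_eq0 => /eqP.
Qed.

Lemma wderivP f : H1per L f -> weak_derivative L f (wderiv L f).
Proof. by move=> [_ [g fg]]; rewrite /wderiv; exact: (@xgetI _ (fun=> 0) _ g). Qed.

Lemma H1norm2E f g : weak_derivative L f g ->
  H1norm2 L f = \I_[0, L] (fun x => f x ^+ 2) + \I_[0, L] (fun x => g x ^+ 2).
Proof.
move=> fg; rewrite /H1norm2 /int_per; congr (_ + _).
have fw : weak_derivative L f (wderiv L f).
  exact: (@xgetI _ (fun=> 0) [set h | weak_derivative L f h] g).
exact: weak_derivative_norm fw fg.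
Qed.

Lemma L2perB f g : L2per L f -> L2per L g -> L2per L (fun x => f x - g x).
Proof.
move=> hf hg; have sfg := sq_integrableB (L2per_sq_integrable 0 L hf)
  (L2per_sq_integrable 0 L hg).
case: hf hg => [pf mf _] [pg mg _]; split => //.
- by move=> x; rewrite pf pg.
- exact: measurable_funB.
- by case: sfg.
Qed.

Lemma weak_derivativeB f g df dg : weak_derivative L f df ->
  weak_derivative L g dg -> weak_derivative L (fun x => f x - g x) (fun x => df x - dg x).
Proof.
move=> [hf ff] [hg gg]; split; first exact: L2perB.
move=> a b ab; rewrite -/(integral_on a b _) integral_onB; last 2 first.
- by apply: sq_integrable_integrable; exact: L2per_sq_integrable.
- by apply: sq_integrable_integrable; exact: L2per_sq_integrable.
by rewrite /integral_on -ff// -gg//; ring.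
Qed.

Lemma L2per_shift y f : L2per L f -> L2per L (fun x => f (x + y)).
Proof.
move=> hf; have [_ h2] := L2per_sq_integrable (0 + y) (L + y) hf.
case: hf => pf mf _.
have ms : measurable_fun [set: R] ((fun x => x + y) : R -> R).
  by apply: measurable_funD => //; exact: measurable_id.
split.
- by move=> x; rewrite addrAC pf.
- exact: measurableT_comp mf ms.
- have m2 : measurable_fun setT (fun x => f x ^+ 2) by exact: measurable_funX.
  by apply/(@integrable_on_shift R 0 L y _ m2).
Qed.

Lemma weak_derivative_shift y f g : weak_derivative L f g ->
  weak_derivative L (fun x => f (x + y)) (fun x => g (x + y)).
Proof.
move=> [hg fg]; split; first exact: L2per_shift.
move=> a b ab; rewrite fg ?lerD2r//.
rewrite -/(integral_on _ _ _) integral_on_shift//; first by case: hg.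
by apply: sq_integrable_integrable; exact: L2per_sq_integrable.
Qed.

Lemma weak_derivative_derivable f g : periodic g L ->
  (forall x, is_derive x (1 : R) f (g x)) -> continuous g -> weak_derivative L f g.
Proof.
move=> pg df cg.
have H a b : a <= b -> primitive_on a b f g.
  by move=> ab; apply: primitive_derivable => // x _; exact: cg.
split.
  split => //; first exact: continuous_measurable_fun.
  by have [[]] := H 0 L (ltW L0).
by move=> a b ab; have [_] := H a b ab; exact.
Qed.

End WeakDerivative.

(** * Differentiation rules for explicit formulas *)

Section DerivativeRules.
Context {R : realType}.
Implicit Types (f g : R -> R) (x a b df dg : R).

Lemma is_derive_as f x df df' :
  is_derive x (1 : R) f df -> df = df' -> is_derive x (1 : R) f df'.
Proof. by move=> H <-. Qed.

Lemma derivative_const a x : is_derive x (1 : R) (fun=> a) 0.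
Proof. exact: is_derive_cst. Qed.

Lemma derivative_id x : is_derive x (1 : R) (fun y => y) 1.
Proof. exact: is_derive_id. Qed.

Lemma derivativeD f g x df dg : is_derive x (1 : R) f df ->
  is_derive x (1 : R) g dg -> is_derive x (1 : R) (fun y => f y + g y) (df + dg).
Proof. by move=> hf hg; exact: is_deriveD. Qed.

Lemma derivativeN f x df : is_derive x (1 : R) f df ->
  is_derive x (1 : R) (fun y => - f y) (- df).
Proof. by move=> hf; exact: is_deriveN. Qed.

Lemma derivativeM f g x df dg : is_derive x (1 : R) f df ->
  is_derive x (1 : R) g dg ->
  is_derive x (1 : R) (fun y => f y * g y) (df * g x + f x * dg).
Proof.
move=> hf hg; apply: (is_derive_as (is_deriveM hf hg)).
by rewrite /GRing.scale/=; ring.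
Qed.

Lemma derivativeX f x df n : is_derive x (1 : R) f df ->
  is_derive x (1 : R) (fun y => f y ^+ n) (n%:R * f x ^+ n.-1 * df).
Proof.
move=> hf; have -> : (fun y => f y ^+ n) = f ^+ n by rewrite exprfctE.
exact: is_deriveX.
Qed.

Lemma derivativeV f x df : f x != 0 -> is_derive x (1 : R) f df ->
  is_derive x (1 : R) (fun y => (f y)^-1) (- df / f x ^+ 2).
Proof.
move=> f0 hf; apply: (is_derive_as (is_deriveV f0 hf)).
by rewrite /GRing.scale/=; field.
Qed.

Lemma derivative_comp f g x df dg : is_derive (g x) (1 : R) f df ->
  is_derive x (1 : R) g dg -> is_derive x (1 : R) (fun y => f (g y)) (df * dg).
Proof. by move=> hf hg; exact: is_derive1_comp. Qed.

Lemma is_derive_continuous f x df : is_derive x (1 : R) f df -> {for x, continuous f}.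
Proof.
by move=> [hf _]; apply: differentiable_continuous; apply/derivable1_diffP.
Qed.

Lemma derivative0_cst f : (forall x, is_derive x (1 : R) f 0) -> forall x y, f x = f y.
Proof. by move=> H x y; apply: is_derive_0_is_cst => z; exact: H. Qed.

End DerivativeRules.

(** Differentiates an algebraic expression in functions whose derivatives are
hypotheses of the form [forall x, is_derive x 1 f (f' x)], leaving the equation
between the derivative found and the one announced. *)
Ltac derivative_rule :=
  match goal with
  | H : forall x, is_derive x _ ?f _ |- is_derive _ _ ?f _ => notypeclasses refine (H _)
  | H : forall x, is_derive x _ ?f _ |- is_derive _ _ (fun y => ?f y) _ =>
      notypeclasses refine (H _)
  | |- is_derive _ _ (fun y => y) _ => notypeclasses refine (derivative_id _)
  | |- is_derive _ _ (fun y => ?a) _ => notypeclasses refine (derivative_const a _)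
  | |- is_derive _ _ (fun y => _ ^+ _) _ => simple notypeclasses refine (derivativeX _ _)
  | |- is_derive _ _ (fun y => _ * _) _ => simple notypeclasses refine (derivativeM _ _)
  | |- is_derive _ _ (fun y => - _) _ => simple notypeclasses refine (derivativeN _)
  | |- is_derive _ _ (fun y => _ + _) _ => simple notypeclasses refine (derivativeD _ _)
  end.

Ltac differentiate :=
  simple notypeclasses refine (is_derive_as _ _); [|repeat derivative_rule|];
  rewrite /= ?expr1.

(** * Oriented integrals of continuous functions *)

(** Written so that the incomplete elliptic integral is an instance of it by
conversion. *)
Definition oriented_integral (R : realType) (f : R -> R) (a : R) : R :=
  if 0 <= a then \I_[0, a] f else - \I_[a, 0] f.

Section OrientedIntegral.
Context {R : realType}.
Implicit Types (f : R -> R) (x : R).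

Lemma continuous_integrable_on a b f : continuous f -> integrable_on a b f.
Proof. by move=> cf; apply: integrable_on_continuous; exact: continuous_subspaceT. Qed.

Lemma oriented_integral0 f : oriented_integral f 0 = 0.
Proof. by rewrite /oriented_integral lexx integral_on_pt. Qed.

Lemma is_derive_oriented_integral f x : continuous f ->
  is_derive x (1 : R) (oriented_integral f) (f x).
Proof.
move=> cf; have fi a b := continuous_integrable_on a b cf.
pose b := - (`|x| + 1).
have bx : b < x by rewrite /b; have := ler_norm (- x); rewrite normrN; lra.
have b0 : b <= 0 by rewrite /b; have := normr_ge0 x; lra.
have xx : x < x + 1 by rewrite ltrDl.
have [D1 D2] := @continuous_FTC1_closed _ f b x (x + 1) xx (fi _ _) bx (cf x).
have H : is_derive x (1 : R) (fun y => \I_[b, y] f) (f x).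
  by split; [exact: D1|rewrite -derive1E; exact: D2].
apply: (@near_eq_is_derive _ _ _ (fun y => \I_[b, y] f + - \I_[b, 0] f)); last first.
  by apply: (is_derive_as (derivativeD H (derivative_const _ x))); rewrite addr0.
near=> y.
have yb : b <= y by rewrite ltW//; near: y; exact: lt_nbhsr.
rewrite /oriented_integral; case: ifPn => y0.
  by rewrite (integral_on_split b0 y0)//; ring.
rewrite -ltNge in y0.
by rewrite (integral_on_split yb (ltW y0))//; ring.
Unshelve. all: by end_near. Qed.

End OrientedIntegral.

(** * The Jacobi amplitude *)

Section Amplitude.
Context {R : realType} {k : R} (hk : 0 < k < 1).
Implicit Types (a x y : R).

Let k2 : 0 < k ^+ 2 < 1.
Proof. by case/andP: hk => k0 k1; rewrite exprn_gt0//= exprn_ilt1// ltW. Qed.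

Definition jacobi_delta a : R := Num.sqrt (1 - k ^+ 2 * sin a ^+ 2).

Lemma jacobi_delta_arg a : 0 < 1 - k ^+ 2 * sin a ^+ 2 <= 1.
Proof. have := cos2Dsin2 a; have := sqr_ge0 (cos a); case/andP: k2; nra. Qed.

Lemma jacobi_delta_gt0 a : 0 < jacobi_delta a.
Proof. by rewrite sqrtr_gt0; case/andP: (jacobi_delta_arg a). Qed.

Lemma jacobi_delta_le1 a : jacobi_delta a <= 1.
Proof. by rewrite -[leRHS]sqrtr1 ler_wsqrtr//; case/andP: (jacobi_delta_arg a). Qed.

Lemma sqr_jacobi_delta a : jacobi_delta a ^+ 2 = 1 - k ^+ 2 * sin a ^+ 2.
Proof. by rewrite sqr_sqrtr// ltW//; case/andP: (jacobi_delta_arg a). Qed.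

Lemma is_derive_jacobi_delta a : is_derive a (1 : R) jacobi_delta
  (- (k ^+ 2 * sin a * cos a / jacobi_delta a)).
Proof.
have ds x : is_derive x (1 : R) sin (cos x) by exact: is_derive_sin.
have dq : is_derive a (1 : R) (fun y => 1 + - (k ^+ 2 * sin y ^+ 2))
    (- (k ^+ 2 * (2 * sin a * cos a))).
  by differentiate; ring.
have /andP[q0 _] := jacobi_delta_arg a.
have H := @derivative_comp _ Num.sqrt (fun y => 1 + - (k ^+ 2 * sin y ^+ 2)) a _ _
  (is_derive1_sqrt q0) dq.
apply: (is_derive_as H).
by rewrite -/(jacobi_delta a); have := jacobi_delta_gt0 a => d0; field; lra.
Qed.

Lemma continuous_ellip_integrand : continuous (ellip_integrand k).
Proof.
move=> x; apply: is_derive_continuous.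
apply: (@derivativeV _ jacobi_delta); last exact: is_derive_jacobi_delta.
by rewrite gt_eqF// jacobi_delta_gt0.
Qed.

Lemma is_derive_ellipF a : is_derive a (1 : R) (ellipF k) (jacobi_delta a)^-1.
Proof. exact: is_derive_oriented_integral continuous_ellip_integrand. Qed.

(** The integrand is at least 1; this gives injectivity and, through the
intermediate value theorem, surjectivity. *)
Lemma ellipF_expanding a b : a <= b -> b - a <= ellipF k b - ellipF k a.
Proof.
move=> ab.
have df x : is_derive x (1 : R) (fun y => ellipF k y + - y) ((jacobi_delta x)^-1 + - 1).
  exact: (derivativeD (is_derive_ellipF x) (derivativeN (derivative_id x))).
have := @ger0_derive1_ndecr _ (fun y => ellipF k y + - y) a b.
move=> /(_ _ _ _ a b (lexx _) ab (lexx _)) H.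
rewrite -subr_ge0 [leRHS](_ : _ = (ellipF k b + - b) - (ellipF k a + - a)); last by ring.
rewrite subr_ge0; apply: H.
- by move=> x _; case: (df x).
- move=> x _; rewrite derive1E; case: (df x) => _ ->.
  by rewrite subr_ge0 invf_ge1 ?jacobi_delta_gt0// jacobi_delta_le1.
- by apply: continuous_subspaceT => x; apply: is_derive_continuous (df x).
Qed.

Lemma ellipF0 : ellipF k 0 = 0.
Proof. exact: oriented_integral0. Qed.

Lemma ellipF_lt a b : a < b -> ellipF k a < ellipF k b.
Proof. by move=> ab; have := ellipF_expanding (ltW ab); lra. Qed.

Lemma ellipF_inj : injective (ellipF k).
Proof.
move=> a b; have [ab|ba|//] := ltgtP a b.
  by have := ellipF_lt ab => /[swap] ->; rewrite ltxx.
by have := ellipF_lt ba => /[swap] ->; rewrite ltxx.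
Qed.

Lemma ellipF_surj x : exists a, ellipF k a = x.
Proof.
have n0 := normr_ge0 x.
have Np : - `|x| <= `|x| by lra.
have := @IVT _ (ellipF k) (- `|x|) `|x| x Np.
case.
- by apply: continuous_subspaceT => y; apply: is_derive_continuous (is_derive_ellipF y).
- have := @ellipF_expanding 0 `|x| n0; have := @ellipF_expanding (- `|x|) 0.
  rewrite ellipF0 oppr_le0 => /(_ n0) h1 h2.
  have := ler_norm x; have := ler_norm (- x); rewrite normrN => h3 h4.
  rewrite ge_min le_max; apply/andP; split; apply/orP; [left|right]; lra.
- by move=> c _ <-; exists c.
Qed.

Lemma ellipF_am x : ellipF k (jacobi_am k x) = x.
Proof.
have [a ax] := ellipF_surj x.
exact: (@xgetI _ 0 [set a | ellipF k a = x] a ax).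
Qed.

Lemma am_ellipF a : jacobi_am k (ellipF k a) = a.
Proof. by apply: ellipF_inj; rewrite ellipF_am. Qed.

Lemma is_derive_am x : is_derive x (1 : R) (jacobi_am k) (jacobi_delta (jacobi_am k x)).
Proof.
rewrite -{1}(ellipF_am x).
rewrite -[X in is_derive _ _ _ X]invrK; apply: is_derive_inverse.
- by near=> y; exact: am_ellipF.
- by near=> y; apply: is_derive_continuous (is_derive_ellipF y).
- exact: is_derive_ellipF.
- by rewrite invr_eq0 gt_eqF// jacobi_delta_gt0.
Unshelve. all: by end_near. Qed.

Lemma am_lt x y : x < y -> jacobi_am k x < jacobi_am k y.
Proof.
move=> xy; rewrite ltNge le_eqVlt; apply/negP => /predU1P[e|/ellipF_lt].
  by move: xy; rewrite -(ellipF_am x) -(ellipF_am y) e ltxx.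
by rewrite !ellipF_am => /(lt_trans xy); rewrite ltxx.
Qed.

Lemma ellipK_ellipF : ellipK k = ellipF k (pi / 2).
Proof. by rewrite /ellipF divr_ge0// pi_ge0. Qed.

Lemma ellipK_gt0 : 0 < ellipK k.
Proof. by rewrite ellipK_ellipF -ellipF0; apply: ellipF_lt; rewrite divr_gt0// pi_gt0. Qed.

Lemma jacobi_deltaDpi a : jacobi_delta (a + pi) = jacobi_delta a.
Proof. by rewrite /jacobi_delta sinDpi sqrrN. Qed.

Lemma jacobi_deltaN a : jacobi_delta (- a) = jacobi_delta a.
Proof. by rewrite /jacobi_delta sinN sqrrN. Qed.

Lemma ellipFN a : ellipF k (- a) = - ellipF k a.
Proof.
have df x : is_derive x (1 : R) (fun y => ellipF k (- y) + ellipF k y) 0.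
  have dn : is_derive x (1 : R) (fun y : R => - y) (- 1).
    exact: (derivativeN (derivative_id x)).
  apply: (is_derive_as (derivativeD (derivative_comp (is_derive_ellipF _) dn)
    (is_derive_ellipF x))).
  by rewrite jacobi_deltaN; ring.
have := derivative0_cst df a 0; rewrite oppr0 ellipF0 addr0 => /eqP.
by rewrite addr_eq0 => /eqP.
Qed.

(** The two sides have the same derivative since [jacobi_delta] has period [pi],
and they agree at [- pi / 2] by oddness. *)
Lemma ellipFDpi a : ellipF k (a + pi) = ellipF k a + 2 * ellipK k.
Proof.
have df x : is_derive x (1 : R) (fun y => ellipF k (y + pi) + - ellipF k y) 0.
  have dn : is_derive x (1 : R) (fun y : R => y + pi) (1 + 0).
    exact: (derivativeD (derivative_id x) (derivative_const pi x)).
  apply: (is_derive_as (derivativeD (derivative_comp (is_derive_ellipF _) dn)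
    (derivativeN (is_derive_ellipF x)))).
  by rewrite jacobi_deltaDpi; ring.
have := derivative0_cst df a (- (pi / 2)).
rewrite (_ : - (pi / 2) + pi = pi / 2); last by field.
by rewrite ellipFN -ellipK_ellipF; lra.
Qed.

Lemma amD2K x : jacobi_am k (x + 2 * ellipK k) = jacobi_am k x + pi.
Proof. by apply: ellipF_inj; rewrite ellipF_am ellipFDpi ellipF_am. Qed.

End Amplitude.

(** * Profiles of periodic travelling waves *)

(** The properties of the cnoidal wave on which the stability argument rests.
The sign of the integration constant [wave_b] of the quadrature decides the sign
of the derivative of the momentum with respect to the speed, through
[mean_sqr_ge]. *)
Record wave_profile (R : realType) (L c : R) (psi : R -> R) := WaveProfile {
  dpsi : R -> R;
  wave_b : R;
  psi_periodic : periodic psi L;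
  dpsi_periodic : periodic dpsi L;
  is_derive_psi : forall x, is_derive x (1 : R) psi (dpsi x);
  is_derive_dpsi : forall x, is_derive x (1 : R) dpsi (c * psi x - 2^-1 * psi x ^+ 2);
  wave_quadrature : forall x,
    dpsi x ^+ 2 = - (3^-1 * psi x ^+ 3) + c * psi x ^+ 2 - wave_b;
  psi_gt0 : forall x, 0 < psi x;
  wave_c_gt0 : 0 < c;
  wave_b_gt0 : 0 < wave_b;
  dpsi_neq0 : exists x, dpsi x != 0
}.

(** In the spirit of Sturm's oscillation theorem, such an [f] bounds the form of
[- d^2/dx^2 + V] from below by [lam] on the functions vanishing at its nodes. *)
Record two_node_solution (R : realType) (L lam : R) (V f : R -> R) := TwoNode {
  df : R -> R;
  node0 : R;
  node1 : R;
  is_derive_f : forall x, is_derive x (1 : R) f (df x);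
  is_derive_df : forall x, is_derive x (1 : R) df ((V x - lam) * f x);
  node_lt : node0 < node1 < node0 + L;
  f_node : [/\ f node0 = 0, f node1 = 0 & f (node0 + L) = 0];
  df_node : [/\ df node0 != 0, df node1 != 0 & df (node0 + L) != 0];
  f_neq0 : forall x, (node0 < x < node1) || (node1 < x < node0 + L) -> f x != 0
}.

Section Cnoidal.
Context {R : realType} {k L : R} (hk : 0 < k < 1) (L0 : 0 < L).
Implicit Types (x : R).

Let nu := 2 * ellipK k / L.
Let w := Num.sqrt (1 - k ^+ 2 + k ^+ 4).

Definition cnoidal_speed : R := 16 * ellipK k ^+ 2 / L ^+ 2 * w.

Let A x := jacobi_am k (nu * x).
Let S x := sin (A x).
Let C x := cos (A x).
Let D x := jacobi_delta (k := k) (A x).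

Let nu_gt0 : 0 < nu.
Proof. by rewrite divr_gt0// mulr_gt0// ellipK_gt0. Qed.

Let k2 : 0 < k ^+ 2 < 1.
Proof. by case/andP: hk => k0 k1; rewrite exprn_gt0//= exprn_ilt1// ltW. Qed.

Let w2 : w ^+ 2 = 1 - k ^+ 2 + k ^+ 4.
Proof.
rewrite sqr_sqrtr// (_ : k ^+ 4 = k ^+ 2 * k ^+ 2); last by ring.
by case/andP: k2; move: (k ^+ 2) => m; nra.
Qed.

Let w_gt0 : 0 < w.
Proof.
rewrite sqrtr_gt0 (_ : k ^+ 4 = k ^+ 2 * k ^+ 2); last by ring.
by case/andP: k2; move: (k ^+ 2) => m; nra.
Qed.

Let C2 x : C x ^+ 2 = 1 - S x ^+ 2.
Proof. by rewrite -(cos2Dsin2 (A x)) addrK. Qed.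

Let D2 x : D x ^+ 2 = 1 - k ^+ 2 * S x ^+ 2.
Proof. exact: sqr_jacobi_delta. Qed.

Let AL x : A (x + L) = A x + pi.
Proof.
rewrite /A -(amD2K hk); congr jacobi_am; rewrite /nu; field.
by rewrite gt_eqF.
Qed.

Let SL x : S (x + L) = - S x. Proof. by rewrite /S AL sinDpi. Qed.
Let CL x : C (x + L) = - C x. Proof. by rewrite /C AL cosDpi. Qed.
Let DL x : D (x + L) = D x. Proof. by rewrite /D AL jacobi_deltaDpi. Qed.

Let dA x : is_derive x (1 : R) A (D x * nu).
Proof.
have h : is_derive x (1 : R) (fun y => nu * y) (0 * x + nu * 1).
  exact: (derivativeM (derivative_const nu x) (derivative_id x)).
have h2 := @derivative_comp _ (jacobi_am k) _ x _ _ (is_derive_am hk _) h.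
by apply: (is_derive_as h2); rewrite /D /A; ring.
Qed.

Let dS x : is_derive x (1 : R) S (nu * C x * D x).
Proof.
apply: (is_derive_as (@derivative_comp _ sin A x _ _ (is_derive_sin _) (dA x))).
by rewrite -/(C x); ring.
Qed.

Let dC x : is_derive x (1 : R) C (- (nu * S x * D x)).
Proof.
apply: (is_derive_as (@derivative_comp _ cos A x _ _ (is_derive_cos _) (dA x))).
by rewrite -/(S x); ring.
Qed.

Let dD x : is_derive x (1 : R) D (- (nu * k ^+ 2 * S x * C x)).
Proof.
apply: (is_derive_as (@derivative_comp _ _ A x _ _ (is_derive_jacobi_delta hk _) (dA x))).
rewrite -/(C x) -/(S x) -/(D x); field.
by rewrite gt_eqF// jacobi_delta_gt0.
Qed.

Let psi := tvarphi L k.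

Let psiE : psi = fun x => 4 * nu ^+ 2 * (w + 1 - 2 * k ^+ 2)
  + 12 * nu ^+ 2 * k ^+ 2 * C x ^+ 2.
Proof.
apply/funext => x; rewrite /psi /tvarphi /jacobi_cn -/w -/nu -/(A x) -/(C x) /nu.
by field; rewrite gt_eqF.
Qed.

Let speedE : cnoidal_speed = 4 * nu ^+ 2 * w.
Proof. by rewrite /cnoidal_speed /nu; field; rewrite gt_eqF. Qed.

Let psi1 x := - (24 * nu ^+ 3 * k ^+ 2) * (C x * (S x * D x)).

Let dpsi1 x : is_derive x (1 : R) psi (psi1 x).
Proof.
by rewrite psiE; differentiate; rewrite /psi1; ring.
Qed.

Let dpsi2 x : is_derive x (1 : R) psi1
  (cnoidal_speed * psi x - 2^-1 * psi x ^+ 2).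
Proof.
rewrite /psi1; differentiate; rewrite speedE psiE.
transitivity (- (24 * nu ^+ 4 * k ^+ 2) *
   (C x ^+ 2 * D x ^+ 2 - S x ^+ 2 * D x ^+ 2 - k ^+ 2 * (S x ^+ 2 * C x ^+ 2))).
  by ring.
rewrite C2 D2.
rewrite [RHS](_ : _ = - (24 * nu ^+ 4 * k ^+ 2) *
   ((1 - S x ^+ 2) * (1 - k ^+ 2 * S x ^+ 2) - S x ^+ 2 * (1 - k ^+ 2 * S x ^+ 2) - k ^+ 2 * (S x ^+ 2 * (1 - S x ^+ 2)))
   + 8 * nu ^+ 4 * (w ^+ 2 - (1 - k ^+ 2 + k ^+ 4))).
  by rewrite w2 subrr mulr0 addr0.
by field.
Qed.

Lemma cnoidal_profile : wave_profile L cnoidal_speed (tvarphi L k).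
Proof.
have A0 : A 0 = 0 by rewrite /A mulr0 -[X in jacobi_am k X](@ellipF0 _ k) am_ellipF.
have S0 : S 0 = 0 by rewrite /S A0 sin0.
have C0 : C 0 = 1 by rewrite /C A0 cos0.
pose al := 4 * nu ^+ 2 * (w + 1 + k ^+ 2).
have nu2 : 0 < nu ^+ 2 by rewrite exprn_gt0.
have k4 : k ^+ 4 = k ^+ 2 * k ^+ 2 by ring.
pose b := al ^+ 2 * (cnoidal_speed - al / 3).
apply: (@WaveProfile R L cnoidal_speed (tvarphi L k) psi1 b).
- by move=> x; rewrite -/psi psiE CL sqrrN.
- by move=> x; rewrite /psi1 CL SL DL; ring.
- exact: dpsi1.
- exact: dpsi2.
- move=> x.
  (* the quadrature is the conservation of energy, evaluated at the crest *)
  have d3 y : is_derive y (1 : R) (fun y => psi1 y ^+ 2 + 3^-1 * psi y ^+ 3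
      - cnoidal_speed * psi y ^+ 2) 0.
    by differentiate; field.
  have := derivative0_cst d3 x 0.
  have -> : psi 0 = al by rewrite psiE C0 /al; ring.
  have -> : psi1 0 = 0 by rewrite /psi1 S0; ring.
  rewrite /b -/psi => H.
  have -> : psi1 x ^+ 2 = (psi1 x ^+ 2 + 3^-1 * psi x ^+ 3 - cnoidal_speed * psi x ^+ 2)
     - 3^-1 * psi x ^+ 3 + cnoidal_speed * psi x ^+ 2 by ring.
  by rewrite H; field.
- move=> x; rewrite -/psi psiE.
  have h : 0 < w + 1 - 2 * k ^+ 2.
    have := w2; have := w_gt0; rewrite k4; case/andP: k2.
    by move: (k ^+ 2) => m; nra.
  have p1 : 0 < 4 * nu ^+ 2 * (w + 1 - 2 * k ^+ 2) by rewrite mulr_gt0// mulr_gt0.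
  rewrite ltr_wpDr//.
  by rewrite mulr_ge0 ?sqr_ge0// mulr_ge0 ?sqr_ge0// mulr_ge0 ?sqr_ge0.
- by rewrite speedE mulr_gt0// mulr_gt0.
- have h : 0 < 2 * w - 1 - k ^+ 2.
    have := w2; have := w_gt0; rewrite k4; case/andP: k2.
    by move: (k ^+ 2) => m; nra.
  have al0 : 0 < al.
    have p1 : 0 < w + 1 + k ^+ 2 by have := w_gt0; case/andP: k2; lra.
    by rewrite /al mulr_gt0// mulr_gt0.
  rewrite /b mulr_gt0 ?exprn_gt0// speedE /al.
  rewrite (_ : _ - _ = 4 * nu ^+ 2 * (2 * w - 1 - k ^+ 2) / 3); last by field.
  by rewrite divr_gt0// mulr_gt0// mulr_gt0.
- exists (ellipF k (pi / 4) / nu).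
  have E : A (ellipF k (pi / 4) / nu) = pi / 4.
    by rewrite /A mulrC divfK ?gt_eqF// am_ellipF.
  rewrite /psi1 /C /S /D E.
  have pi0 : 0 < pi / 4 :> R by rewrite divr_gt0// pi_gt0.
  have pi1 : pi / 4 < pi / 2 :> R by have := @pi_gt0 R; lra.
  have n3 : 0 < nu ^+ 3 by rewrite exprn_gt0.
  have kk : 0 < k ^+ 2 by case/andP: k2.
  have h24 : 0 < 24 * nu ^+ 3 * k ^+ 2 by rewrite mulr_gt0// mulr_gt0.
  have hc : 0 < cos (pi / 4) :> R by apply: cos_gt0_pihalf; lra.
  have hs : 0 < sin (pi / 4) :> R by apply: sin_gt0_pihalf; rewrite pi0.
  have hd := @jacobi_delta_gt0 _ _ hk (pi / 4).
  by rewrite mulf_neq0 ?oppr_eq0 ?gt_eqF// mulr_gt0// mulr_gt0.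
Qed.

(** Up to scaling and translation of the spectrum, [- d^2/dx^2 + c - psi] is
Lamé's operator [- d^2/dy^2 + 12 k^2 sn^2], whose periodic spectrum starts with
three explicit eigenfunctions. The derivative of the wave is the second one;
[chi = dn (1 - ga sn^2)], where [ga] is the larger root of
[ga^2 - (2 + 4 k^2) ga + 5 k^2 = 0], is the third one, so that its eigenvalue
[lam] is positive. Its nodes in a period are the points where [sn^2 = 1 / ga]. *)
Lemma cnoidal_two_node : exists2 lam, 0 < lam &
  exists chi, inhabited (two_node_solution L lam
    (fun x => cnoidal_speed - tvarphi L k x) chi).
Proof.
have k4 : k ^+ 4 = k ^+ 2 * k ^+ 2 by ring.
pose sg := Num.sqrt (1 - k ^+ 2 + 4 * k ^+ 4).
have sgp : 0 < 1 - k ^+ 2 + 4 * k ^+ 4.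
  by rewrite k4; case/andP: k2; move: (k ^+ 2) => m; nra.
have sg0 : 0 < sg by rewrite sqrtr_gt0.
have sg2 : sg ^+ 2 = 1 - k ^+ 2 + 4 * k ^+ 4 by rewrite sqr_sqrtr// ltW.
pose ga := 1 + 2 * k ^+ 2 + sg.
have ga1 : 1 < ga by rewrite /ga; case/andP: k2; lra.
have ga0 : 0 < ga by lra.
have gaE : ga ^+ 2 = (2 + 4 * k ^+ 2) * ga - 5 * k ^+ 2.
  have -> : ga ^+ 2 = (1 + 2 * k ^+ 2) ^+ 2 + 2 * (1 + 2 * k ^+ 2) * sg + sg ^+ 2.
    by rewrite /ga; ring.
  by rewrite sg2 /ga; ring.
pose lam := nu ^+ 2 * (k ^+ 2 - 2 + 2 * sg).
have lam0 : 0 < lam.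
  rewrite mulr_gt0 ?exprn_gt0//.
  by move: sg2 sg0; rewrite k4; case/andP: k2; move: (k ^+ 2) => m; nra.
pose chi x := D x * (1 - ga * S x ^+ 2).
pose dchi x := - nu * (S x * (C x * (k ^+ 2 + 2 * ga - 3 * ga * k ^+ 2 * S x ^+ 2))).
exists lam => //; exists chi; split.
pose s0 := Num.sqrt ga^-1.
have gai : 0 < ga^-1 < 1 by rewrite invr_gt0 ga0/= invf_lt1.
have s00 : 0 < s0 by rewrite sqrtr_gt0; case/andP: gai.
have s02 : s0 ^+ 2 = ga^-1 by rewrite sqr_sqrtr// ltW//; case/andP: gai.
have s01 : s0 < 1.
  by case/andP: gai => g0 g1; rewrite -(ltr_pXn2r (ltn0Sn 1)) ?nnegrE ?(ltW s00)// s02 expr1n.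
have s0i : -1 <= s0 <= 1 by apply/andP; split; lra.
pose a0 := asin s0.
have sa0 : sin a0 = s0 by rewrite /a0 asinK// in_itv.
have a0p : a0 < pi / 2 by apply: asin_ltpi2; apply/andP; split; lra.
have pi0 := @pi_gt0 R.
have a0m : - (pi / 2) < a0 by apply: asin_gtNpi2; apply/andP; split; lra.
have a00 : 0 < a0.
  have := @ltr_sin R 0 a0; rewrite !in_itv/= sin0 sa0 s00 => <- //; apply/andP; split; lra.
have a0pi : a0 < pi - a0 by lra.
have pia0 : pi - a0 < a0 + pi by lra.
(* [X] inverts the amplitude [A]: the nodes are found by their amplitudes *)
pose X a := ellipF k a / nu.
have AX a : A (X a) = a by rewrite /A /X mulrC divfK ?gt_eqF// am_ellipF.
have XL a : X a + L = X (a + pi).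
  by rewrite /X ellipFDpi// mulrDl; congr (_ + _); rewrite /nu; field;
     rewrite !gt_eqF// ellipK_gt0.
have Xlt a a' : a < a' -> X a < X a'.
  by move=> aa; rewrite /X ltr_pM2r ?invr_gt0// ellipF_lt.
have Altl a x : X a < x -> a < A x.
  by move=> h; rewrite -(AX a) /A am_lt// ltr_pM2l.
have Altr a x : x < X a -> A x < a.
  by move=> h; rewrite -(AX a) /A am_lt// ltr_pM2l.
have sin_small t : - a0 < t < a0 -> sin t ^+ 2 < s0 ^+ 2.
  move=> /andP[t1 t2].
  have h1 : sin t < s0 by rewrite -sa0 ltr_sin// in_itv/=; apply/andP; split; lra.
  have h2 : - s0 < sin t by rewrite -sa0 -sinN ltr_sin// in_itv/=; apply/andP; split; lra.
  by nra.
have sin_large t : a0 < t < pi - a0 -> s0 ^+ 2 < sin t ^+ 2.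
  move=> /andP[t1 t2].
  have h1 : s0 < sin t.
    have [tp|tp] := leP t (pi / 2).
      by rewrite -sa0 ltr_sin// in_itv/=; apply/andP; split; lra.
    have -> : sin t = sin (pi - t) by rewrite sinB sinpi cospi; ring.
    have t3 : a0 < pi - t by lra.
    by rewrite -sa0 ltr_sin// in_itv/=; apply/andP; split; lra.
  by nra.
have chiE x : S x ^+ 2 = s0 ^+ 2 -> chi x = 0.
  by move=> h; rewrite /chi h s02 divff ?gt_eqF// subrr mulr0.
have chi_neq0 x : S x ^+ 2 != s0 ^+ 2 -> chi x != 0.
  move=> h; have D0 : D x != 0 by rewrite gt_eqF// jacobi_delta_gt0.
  rewrite mulf_neq0//; apply: contra h; rewrite subr_eq0 => /eqP h; rewrite s02.
  by apply/eqP; rewrite -[RHS]mulr1 h mulrA mulVf ?mul1r// gt_eqF.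
have dchi_neq0 x : S x ^+ 2 = s0 ^+ 2 -> dchi x != 0.
  move=> h.
  have C0 : C x ^+ 2 != 0.
    by rewrite C2 h s02 subr_eq0 gt_eqF//; case/andP: gai.
  have S0 : S x ^+ 2 != 0 by rewrite h expf_neq0// gt_eqF.
  have S1 : S x != 0 by move: S0; rewrite expf_eq0.
  have C1 : C x != 0 by move: C0; rewrite expf_eq0.
  have nu1 : - nu != 0 by rewrite oppr_eq0 gt_eqF.
  rewrite /dchi mulf_neq0// mulf_neq0// mulf_neq0//.
  rewrite h s02 (_ : _ - _ = 2 * ga - 2 * k ^+ 2); last by field; rewrite gt_eqF.
  by rewrite gt_eqF// subr_gt0; case/andP: k2; lra.
have N0 : S (X a0) ^+ 2 = s0 ^+ 2 by rewrite /S AX sa0.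
have N1 : S (X (pi - a0)) ^+ 2 = s0 ^+ 2.
  by rewrite /S AX sinB sinpi cospi sa0; congr (_ ^+ 2); ring.
have N2 : S (X a0 + L) ^+ 2 = s0 ^+ 2 by rewrite SL sqrrN N0.
apply: (@TwoNode R L lam _ chi dchi (X a0) (X (pi - a0))).
- by move=> x; rewrite /chi; differentiate; rewrite /dchi;
    rewrite (_ : k ^+ 2 + 2 * ga - 3 * ga * k ^+ 2 * S x ^+ 2 =
      k ^+ 2 * (1 - ga * S x ^+ 2) + 2 * ga * D x ^+ 2); [ring|rewrite D2; ring].
- move=> x; rewrite /dchi; differentiate; rewrite -/psi speedE psiE /chi.
  pose t := S x ^+ 2.
  transitivity (- nu ^+ 2 * D x * ((C x ^+ 2 - t) * (k ^+ 2 + 2 * ga - 3 * ga * k ^+ 2 * t)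
     - 6 * ga * k ^+ 2 * t * C x ^+ 2)).
    by rewrite /t; ring.
  rewrite C2 -/t /lam.
  have sgE : sg = ga - 1 - 2 * k ^+ 2 by rewrite /ga; ring.
  rewrite sgE.
  transitivity (- nu ^+ 2 * D x * ((1 - t - t) * (k ^+ 2 + 2 * ga - 3 * ga * k ^+ 2 * t)
     - 6 * ga * k ^+ 2 * t * (1 - t))
     + 2 * nu ^+ 2 * D x * t * (ga ^+ 2 - ((2 + 4 * k ^+ 2) * ga - 5 * k ^+ 2))).
    by rewrite gaE subrr mulr0 addr0.
  by ring.
- by rewrite XL !Xlt.
- by split; apply: chiE.
- by split; apply: dchi_neq0.
- move=> x /orP[/andP[x1 x2]|/andP[x1 x2]]; apply: chi_neq0.
    by rewrite gt_eqF// sin_large// Altl//= Altr.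
  rewrite lt_eqF//; rewrite XL in x2.
  have -> : S x ^+ 2 = sin (A x - pi) ^+ 2.
    by rewrite sinB sinpi cospi /S; ring.
  have y1 := Altl _ _ x1; have y2 := Altr _ _ x2.
  by apply: sin_small; rewrite ltrBrDr ltrBlDr (addrC (- a0)) y1 y2.
Qed.

End Cnoidal.

(** * Riccati equations and positivity of quadratic forms *)

Section Picone.
Context {R : realType}.
Implicit Types (a b x e : R) (p gp f h q : R -> R).

Lemma primitive_mul_integrable a b p gp h : primitive_on a b p gp ->
  integrable_on a b h -> integrable_on a b (fun x => h x * p x).
Proof.
move=> hp ih; have [M pM] := primitive_bounded hp.
apply: (@le_integrable_on _ _ _ _ (fun x => M * `|h x|)).
- apply: measurable_funM; first exact: measurable_integrable_on.
  by have [mp _] := primitive_sq_integrable hp.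
- by move=> x xab; rewrite normrM mulrC ler_wpM2r// pM.
- by apply: integrable_onZ; exact: integrable_on_norm.
Qed.

(** Expand [0 <= \int (gp - h p)^2], in which [2 h p gp + dh p^2] is the
derivative of [h p^2]. *)
Lemma picone_riccati a b p gp h dh q : a <= b ->
  primitive_on a b p gp -> primitive_on a b h dh ->
  (forall x, a <= x <= b -> dh x + h x ^+ 2 = q x) ->
  h b * p b ^+ 2 - h a * p a ^+ 2 <=
    \I_[a, b] (fun x => gp x ^+ 2 + q x * p x ^+ 2).
Proof.
move=> ab hp hh hq.
have hpp := primitiveM hp hp.
have hhp := primitiveM hh hp.
have hhpp := primitiveM hh hpp.
have [sg IG] := hhpp.
have {}IG := IG a b (lexx _) ab (lexx _).
rewrite [leLHS](_ : _ = h b * (p b * p b) - h a * (p a * p a)); last by ring.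
rewrite IG -subr_ge0 -integral_onB; last 2 first.
- apply: integrable_onD; first by case: hp => -[].
  apply: (@eq_integrable_on _ _ _ (fun x => (dh x * p x) * p x + (h x * p x) ^+ 2)).
    by move=> x xab; rewrite -hq//; ring.
  apply: integrable_onD; last by have [] := primitive_sq_integrable hhp.
  apply: (primitive_mul_integrable hp); apply: (primitive_mul_integrable hp).
  by case: hh => /sq_integrable_integrable.
- exact: sq_integrable_integrable.
apply: integral_on_ge0 => x xab; rewrite -hq//.
rewrite (_ : _ - _ = (gp x - h x * p x) ^+ 2); first exact: sqr_ge0.
by ring.
Qed.

(** The logarithmic derivative of a solution of [f'' = q f] solves the Riccati
equation. *)
Lemma picone_nonvanishing a b p gp f df q : a <= b ->
  primitive_on a b p gp ->
  (forall x, is_derive x (1 : R) f (df x)) ->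
  (forall x, is_derive x (1 : R) df (q x * f x)) -> continuous q ->
  (forall x, a <= x <= b -> f x != 0) ->
  df b / f b * p b ^+ 2 - df a / f a * p a ^+ 2 <=
    \I_[a, b] (fun x => gp x ^+ 2 + q x * p x ^+ 2).
Proof.
move=> ab hp hf hdf cq f0.
pose dh x := (q x * f x) * (f x)^-1 + df x * (- df x / f x ^+ 2).
apply: (@picone_riccati _ _ _ _ (fun x => df x / f x) dh) => //; last first.
  by move=> x /f0 fx; rewrite /dh; field.
apply: primitive_derivable => // x /f0 fx.
  exact: (derivativeM (hdf x) (derivativeV fx (hf x))).
have cf := is_derive_continuous (hf x).
have cdf := is_derive_continuous (hdf x).
have cv : {for x, continuous (fun y => (f y)^-1)} by exact: continuousV.
apply: (@continuousD _ _ _ (fun y => q y * f y * (f y)^-1)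
   (fun y => df y * (- df y / f y ^+ 2))).
  apply: (@continuousM _ _ (fun y => q y * f y) (fun y => (f y)^-1)) => //.
  by apply: continuousM => //; exact: cq.
apply: (@continuousM _ _ df (fun y => - df y / f y ^+ 2)) => //.
apply: (@continuousM _ _ (fun y => - df y) (fun y => (f y ^+ 2)^-1)).
  exact: continuousN.
apply: (@continuousV _ _ (fun y => f y ^+ 2)); first by rewrite expf_neq0.
by apply: (@continuousM _ _ f f).
Qed.

Lemma small_integral_left a b g e : a < b -> integrable_on a b g -> 0 < e ->
  exists2 d, 0 < d & forall x, a < x -> x < a + d -> `|\I_[a, x] g| <= e.
Proof.
move=> ab ig e0.
have /cvgrPdist_lt/(_ _ e0) := parameterized_integral_cvg_left ab ig.
move=> [d /= d0 H]; exists d => // x ax xd; apply/ltW.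
have := H x; rewrite sub0r normrN; apply.
by rewrite /= ltr0_norm ?opprB; lra.
Qed.

Lemma small_integral_right a b g e : a < b -> integrable_on a b g -> 0 < e ->
  exists2 d, 0 < d & forall x, a <= x -> b - d < x -> x < b -> `|\I_[x, b] g| <= e.
Proof.
move=> ab ig e0.
have /cvgrPdist_lt/(_ _ e0) := parameterized_integral_cvg_at_left ab ig.
move=> [d /= d0 H]; exists d => // x ax xd xb; apply/ltW.
have -> : \I_[x, b] g = \I_[a, b] g - \I_[a, x] g.
  by rewrite (integral_on_split ax (ltW xb) ig) addrAC subrr add0r.
apply: (H x) => //=.
by rewrite /= gtr0_norm ?opprB; lra.
Qed.

Lemma simple_node_bound z f m : f z = 0 -> is_derive z (1 : R) f m -> m != 0 ->
  exists2 d, 0 < d & forall x, `|x - z| < d -> `|m| / 2 * `|x - z| <= `|f x|.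
Proof.
move=> fz [df fm] m0.
have m2 : 0 < `|m| / 2 by rewrite divr_gt0// normr_gt0.
have := df; rewrite /derivable => /cvg_ex[l hl].
have lm : l = m.
  by rewrite -fm; apply/esym/cvg_lim.
move: hl; rewrite lm => /cvgrPdist_lt/(_ _ m2)[d /= d0 H].
exists d => // x xd.
have [->|xz] := eqVneq x z; first by rewrite subrr normr0 mulr0.
have xz0 : x - z != 0 by rewrite subr_eq0.
have := H (x - z); rewrite /= sub0r normrN => /(_ xd xz0).
rewrite fz subr0 /GRing.scale/= mulr1 subrK => H1.
have p0 : 0 < `|x - z| by rewrite normr_gt0.
have fE : f x = (x - z) * ((x - z)^-1 * f x) by rewrite mulrA divff// mul1r.
rewrite fE normrM mulrC ler_wpM2l//.
have := ler_normD (m - (x - z)^-1 * f x) ((x - z)^-1 * f x).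
rewrite subrK; lra.
Qed.

(** On a slightly smaller interval [df / f] is available, with boundary terms
[df / f p^2]. These tend to zero at a node [z]: there [f] vanishes to first
order only, while [p x ^ 2] is at most [|x - z|] times the integral of [gp^2]
between [x] and [z], which is [o(|x - z|)]. *)
Lemma picone_nodes a b p gp f df q : a < b ->
  primitive_on a b p gp ->
  (forall x, is_derive x (1 : R) f (df x)) ->
  (forall x, is_derive x (1 : R) df (q x * f x)) -> continuous q ->
  (forall x, a < x < b -> f x != 0) ->
  f a = 0 -> f b = 0 -> df a != 0 -> df b != 0 -> p a = 0 -> p b = 0 ->
  0 <= \I_[a, b] (fun x => gp x ^+ 2 + q x * p x ^+ 2).
Proof.
move=> ab hp hf hdf cq f0 fa fb dfa dfb pa pb.
pose G x := gp x ^+ 2 + q x * p x ^+ 2.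
have ig2 : integrable_on a b (fun x => gp x ^+ 2) by case: hp => -[].
have iG : integrable_on a b G.
  apply: integrable_onD => //.
  apply: (@eq_integrable_on _ _ _ (fun x => (q x * p x) * p x)).
    by move=> x _; ring.
  apply: (primitive_mul_integrable hp); apply: (primitive_mul_integrable hp).
  exact: continuous_integrable_on.
rewrite leNgt; apply/negP => neg.
(* two boundary terms and two end intervals, each contributing at most [e] *)
pose e := - \I_[a, b] G / 5.
have e0 : 0 < e by rewrite divr_gt0// oppr_gt0.
have cdf : continuous df by move=> x; exact: is_derive_continuous (hdf x).
have [M M0 dfM] : exists2 M, 0 < M & forall x, a <= x <= b -> `|df x| <= M.
  have hdp : primitive_on a b df (fun x => q x * f x).
    apply: primitive_derivable => // [|x _]; first exact: ltW.
    apply: continuousM; first exact: cq.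
    exact: is_derive_continuous (hf x).
  have [M HM] := primitive_bounded hdp; exists (`|M| + 1).
    by rewrite ltr_wpDl.
  by move=> x /HM /le_trans; apply; have := ler_norm M; lra.
have [d1 d10 B1] := simple_node_bound fa (hf a) dfa.
have [d2 d20 B2] := simple_node_bound fb (hf b) dfb.
have na : 0 < `|df a| by rewrite normr_gt0.
have nb : 0 < `|df b| by rewrite normr_gt0.
have [d3 d30 J1] : exists2 d, 0 < d & forall x, a < x -> x < a + d ->
    `|\I_[a, x] (fun x => gp x ^+ 2)| <= e * (`|df a| / 2) / M.
  apply: small_integral_left ab ig2 _.
  by rewrite divr_gt0// mulr_gt0// divr_gt0.
have [d4 d40 J2] : exists2 d, 0 < d & forall x, a <= x -> b - d < x -> x < b ->
    `|\I_[x, b] (fun x => gp x ^+ 2)| <= e * (`|df b| / 2) / M.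
  apply: small_integral_right ab ig2 _.
  by rewrite divr_gt0// mulr_gt0// divr_gt0.
have [d5 d50 G1] := small_integral_left ab iG e0.
have [d6 d60 G2] := small_integral_right ab iG e0.
pose d := Num.min (Num.min (Num.min d1 d2) (Num.min d3 d4))
  (Num.min (Num.min d5 d6) ((b - a) / 2)).
have d0 : 0 < d by rewrite !lt_min d10 d20 d30 d40 d50 d60/= divr_gt0// subr_gt0.
have : d <= d by [].
rewrite {2}/d !le_min => /andP[/andP[/andP[dd1 dd2] /andP[dd3 dd4]]].
move=> /andP[/andP[dd5 dd6] dd7].
pose x := a + d / 2; pose y := b - d / 2.
have [ax xd yb yd xy] : [/\ a < x, x < a + d, y < b, b - d < y & x < y].
  by clear -d0 dd7; rewrite /x /y; split; lra.
have ay := lt_trans ax xy; have xb := lt_trans xy yb.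
have xa : `|x - a| < d by rewrite gtr0_norm ?subr_gt0// ltrBlDl.
have yb' : `|y - b| < d by rewrite distrC gtr0_norm ?subr_gt0// ltrBlDl -ltrBlDr.
have bound z u m J : `|u - z| < d -> a <= u <= b -> 0 < m ->
    m / 2 * `|u - z| <= `|f u| -> 0 < `|u - z| ->
    p u ^+ 2 <= `|u - z| * J -> `|J| <= e * (m / 2) / M ->
    `|df u / f u * p u ^+ 2| <= e.
  move=> ud uab m0 fu uz pJ Je.
  have m2 : 0 < m / 2 by rewrite divr_gt0.
  have fu0 : 0 < `|f u| by apply: lt_le_trans fu; rewrite mulr_gt0.
  rewrite normrM (ger0_norm (sqr_ge0 (p u))) normrM normfV mulrAC ler_pdivrMr//.
  have h1 : `|df u| * p u ^+ 2 <= M * (`|u - z| * J).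
    apply: ler_pM => //; [exact: sqr_ge0|exact: dfM].
  rewrite (le_trans h1)//.
  have h2 : J <= e * (m / 2) / M by apply: le_trans Je; exact: ler_norm.
  have h3 : M * (`|u - z| * J) <= `|u - z| * (e * (m / 2)).
    rewrite mulrCA ler_wpM2l// mulrC -ler_pdivlMr//; exact: M0.
  rewrite (le_trans h3)// mulrCA ler_wpM2l ?(ltW e0)// mulrC//.
have Bx : `|df x / f x * p x ^+ 2| <= e.
  apply: (bound a x `|df a| (\I_[a, x] (fun x => gp x ^+ 2))) => //.
  - by rewrite !ltW.
  - by apply: B1; exact: lt_le_trans dd1.
  - by rewrite normr_gt0 subr_eq0 gt_eqF.
  - have := primitive_holder hp (lexx a) (ltW ax) (ltW xb).
    by rewrite pa subr0 (gtr0_norm (x := x - a)) ?subr_gt0.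
  - by apply: J1 => //; apply: (lt_le_trans xd); rewrite lerD2l.
have By : `|df y / f y * p y ^+ 2| <= e.
  apply: (bound b y `|df b| (\I_[y, b] (fun x => gp x ^+ 2))) => //.
  - by rewrite !ltW.
  - by apply: B2; exact: lt_le_trans dd2.
  - by rewrite normr_gt0 subr_eq0 lt_eqF.
  - have := primitive_holder hp (ltW ay) (ltW yb) (lexx b).
    by rewrite pb sub0r sqrrN distrC (ger0_norm (x := b - y)) ?subr_ge0 ?(ltW yb).
  - apply: J2 => //; first exact: ltW.
    by apply: le_lt_trans yd; rewrite lerD2l lerN2.
have mid : df y / f y * p y ^+ 2 - df x / f x * p x ^+ 2 <= \I_[x, y] G.
  apply: picone_nonvanishing => //; first exact: ltW.
  - exact: primitive_on_sub (ltW ax) (ltW yb) hp.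
  - move=> z /andP[z1 z2]; apply: f0.
    by rewrite (lt_le_trans ax z1) (le_lt_trans z2 yb).
have GG1 : `|\I_[a, x] G| <= e.
  by apply: G1 => //; apply: (lt_le_trans xd); rewrite lerD2l.
have GG2 : `|\I_[y, b] G| <= e.
  apply: G2 => //; first exact: ltW.
  by apply: le_lt_trans yd; rewrite lerD2l lerN2.
have S1 := integral_on_split (ltW ax) (ltW xb) iG.
have S2 := integral_on_split (ltW xy) (ltW yb)
  (integrable_on_sub (ltW ax) (lexx b) iG).
have eE : \I_[a, b] G = - (5 * e) by rewrite /e; field.
move: GG1 GG2 Bx By; rewrite !ler_norml => /andP[g1 _] /andP[g2 _] /andP[_ bx] /andP[byy _].
clear -g1 g2 bx byy mid S1 S2 eE e0; lra.
Qed.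

End Picone.

(** * The periodic Sobolev space *)

(** Functions of the periodic space H^1 together with a representative of their
weak derivative. *)
Definition H1pair (R : realType) (L : R) (p gp : R -> R) : Prop :=
  periodic p L /\ weak_derivative L p gp.

Definition inner_per (R : realType) (L : R) (f g : R -> R) : R :=
  \I_[0, L] (fun x => f x * g x).

(** The quadratic form of the Hill operator [- d^2/dx^2 + v]. *)
Definition hill_form (R : realType) (L : R) (v p gp : R -> R) : R :=
  \I_[0, L] (fun x => gp x ^+ 2 + v x * p x ^+ 2).

Section H1pair.
Context {R : realType} {L : R} (L0 : 0 < L).
Implicit Types (p gp q gq f g h v : R -> R) (r s t : R).

Local Notation sqi := (sq_integrable 0 L).
Local Notation "\< f , g \>" := (inner_per L f g).

Lemma continuous_sqi f : continuous f -> sqi f.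
Proof.
move=> cf; apply: sq_integrable_continuous.
by apply: continuous_subspaceT => x; exact: cf.
Qed.

Lemma H1pair_primitive a b p gp : H1pair L p gp -> primitive_on a b p gp.
Proof. by move=> [_ h]; exact: (weak_derivative_primitive L0 a b h). Qed.

Lemma H1pair_continuous p gp : H1pair L p gp -> continuous p.
Proof.
move=> hp x; have := primitive_continuous (H1pair_primitive (x - 1) (x + 1) hp).
move=> /(continuous_within_itvP _ _)[|+ _ _]; first by lra.
by move=> /(_ x); apply; rewrite in_itv/=; apply/andP; split; lra.
Qed.

Lemma H1pair_sqi p gp : H1pair L p gp -> sqi p.
Proof. by move=> /H1pair_continuous; exact: continuous_sqi. Qed.

Lemma H1pair_sqi_deriv p gp : H1pair L p gp -> sqi gp.
Proof. by move=> /(H1pair_primitive 0 L) []. Qed.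

Lemma H1pair_measurable p gp : H1pair L p gp ->
  measurable_fun setT p /\ measurable_fun setT gp.
Proof.
move=> hp; split; last by case: hp => _ [[]].
by apply: continuous_measurable_fun; exact: H1pair_continuous hp.
Qed.

Lemma H1pair_smooth f g : periodic f L -> periodic g L ->
  (forall x, is_derive x (1 : R) f (g x)) -> continuous g -> H1pair L f g.
Proof. by move=> pf pg df cg; split => //; exact: (weak_derivative_derivable L0). Qed.

Lemma H1pairB p gp q gq : H1pair L p gp -> H1pair L q gq ->
  H1pair L (fun x => p x - q x) (fun x => gp x - gq x).
Proof.
move=> [pp hp] [pq hq]; split; last exact: (weak_derivativeB L0).
by move=> x; rewrite pp pq.
Qed.

Lemma H1pairZ r p gp : H1pair L p gp ->
  H1pair L (fun x => r * p x) (fun x => r * gp x).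
Proof.
move=> hp; split; first by move=> x; case: hp => ->.
have [_ [[pg mg _] _]] := hp.
split.
  split; first by move=> x; rewrite pg.
    by apply: measurable_funM => //; exact: measurable_cst.
  by have [_] := sq_integrableZ r (H1pair_sqi_deriv hp).
move=> a b ab; have [_] := primitiveZ r (H1pair_primitive a b hp); exact.
Qed.

Lemma H1pairD p gp q gq : H1pair L p gp -> H1pair L q gq ->
  H1pair L (fun x => p x + q x) (fun x => gp x + gq x).
Proof.
move=> hp /(H1pairZ (-1)) hq; have := H1pairB hp hq.
by congr (H1pair _ _ _); apply/funext => x; rewrite mulN1r opprK.
Qed.

Lemma H1pair_shift y p gp : H1pair L p gp ->
  H1pair L (fun x => p (x + y)) (fun x => gp (x + y)).
Proof.
move=> [pp hp]; split; first by move=> x; rewrite addrAC pp.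
exact: (weak_derivative_shift L0).
Qed.

Lemma H1pair_parts p gp q gq : H1pair L p gp -> H1pair L q gq ->
  \I_[0, L] (fun x => gp x * q x + p x * gq x) = 0.
Proof.
move=> hp hq; have [_ H] := primitiveM (H1pair_primitive 0 L hp) (H1pair_primitive 0 L hq).
rewrite -(H 0 L (lexx _) (ltW L0) (lexx _)); case: hp => pp _; case: hq => pq _.
by have := pp 0; have := pq 0; rewrite add0r => -> ->; rewrite subrr.
Qed.

Lemma integral_derivative0 f g : H1pair L f g -> \I_[0, L] g = 0.
Proof.
move=> [pf [_ H]]; rewrite /integral_on -H ?ltW//.
by have := pf 0; rewrite add0r => ->; rewrite subrr.
Qed.

Lemma innerC f g : \< f, g \> = \< g, f \>.
Proof. by apply: eq_integral_on => x _; rewrite mulrC. Qed.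

Lemma innerZ r f g : sqi f -> sqi g -> \< (fun x => r * f x), g \> = r * \< f, g \>.
Proof.
move=> hf hg; rewrite /inner_per -integral_onZ; last exact: integrable_on_mul.
by apply: eq_integral_on => x _; rewrite mulrA.
Qed.

Lemma innerD f g h : sqi f -> sqi g -> sqi h ->
  \< (fun x => f x + g x), h \> = \< f, h \> + \< g, h \>.
Proof.
move=> hf hg hh; rewrite /inner_per -integral_onD; try exact: integrable_on_mul.
by apply: eq_integral_on => x _; rewrite mulrDl.
Qed.

Lemma inner_ge0 f : 0 <= \< f, f \>.
Proof. by apply: integral_on_ge0 => x _; rewrite -expr2 sqr_ge0. Qed.

Lemma inner_sqr f : \I_[0, L] (fun x => f x ^+ 2) = \< f, f \>.
Proof. by apply: eq_integral_on => x _; rewrite expr2. Qed.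

Lemma cauchy_schwarz_per f g : sqi f -> sqi g ->
  \< f, g \> ^+ 2 <= \< f, f \> * \< g, g \>.
Proof. by move=> hf hg; rewrite -!inner_sqr; exact: cauchy_schwarz_on. Qed.

Lemma hill_form_integrable v p gp : continuous v -> H1pair L p gp ->
  integrable_on 0 L (fun x => gp x ^+ 2 + v x * p x ^+ 2).
Proof.
move=> cv hp; apply: integrable_onD; first by have [] := H1pair_sqi_deriv hp.
apply: (@eq_integrable_on _ _ _ (fun x => (v x * p x) * p x)).
  by move=> x _; ring.
have hpp := H1pair_primitive 0 L hp.
apply: (primitive_mul_integrable hpp); apply: (primitive_mul_integrable hpp).
exact: continuous_integrable_on.
Qed.

(** Integration by parts moves the operator to [e], where it gives [g]; so only
[L^2] products remain besides the form of [p]. *)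
Lemma hill_formD v p gp e de dde g : continuous v -> H1pair L p gp ->
  H1pair L e de -> H1pair L de dde -> sqi g ->
  (forall x, dde x = v x * e x - g x) ->
  hill_form L v (fun x => p x + e x) (fun x => gp x + de x) =
  hill_form L v p gp + 2 * \< p, g \> + \< e, g \>.
Proof.
move=> cv hp he hde hg E.
have I1 := H1pair_parts hp hde.
have I2 := H1pair_parts he hde.
have ip := hill_form_integrable cv hp.
have sp := H1pair_sqi hp; have se := H1pair_sqi he.
have sgp := H1pair_sqi_deriv hp.
have sde := H1pair_sqi he; have sde2 := H1pair_sqi_deriv he.
have sdde := H1pair_sqi_deriv hde.
have i1 : integrable_on 0 L (fun x => gp x * de x + p x * dde x).
  by apply: integrable_onD; exact: integrable_on_mul.
have i2 : integrable_on 0 L (fun x => de x * de x + e x * dde x).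
  by apply: integrable_onD; exact: integrable_on_mul.
have ig : integrable_on 0 L (fun x => 2 * (p x * g x) + e x * g x).
  by apply: integrable_onD; [apply: integrable_onZ|]; exact: integrable_on_mul.
have id : integrable_on 0 L (fun x => 2 * (gp x * de x + p x * dde x)
   + (de x * de x + e x * dde x)).
  by apply: integrable_onD => //; apply: integrable_onZ.
rewrite /hill_form /inner_per.
transitivity (\I_[0, L] (fun x => (gp x ^+ 2 + v x * p x ^+ 2)
   + ((2 * (gp x * de x + p x * dde x) + (de x * de x + e x * dde x))
   + (2 * (p x * g x) + e x * g x)))).
  by apply: eq_integral_on => x _; rewrite E; ring.
rewrite (integral_onD ip (integrable_onD id ig)) (integral_onD id ig).
rewrite (integral_onD (integrable_onZ 2 i1) i2) (integral_onZ _ i1) I1 I2 mulr0 !add0r.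
rewrite (integral_onD (integrable_onZ 2 (integrable_on_mul sp hg)) (integrable_on_mul se hg)).
by rewrite (integral_onZ _ (integrable_on_mul sp hg)) addrA.
Qed.

Lemma inner_shift f g y : measurable_fun setT f -> measurable_fun setT g ->
  periodic f L -> periodic g L -> sqi f -> sqi g ->
  \< (fun x => f (x + y)), (fun x => g (x + y)) \> = \< f, g \>.
Proof.
move=> mf mg pf pg sf sg.
apply: (@periodic_integral_shift R L L0 y (fun y => f y * g y)).
- exact: measurable_funM.
- by move=> x; rewrite pf pg.
- exact: integrable_on_mul.
Qed.

Lemma H1pair_periodic_deriv p gp : H1pair L p gp -> periodic gp L.
Proof. by case=> _ [[]]. Qed.

(** Compare [p x] with [p z] by the Hoelder estimate and average over [z]. *)
Lemma H1pair_sup p gp x : H1pair L p gp ->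
  p x ^+ 2 <= 2 / L * \< p, p \> + 2 * L * \< gp, gp \>.
Proof.
have at0 q gq : H1pair L q gq ->
    q 0 ^+ 2 <= 2 / L * \< q, q \> + 2 * L * \< gq, gq \>.
  move=> hq; have hqq := H1pair_primitive 0 L hq.
  have H z : 0 <= z <= L -> q 0 ^+ 2 <= 2 * (q z * q z) + 2 * L * \< gq, gq \>.
    move=> /[dup] zL /andP[z0 zl].
    have := primitive_holder_norm (x := 0) (y := z) hqq.
    rewrite lexx ltW//= zL => /(_ isT isT); rewrite subr0 ger0_norm// inner_sqr => h.
    have h2 : z * \< gq, gq \> <= L * \< gq, gq \> by rewrite ler_wpM2r// inner_ge0.
    move: h h2; move: (q 0) (q z) (inner_per L gq gq) => u v I h h2.
    have h3 := sqr_ge0 (2 * v - u).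
    rewrite (_ : u ^+ 2 = 2 * (v * v) + 2 * (v - u) ^+ 2 - (2 * v - u) ^+ 2); last by ring.
    lra.
  have sq := H1pair_sqi hq.
  have iq := integrable_on_mul sq sq.
  have icst r : integrable_on 0 L (fun=> r).
    by apply: continuous_integrable_on => y; exact: cvg_cst.
  have := le_integral_on (icst _) (integrable_onD (integrable_onZ 2 iq) (icst _)) H.
  rewrite integral_onD//; last exact: integrable_onZ.
  rewrite integral_onZ// !(integral_on_cst _ (ltW L0)) !subr0 => h.
  rewrite -(ler_pM2r L0); apply: (le_trans h).
  rewrite -/(inner_per L q q) le_eqVlt; apply/orP; left; apply/eqP.
  by field; rewrite gt_eqF.
move=> hp; have hs := H1pair_shift x hp.
have := at0 _ _ hs; rewrite add0r.
have [mp mg] := H1pair_measurable hp.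
rewrite !inner_shift//.
- exact: H1pair_periodic_deriv hp.
- exact: H1pair_periodic_deriv hp.
- exact: H1pair_sqi_deriv hp.
- exact: H1pair_sqi_deriv hp.
- by case: hp.
- by case: hp.
- exact: H1pair_sqi hp.
- exact: H1pair_sqi hp.
Qed.

End H1pair.

(** * Coercivity of the linearized operators *)

Section PositiveIntegral.
Context {R : realType} {L : R} (L0 : 0 < L).
Local Notation "\< f , g \>" := (inner_per L f g).

(** If the integral vanished, the primitive of [g] would be constant on a period
around [x] by Cauchy-Schwarz, and its derivative at [x] is [g x]. *)
Lemma inner_gt0 (g : R -> R) x : continuous g -> periodic g L -> g x != 0 ->
  0 < \< g, g \>.
Proof.
move=> cg pg gx; rewrite lt_def inner_ge0 andbT; apply/eqP => g0.
pose z := x - L / 2.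
have Gz : \I_[z, z + L] (fun y => g y ^+ 2) = 0.
  rewrite (@periodic_integral_on R L L0 z (fun y => g y ^+ 2)) ?inner_sqr//.
  - by apply: measurable_funX; exact: continuous_measurable_fun.
  - by move=> y; rewrite pg.
  - by have [] := continuous_sqi (L := L) cg.
pose G := oriented_integral g.
have dG y : is_derive y (1 : R) G (g y) by exact: is_derive_oriented_integral.
have zL : z <= z + L by rewrite lerDl ltW.
have hG : primitive_on z (z + L) G g by apply: primitive_derivable => // y _; exact: cg.
have cst y : z <= y <= z + L -> G y = G z.
  move=> yz; have := primitive_holder_norm (x := z) hG _ yz.
  rewrite lexx zL => /(_ isT); rewrite Gz mulr0 exprn_even_le0//= subr_eq0.
  by move/eqP.
have L2 : 0 < L / 2 by rewrite divr_gt0.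
have zx : z < x by rewrite ltrBlDr ltrDl.
have xz : x < z + L by rewrite /z (_ : x - L / 2 + L = x + L / 2) ?ltrDl//; field.
have d0 : is_derive x (1 : R) G 0.
  apply: (@near_eq_is_derive _ _ _ (fun=> G z)).
  near=> y; apply/esym/cst; apply/andP; split; apply/ltW; near: y.
    exact: lt_nbhsr.
  exact: lt_nbhsl.
have [_ E1] := dG x; have [_ E2] := d0.
by move: gx; rewrite -E1 E2 eqxx.
Unshelve. all: by end_near. Qed.

End PositiveIntegral.

Section Coercivity.
Context {R : realType} {L c : R} {psi : R -> R} (L0 : 0 < L).
Context (W : wave_profile L c psi).
Implicit Types (p gp : R -> R) (d : R).

Local Notation "\< f , g \>" := (inner_per L f g).
Local Notation psi' := (dpsi W).
Local Notation b := (wave_b W).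

Let dpsi0 := is_derive_psi W.
Let dpsi1 := is_derive_dpsi W.
Let quad := wave_quadrature W.
Let c0 := wave_c_gt0 W.
Let b0 := wave_b_gt0 W.
Let psi0 := psi_gt0 W.

Lemma psi_continuous : continuous psi.
Proof. by move=> x; exact: is_derive_continuous (dpsi0 x). Qed.

Lemma dpsi_continuous : continuous psi'.
Proof. by move=> x; exact: is_derive_continuous (dpsi1 x). Qed.

Definition ddpsi (x : R) : R := c * psi x - 2^-1 * psi x ^+ 2.

Lemma is_derive_ddpsi x : is_derive x (1 : R) ddpsi ((c - psi x) * psi' x).
Proof. by rewrite /ddpsi; differentiate; field. Qed.

Lemma ddpsi_continuous : continuous ddpsi.
Proof. by move=> x; exact: is_derive_continuous (is_derive_ddpsi x). Qed.

Lemma potential_continuous r : continuous (fun x => c - r * psi x).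
Proof.
move=> x; have h : is_derive x (1 : R) (fun x => c - r * psi x) (- (r * psi' x)).
  by differentiate; ring.
exact: is_derive_continuous h.
Qed.

Lemma H1pair_psi : H1pair L psi psi'.
Proof.
apply: (H1pair_smooth L0 (psi_periodic W) (dpsi_periodic W) dpsi0).
exact: dpsi_continuous.
Qed.

Lemma H1pair_dpsi : H1pair L psi' ddpsi.
Proof.
apply: (H1pair_smooth L0 (dpsi_periodic W)) => //; last exact: ddpsi_continuous.
by move=> x; rewrite /ddpsi (psi_periodic W).
Qed.

(** Since [psi'' = (c - psi / 2) psi] and [psi > 0], the operator with potential
[c - psi / 2] is nonnegative; the difference with the potential [c - d psi] is
[(1 / 2 - d) psi]. *)
Lemma transversal_form_ge p gp d : H1pair L p gp ->
  (2^-1 - d) * \I_[0, L] (fun x => psi x * p x ^+ 2) <=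
  hill_form L (fun x => c - d * psi x) p gp.
Proof.
move=> hp.
have i1 : integrable_on 0 L (fun x => psi x * p x ^+ 2).
  apply: (@eq_integrable_on _ _ _ (fun x => (psi x * p x) * p x)).
    by move=> x _; ring.
  have hpp := H1pair_primitive L0 0 L hp.
  apply: (primitive_mul_integrable hpp); apply: (primitive_mul_integrable hpp).
  exact: (continuous_integrable_on _ _ (@psi_continuous)).
have i2 := hill_form_integrable L0 (@potential_continuous 2^-1) hp.
have E x : gp x ^+ 2 + (c - d * psi x) * p x ^+ 2 =
    (gp x ^+ 2 + (c - 2^-1 * psi x) * p x ^+ 2) + (2^-1 - d) * (psi x * p x ^+ 2).
  by ring.
rewrite /hill_form (eq_integral_on (g := _) (fun x _ => E x)).
rewrite (integral_onD i2 (integrable_onZ _ i1)) (integral_onZ _ i1) lerDr.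
have h2 x : is_derive x (1 : R) psi' ((c - 2^-1 * psi x) * psi x).
  by apply: (is_derive_as (dpsi1 x)); ring.
have := picone_nonvanishing (ltW L0) (H1pair_primitive L0 0 L hp) dpsi0 h2
  (@potential_continuous _) (fun x _ => lt0r_neq0 (psi0 x)).
have [pp _] := hp.
have := pp 0; have := psi_periodic W 0; have := dpsi_periodic W 0.
by rewrite !add0r => -> -> ->; rewrite subrr.
Qed.

(** ** The generalized kernel *)

Let mean := \I_[0, L] psi / L.

Let ipsi : integrable_on 0 L psi.
Proof. exact: (continuous_integrable_on _ _ (@psi_continuous)). Qed.

Lemma integral_psi : \I_[0, L] psi = mean * L.
Proof. by rewrite /mean divfK// gt_eqF. Qed.

Lemma mean_gt0 : 0 < mean.
Proof.
rewrite divr_gt0//.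
have ci : continuous (fun x => Num.sqrt (psi x)).
  move=> x; apply: (@continuous_comp _ _ _ psi Num.sqrt).
    exact: psi_continuous.
  exact: sqrt_continuous.
have := @inner_gt0 R L L0 (fun x => Num.sqrt (psi x)) 0 ci.
rewrite /inner_per (@eq_integral_on _ _ _ _ psi).
  by apply; [move=> x; rewrite (psi_periodic W)|rewrite gt_eqF// sqrtr_gt0].
by move=> x _; rewrite -expr2 sqr_sqrtr// ltW.
Qed.

Let icst r : integrable_on 0 L (fun=> r).
Proof. by apply: continuous_integrable_on => y; exact: cvg_cst. Qed.

Let spsi : sq_integrable 0 L psi. Proof. exact: (continuous_sqi (@psi_continuous)). Qed.

(** The profile equation integrated over a period. *)
Lemma inner_psi_psi : \< psi, psi \> = 2 * c * mean * L.
Proof.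
have := integral_derivative0 L0 H1pair_dpsi.
rewrite /ddpsi integral_onB; [|exact: integrable_onZ|by apply: integrable_onZ; case: spsi].
rewrite !integral_onZ//; last by case: spsi.
by rewrite inner_sqr integral_psi; lra.
Qed.

(** The variance of [psi] is positive and its second moment is [2 c mean]. *)
Lemma mean_lt : mean < 2 * c.
Proof.
pose g x := psi x - mean.
have dg x : is_derive x (1 : R) g (psi' x) by rewrite /g; differentiate; ring.
have cg : continuous g by move=> x; exact: is_derive_continuous (dg x).
have [x gx] : exists x, g x != 0.
  apply: contrapT => H; have [y] := dpsi_neq0 W; apply/negP; rewrite negbK.
  have g0 : g = fun=> 0.
    by apply/funext => x; apply: contrapT => /eqP gx; apply: H; exists x.
  have [_ <-] := dg y; rewrite g0.
  by have [_ ->] := derivative_const (0 : R) y.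
have := inner_gt0 L0 cg (fun x => congr1 (fun y => y - mean) (psi_periodic W x)) gx.
have -> : \< g, g \> = \< psi, psi \> - mean ^+ 2 * L.
  rewrite /inner_per (@eq_integral_on _ _ _ _ (fun x => psi x * psi x - 2 * mean * psi x + mean ^+ 2)).
    rewrite integral_onD//; last first.
      by apply: integrable_onB; [exact: integrable_on_mul|exact: integrable_onZ].
    rewrite (integral_on_cst _ (ltW L0)).
    rewrite (integral_onB (integrable_on_mul spsi spsi) (integrable_onZ _ ipsi)).
    by rewrite (integral_onZ _ ipsi) integral_psi; ring.
  by move=> y _; rewrite /g; ring.
rewrite inner_psi_psi (_ : _ - _ = (mean * L) * (2 * c - mean)); last by ring.
have mL : 0 < mean * L by apply: mulr_gt0 => //; exact: mean_gt0.
by rewrite pmulr_rgt0// subr_gt0.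
Qed.

(** Cauchy-Schwarz for [psi] and [1 / psi], the integral of [1 / psi^2] being
given by [(psi' / psi)' = - psi / 6 + b / psi^2]. *)
Lemma mean_sqr_ge : 3 * b <= c * mean ^+ 2.
Proof.
have pn0 x : psi x != 0 by rewrite gt_eqF.
pose ip x := (psi x)^-1.
have dip x : is_derive x (1 : R) ip (- psi' x / psi x ^+ 2).
  by apply: derivativeV.
have cip : continuous ip by move=> x; exact: is_derive_continuous (dip x).
have sip : sq_integrable 0 L ip by exact: continuous_sqi.
have H1 : \< psi, ip \> = L.
  rewrite /inner_per (@eq_integral_on _ _ _ _ (fun=> 1)).
    by rewrite (integral_on_cst _ (ltW L0)) subr0 mul1r.
  by move=> x _; rewrite /ip divff.
have H2 : b * \< ip, ip \> = mean * L / 6.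
  pose f x := psi' x * ip x.
  pose g x := - (6^-1 * psi x) + b * (ip x * ip x).
  have df x : is_derive x (1 : R) f (g x).
    apply: (is_derive_as (derivativeM (dpsi1 x) (dip x))).
    rewrite /g /ip; apply: (mulIf (expf_neq0 2 (pn0 x))).
    rewrite [LHS](_ : _ = c * psi x ^+ 2 - 2^-1 * psi x ^+ 3 - psi' x ^+ 2); last by field.
    by rewrite quad; field.
  have cg : continuous g.
    move=> x; have h : is_derive x (1 : R) g (- (6^-1 * psi' x)
        + b * ((- psi' x / psi x ^+ 2) * ip x + ip x * (- psi' x / psi x ^+ 2))).
      by rewrite /g; differentiate; ring.
    exact: is_derive_continuous h.
  have hf : H1pair L f g.
    apply: H1pair_smooth => //.
      by move=> x; rewrite /f /ip (psi_periodic W) (dpsi_periodic W).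
    by move=> x; rewrite /g /ip (psi_periodic W).
  have := integral_derivative0 L0 hf.
  have i1 := integrable_onN (integrable_onZ 6^-1 ipsi).
  have ii := integrable_on_mul sip sip.
  rewrite /g integral_onD//; last exact: integrable_onZ.
  rewrite (@eq_integral_on _ _ _ _ (fun x => (- 6^-1) * psi x)); last by move=> x _; ring.
  by rewrite !integral_onZ// integral_psi -/(inner_per L ip ip); lra.
have := cauchy_schwarz_per spsi sip.
rewrite H1 inner_psi_psi => H3.
have H4 : b * L ^+ 2 <= b * (2 * c * mean * L * \< ip, ip \>) by rewrite ler_wpM2l// ltW.
have E : b * (2 * c * mean * L * \< ip, ip \>) = (c * mean ^+ 2 / 3) * L ^+ 2.
  rewrite (_ : _ * _ = 2 * c * mean * L * (b * \< ip, ip \>)); last by ring.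
  by rewrite H2; field.
rewrite E ler_pM2r ?exprn_gt0// in H4; lra.
Qed.

Definition kappa : R := 2 * c * mean - 3 * b / c.

Lemma kappa_gt0 : 0 < kappa.
Proof.
have h : 3 * b / c <= mean ^+ 2 by rewrite ler_pdivrMr// (mulrC _ c) mean_sqr_ge.
have m2 : 0 < 2 * c - mean by rewrite subr_gt0 mean_lt.
have := mulr_gt0 mean_gt0 m2.
by rewrite /kappa; lra.
Qed.

Let Z := oriented_integral (fun x => psi x - mean).

Let dZ x : is_derive x (1 : R) Z (psi x - mean).
Proof.
apply: is_derive_oriented_integral => y.
have h : is_derive y (1 : R) (fun x => psi x - mean) (psi' y) by differentiate; ring.
exact: is_derive_continuous h.
Qed.

Let Z_periodic : periodic Z L.
Proof.
move=> x.
have dd y : is_derive y (1 : R) (fun y => Z (y + L) + - Z y) 0.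
  have h : is_derive y (1 : R) (fun y : R => y + L) (1 + 0).
    exact: (derivativeD (derivative_id y) (derivative_const L y)).
  apply: (is_derive_as (derivativeD (@derivative_comp _ Z (fun y => y + L) y _ _ (dZ (y + L)) h) (derivativeN (dZ y)))).
  by rewrite (psi_periodic W); ring.
have := derivative0_cst dd x 0; rewrite add0r.
have -> : Z 0 = 0 by exact: oriented_integral0.
have -> : Z L = 0.
  rewrite /Z /oriented_integral (ltW L0) integral_onB//.
  by rewrite (integral_on_cst _ (ltW L0)) integral_psi; ring.
by rewrite subrr => /eqP; rewrite subr_eq0 => /eqP.
Qed.

(** [L1 eta = kappa psi] for [L1 = - d^2/dx^2 + c - psi]. Up to a factor this is
the derivative of [psi] with respect to the speed at fixed period; it is found
among the combinations of [Z psi'], [psi^2], [psi] and [1], a space that [L1]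
maps into the polynomials in [psi]. *)
Definition eta (x : R) : R :=
  Z x * psi' x - 2 * psi x ^+ 2 + (6 * c - 2 * mean) * psi x + 3 * b / c.

Definition deta (x : R) : R := (psi x - mean) * psi' x + Z x * ddpsi x - 4 * psi x * psi' x
  + (6 * c - 2 * mean) * psi' x.

Lemma is_derive_eta x : is_derive x (1 : R) eta (deta x).
Proof. by rewrite /eta; differentiate; rewrite /deta /ddpsi; ring. Qed.

Lemma is_derive_deta x : is_derive x (1 : R) deta ((c - 1 * psi x) * eta x - kappa * psi x).
Proof.
have h := is_derive_ddpsi.
rewrite /deta; differentiate; rewrite /eta /kappa.
have q2 := quad x.
have -> : 3 * b / c = 3 / c * b by ring.
have -> : b = - (3^-1 * psi x ^+ 3) + c * psi x ^+ 2 - psi' x ^+ 2 by rewrite q2; ring.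
rewrite /ddpsi; field.
by rewrite gt_eqF.
Qed.

Lemma H1pair_eta : H1pair L eta deta.
Proof.
apply: (H1pair_smooth L0 _ _ is_derive_eta).
- by move=> x; rewrite /eta Z_periodic (psi_periodic W) (dpsi_periodic W).
- by move=> x; rewrite /deta /ddpsi Z_periodic (psi_periodic W) (dpsi_periodic W).
- by move=> x; exact: is_derive_continuous (is_derive_deta x).
Qed.

Lemma H1pair_deta : H1pair L deta (fun x => (c - 1 * psi x) * eta x - kappa * psi x).
Proof.
apply: (H1pair_smooth L0 _ _ is_derive_deta).
- by move=> x; rewrite /deta /ddpsi Z_periodic (psi_periodic W) (dpsi_periodic W).
- by move=> x; rewrite /eta Z_periodic (psi_periodic W) (dpsi_periodic W).
- move=> x.
  have h : is_derive x (1 : R) (fun x => (c - 1 * psi x) * eta x - kappa * psi x)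
      ((- psi' x) * eta x + (c - psi x) * deta x - kappa * psi' x).
    have he := is_derive_eta.
    by differentiate; ring.
  exact: is_derive_continuous h.
Qed.

(** Equivalent to the growth of the momentum with the speed. Modulo derivatives
of periodic functions, [eta psi] reduces to a combination of [1] and [psi]; the
integral is [- 3 L / c (c^2 mean^2 - b mean - b c)], and [mean_sqr_ge] with
[mean < 2 c] gives the sign of the bracket. *)
Lemma inner_eta_psi_lt0 : \< eta, psi \> < 0.
Proof.
pose f x := 2^-1 * Z x * psi x ^+ 2 + 3 * psi x * psi' x + 3 * mean * psi' x.
pose r := 3 * b / c - 3 * mean * c.
pose g x := eta x * psi x - (3 * b + r * psi x).
have df x : is_derive x (1 : R) f (g x).
  rewrite /f; differentiate; rewrite /g /eta /r.
  have q2 := quad x.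
  have -> : 3 * b = 3 * (- (3^-1 * psi x ^+ 3) + c * psi x ^+ 2 - psi' x ^+ 2) by rewrite q2; ring.
  by field; rewrite gt_eqF.
have cg : continuous g.
  have he := is_derive_eta.
  move=> x; have h : is_derive x (1 : R) g
      (deta x * psi x + eta x * psi' x - r * psi' x).
    by rewrite /g; differentiate; ring.
  exact: is_derive_continuous h.
have hf : H1pair L f g.
  apply: H1pair_smooth => //.
    by move=> x; rewrite /f Z_periodic (psi_periodic W) (dpsi_periodic W).
  by move=> x; rewrite /g /eta Z_periodic (psi_periodic W) (dpsi_periodic W).
have := integral_derivative0 L0 hf.
have se := H1pair_sqi L0 H1pair_eta.
have i2 := integrable_onD (icst (3 * b)) (integrable_onZ r ipsi).
rewrite /g (integral_onB (integrable_on_mul se spsi) i2).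
rewrite (integral_onD (icst _) (integrable_onZ r ipsi)) (integral_onZ _ ipsi).
rewrite (integral_on_cst _ (ltW L0)) integral_psi -/(inner_per L eta psi) => /eqP.
rewrite subr_eq0 => /eqP ->.
have -> : 3 * b * (L - 0) + r * (mean * L) =
   - (3 * L / c) * (c ^+ 2 * mean ^+ 2 - b * mean - b * c).
  by rewrite /r; field; rewrite gt_eqF.
rewrite mulNr oppr_lt0 mulr_gt0 ?divr_gt0 ?mulr_gt0//.
have := mean_sqr_ge; have := mean_lt; have := mean_gt0; move: (mean) => m m0 mc mb.
have h1 : 3 * b * (m + c) <= c * m ^+ 2 * (m + c) by rewrite ler_pM2r//; lra.
have h2 : 0 < c * m ^+ 2 * (2 * c - m) by rewrite !mulr_gt0 ?subr_gt0 ?exprn_gt0.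
lra.
Qed.

(** ** Coercivity *)

Lemma psi_bounds : exists2 m, 0 < m & exists M, forall x, 0 <= x <= L -> m <= psi x <= M.
Proof.
have cw : {within `[0, L], continuous psi}.
  by apply: continuous_subspaceT => x; exact: psi_continuous.
have [u _ hu] := EVT_min (ltW L0) cw.
have [v _ hv] := EVT_max (ltW L0) cw.
exists (psi u) => //; exists (psi v) => x xL.
by rewrite hu ?hv// in_itv.
Qed.

(** A convex combination of the two lower bounds for [Q]. In the applications [A]
and [B] are the squared norms of a function and of its derivative. *)
Lemma H1_of_L2_coercive (d0 M : R) : 0 < d0 -> 0 < M -> exists2 d, 0 < d &
  forall A B Q T, 0 <= A -> 0 <= B -> 0 <= T ->
    d0 * A - T <= Q -> B - M * A - T <= Q -> d * (A + B) - T <= Q.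
Proof.
move=> d00 M0; pose th := d0 / (2 * (d0 + M)).
have dM : 0 < 2 * (d0 + M) by rewrite mulr_gt0// addr_gt0.
have th0 : 0 < th by rewrite divr_gt0.
have thE : th * (d0 + M) = d0 / 2 by rewrite /th; field; lra.
have th1 : th <= 1 by rewrite ler_pdivrMr//; lra.
exists (Num.min (d0 / 2) th) => [|A B Q T A0 B0 T0 h1 h2].
  by rewrite lt_min th0 divr_gt0.
have e1 : Num.min (d0 / 2) th * A <= d0 / 2 * A by rewrite ler_wpM2r// ge_min lexx.
have e2 : Num.min (d0 / 2) th * B <= th * B by rewrite ler_wpM2r// ge_min lexx orbT.
have e3 : (1 - th) * (d0 * A - T) <= (1 - th) * Q by rewrite ler_wpM2l// subr_ge0.
have e4 : th * (B - M * A - T) <= th * Q by rewrite ler_wpM2l// ltW.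
have e5 : th * d0 * A + th * M * A = d0 / 2 * A by rewrite -thE; ring.
lra.
Qed.

Lemma hill_form_lower d : exists2 M, 0 < M & forall p gp, H1pair L p gp ->
  \< gp, gp \> - M * \< p, p \> <= hill_form L (fun x => c - d * psi x) p gp.
Proof.
have [m m0 [M mM]] := psi_bounds.
pose M' := `|d| * `|M| + 1.
have M'0 : 0 < M' by rewrite ltr_wpDl// mulr_ge0.
exists M' => // p gp hp.
have sp := H1pair_sqi L0 hp; have sg := H1pair_sqi_deriv L0 hp.
have ip := integrable_on_mul sp sp; have ig := integrable_on_mul sg sg.
rewrite /inner_per -(integral_onZ _ ip) -(integral_onB ig (integrable_onZ _ ip)).
apply: le_integral_on.
- exact: integrable_onB (integrable_onZ _ ip).
- exact: hill_form_integrable (@potential_continuous d) hp.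
move=> x /mM /andP[h1 h2]; rewrite -expr2 lerD2l -mulNr -expr2 ler_wpM2r ?sqr_ge0//.
have h3 : d * psi x <= `|d| * `|M|.
  rewrite (le_trans (ler_norm _))// normrM ler_wpM2l// ger0_norm ?(ltW (psi0 x))//.
  by rewrite (le_trans h2)// ler_norm.
by rewrite /M'; have := c0; lra.
Qed.

Lemma transversal_coercive d : d < 2^-1 -> exists2 del, 0 < del &
  forall p gp, H1pair L p gp ->
  del * (\< p, p \> + \< gp, gp \>) <= hill_form L (fun x => c - d * psi x) p gp.
Proof.
move=> d2; have [m m0 [M mM]] := psi_bounds.
have [M1 M10 HM] := hill_form_lower d.
have dm : 0 < (2^-1 - d) * m by rewrite mulr_gt0// subr_gt0.
have [del del0 H] := H1_of_L2_coercive dm M10.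
exists del => // p gp hp.
have := H _ _ (hill_form L (fun x => c - d * psi x) p gp) 0
  (@inner_ge0 R L p) (@inner_ge0 R L gp) (lexx _).
rewrite !subr0; apply; last exact: HM.
apply: le_trans (transversal_form_ge d hp).
have sp := H1pair_sqi L0 hp; have ip := integrable_on_mul sp sp.
rewrite -mulrA ler_wpM2l ?subr_ge0 ?(ltW d2)// /inner_per -integral_onZ//.
apply: le_integral_on; first exact: integrable_onZ.
  apply: (@eq_integrable_on _ _ _ (fun x => (psi x * p x) * p x)).
    by move=> x _; ring.
  have hpp := H1pair_primitive L0 0 L hp.
  apply: (primitive_mul_integrable hpp); apply: (primitive_mul_integrable hpp).
  exact: (continuous_integrable_on _ _ (@psi_continuous)).
by move=> x /mM /andP[h1 _]; rewrite -expr2 ler_wpM2r// sqr_ge0.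
Qed.

Context {lam : R} {chi : R -> R} (lam0 : 0 < lam).
Context (N : two_node_solution L lam (fun x => c - psi x) chi).
Local Notation n0 := (node0 N).
Local Notation n1 := (node1 N).
Local Notation Q1 := (hill_form L (fun x => c - 1 * psi x)).

(** The nodes cut a period into two intervals on each of which [chi] has a
constant sign. *)
Lemma node_form_ge p gp : H1pair L p gp -> p n0 = 0 -> p n1 = 0 ->
  lam * \< p, p \> <= Q1 p gp.
Proof.
move=> hp p0 p1.
pose q x := c - psi x - lam.
have cq : continuous q.
  move=> x; have h : is_derive x (1 : R) q (- psi' x) by rewrite /q; differentiate; ring.
  exact: is_derive_continuous h.
pose F x := gp x ^+ 2 + q x * p x ^+ 2.
have sp := H1pair_sqi L0 hp; have ip := integrable_on_mul sp sp.
have [mp mg] := H1pair_measurable L0 hp.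
have iF := hill_form_integrable L0 cq hp.
have pF : periodic F L.
  move=> x; rewrite /F /q (psi_periodic W) (H1pair_periodic_deriv hp).
  by case: hp => ->.
have mF : measurable_fun setT F.
  apply: measurable_funD; first exact: measurable_funX.
  apply: measurable_funM; last exact: measurable_funX.
  exact: continuous_measurable_fun.
have QE : Q1 p gp = \I_[0, L] F + lam * \< p, p \>.
  rewrite /inner_per -(integral_onZ _ ip) -(integral_onD iF (integrable_onZ _ ip)).
  by apply: eq_integral_on => x _; rewrite /F /q; ring.
rewrite QE lerDr -(periodic_integral_on L0 n0 mF pF iF).
have /andP[n01 n12] := node_lt N.
have [f0 f1 f2] := f_node N; have [g0 g1 g2] := df_node N.
have iF2 := periodic_integrable_on L0 n0 (n0 + L) mF pF iF.
rewrite (integral_on_split (ltW n01) (ltW n12) iF2).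
have dchi x : is_derive x (1 : R) (df N) (q x * chi x) by exact: (is_derive_df N).
have p2 : p (n0 + L) = 0 by case: hp => ->.
apply: addr_ge0.
- apply: (picone_nodes n01 (H1pair_primitive L0 _ _ hp) (is_derive_f N) dchi) => //.
  by move=> x x01; apply: (f_neq0 (t := N)); rewrite x01.
- apply: (picone_nodes n12 (H1pair_primitive L0 _ _ hp) (is_derive_f N) dchi) => //.
  by move=> x x12; apply: (f_neq0 (t := N)); rewrite x12 orbT.
Qed.

Let spsi' : sq_integrable 0 L psi'. Proof. exact: H1pair_sqi H1pair_dpsi. Qed.
Let seta : sq_integrable 0 L eta. Proof. exact: H1pair_sqi H1pair_eta. Qed.

Let comb s t x := s * eta x + t * psi' x.
Let dcomb s t x := s * deta x + t * ddpsi x.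

Let H1pair_comb s t : H1pair L (comb s t) (dcomb s t).
Proof.
apply: (H1pairD L0 (H1pairZ L0 s H1pair_eta) (H1pairZ L0 t H1pair_dpsi)).
Qed.

Let scomb s t : sq_integrable 0 L (comb s t).
Proof. exact: H1pair_sqi (H1pair_comb s t). Qed.

Let inner_dpsi_psi : \< psi', psi \> = 0.
Proof.
have := H1pair_parts L0 H1pair_psi H1pair_psi.
rewrite integral_onD; try exact: integrable_on_mul.
rewrite -/(inner_per L psi' psi) -/(inner_per L psi psi') (@innerC R L psi psi') => h.
by apply: (mulfI (_ : 2 != 0 :> R)) => //; rewrite mulr0; lra.
Qed.

(** Because [L1 psi' = 0] and [L1 eta = kappa psi], adding a combination of [eta]
and [psi'] changes the form by products with [psi] only. *)
Lemma form_add_comb p gp s t : H1pair L p gp ->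
  Q1 (fun x => p x + comb s t x) (fun x => gp x + dcomb s t x) =
  Q1 p gp + 2 * s * kappa * \< p, psi \> + s ^+ 2 * kappa * \< eta, psi \>.
Proof.
move=> hp.
have h2 : H1pair L (dcomb s t) (fun x => s * ((c - 1 * psi x) * eta x - kappa * psi x)
    + t * ((c - psi x) * psi' x)).
  apply: (H1pairD L0 (H1pairZ L0 s H1pair_deta)); apply: (H1pairZ L0).
  apply: (H1pair_smooth L0) (is_derive_ddpsi) _.
  - by move=> x; rewrite /ddpsi (psi_periodic W).
  - by move=> x; rewrite (psi_periodic W) (dpsi_periodic W).
  - move=> x.
    have h : is_derive x (1 : R) (fun x => (c - psi x) * psi' x)
        ((- psi' x) * psi' x + (c - psi x) * (c * psi x - 2^-1 * psi x ^+ 2)).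
      by differentiate; ring.
    exact: is_derive_continuous h.
have sg : sq_integrable 0 L (fun x => (s * kappa) * psi x) by exact: sq_integrableZ.
rewrite (hill_formD L0 (@potential_continuous 1) hp (H1pair_comb s t) h2 sg); last first.
  by move=> x; rewrite /comb; ring.
have sp := H1pair_sqi L0 hp.
rewrite (@innerC R L p) (innerZ _ spsi sp) (@innerC R L psi p).
rewrite (@innerC R L (comb s t)) (innerZ _ spsi (scomb s t)) (@innerC R L psi).
rewrite (innerD (sq_integrableZ s seta) (sq_integrableZ t spsi') spsi).
rewrite (innerZ _ seta spsi) (innerZ _ spsi' spsi) inner_dpsi_psi.
by ring.
Qed.

Lemma form_comb s t : Q1 (comb s t) (dcomb s t) = s ^+ 2 * kappa * \< eta, psi \>.
Proof.
have h0 : H1pair L (fun=> 0 : R) (fun=> 0).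
  by apply: (H1pair_smooth L0) => // x; exact: cvg_cst.
have := form_add_comb s t h0.
have -> : Q1 (fun=> 0) (fun=> 0) = 0.
  rewrite /hill_form (@eq_integral_on _ _ _ _ (fun=> 0)).
    by rewrite (integral_on_cst _ (ltW L0)) mul0r.
  by move=> x _; rewrite expr0n mulr0 addr0.
have -> : \< (fun=> 0), psi \> = 0.
  rewrite /inner_per (@eq_integral_on _ _ _ _ (fun=> 0)).
    by rewrite (integral_on_cst _ (ltW L0)) mul0r.
  by move=> x _; rewrite mul0r.
rewrite mulr0 !add0r => <-; congr (hill_form L _ _ _); apply/funext => x; rewrite add0r//.
Qed.

Let E : R := - (kappa * \< eta, psi \>).

Let E0 : 0 < E.
Proof. by rewrite oppr_gt0 pmulr_rlt0 ?kappa_gt0// inner_eta_psi_lt0. Qed.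

Let Nrm : R := \< psi', psi' \>.

Let N0 : 0 < Nrm.
Proof.
have [x px] := dpsi_neq0 W.
apply: (inner_gt0 L0 _ _ px); [exact: dpsi_continuous|exact: (dpsi_periodic W)].
Qed.

(** The form of [L1] is [- s^2 E <= 0] on such a combination, and it is positive
definite on the functions vanishing at both nodes. *)
Lemma comb_nodes s t : comb s t n0 = 0 -> comb s t n1 = 0 -> s = 0 /\ t = 0.
Proof.
move=> h0 h1; have := node_form_ge (H1pair_comb s t) h0 h1.
have i0 := @inner_ge0 R L (comb s t).
have l0 : 0 <= lam * \< comb s t, comb s t \> by rewrite mulr_ge0// ltW.
rewrite form_comb => h.
have s2 : s ^+ 2 * E <= 0.
  by rewrite /E; lra.
have s0 : s = 0.
  apply/eqP; rewrite -(sqrf_eq0 s) eq_le sqr_ge0 andbT.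
  by move: s2; rewrite pmulr_lle0.
split=> //.
move: h; rewrite s0 expr0n/= !mul0r pmulr_rle0// => h.
have : t ^+ 2 * Nrm <= 0.
  apply: le_trans h; rewrite /inner_per /Nrm /inner_per -integral_onZ; last exact: integrable_on_mul.
  rewrite le_eqVlt; apply/orP; left; apply/eqP; apply: eq_integral_on => x _.
  by rewrite /comb; ring.
rewrite pmulr_lle0// => t2.
by apply/eqP; rewrite -(sqrf_eq0 t) eq_le sqr_ge0 andbT.
Qed.

(** A two by two linear system, nonsingular by [comb_nodes]. *)
Lemma comb_interpolation u v : exists s t, comb s t n0 = u /\ comb s t n1 = v.
Proof.
pose D := eta n0 * psi' n1 - eta n1 * psi' n0.
have D0 : D != 0.
  apply/eqP => D0.
  have [a1 b1] : psi' n0 = 0 /\ - eta n0 = 0.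
    by apply: comb_nodes; rewrite /comb; [ring|move: D0; rewrite /D; lra].
  have [a2 b2] : psi' n1 = 0 /\ - eta n1 = 0.
    by apply: comb_nodes; rewrite /comb; [move: D0; rewrite /D; lra|ring].
  have [] : (1 : R) = 0 /\ (0 : R) = 0; last by move/eqP; rewrite oner_eq0.
  apply: comb_nodes; rewrite /comb; lra.
exists ((u * psi' n1 - v * psi' n0) / D), ((v * eta n0 - u * eta n1) / D).
by rewrite /comb; split; rewrite /D; field; exact: D0.
Qed.

(** Choose [s] and [t] so that [r = p + s eta + t psi'] vanishes at both nodes.
Then [Q1 p = Q1 r + s^2 E - 2 s kappa <p, psi>], where [Q1 r] controls the norm
of [r], the second term controls [s], and orthogonality to [psi'] recovers [t]
from [r] and [s]. *)
Lemma longitudinal_coercive : exists2 del, 0 < del & exists2 C, 0 <= C &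
  forall p gp, H1pair L p gp -> \< p, psi' \> = 0 ->
  del * (\< p, p \> + \< gp, gp \>) - C * \< p, psi \> ^+ 2 <= Q1 p gp.
Proof.
have [M M0 HM] := hill_form_lower 1.
pose ee := \< eta, eta \>; pose ed := \< eta, psi' \>.
have ee0 : 0 <= ee := @inner_ge0 R L eta.
pose K := 3 * ee + 6 * (ed ^+ 2 / Nrm) + 1.
have K0 : 0 < K.
  by rewrite ltr_wpDl// addr_ge0// mulr_ge0// divr_ge0 ?sqr_ge0// ltW.
pose d0 := Num.min (lam / 9) (E / (2 * K)).
have d00 : 0 < d0 by rewrite lt_min !divr_gt0// mulr_gt0.
have [del del0 H] := H1_of_L2_coercive d00 M0.
pose C := 2 * kappa ^+ 2 / E.
have C0 : 0 <= C by rewrite divr_ge0 ?(ltW E0)// mulr_ge0// sqr_ge0.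
exists del => //; exists C => // p gp hp ppsi'.
have T0 : 0 <= C * \< p, psi \> ^+ 2 by rewrite mulr_ge0// sqr_ge0.
apply: H => //; [exact: inner_ge0|exact: inner_ge0| |]; last first.
  by have := HM _ _ hp; lra.
have sp := H1pair_sqi L0 hp.
have [s [t [c0' c1']]] := comb_interpolation (- p n0) (- p n1).
have hr := H1pairD L0 hp (H1pair_comb s t).
have := node_form_ge hr; rewrite c0' c1' !subrr => /(_ erefl erefl).
rewrite (form_add_comb s t hp).
set r := fun x => p x + comb s t x.
have sr : sq_integrable 0 L r by exact: sq_integrableD.
have rE : \< r, psi' \> = s * ed + t * Nrm.
  rewrite (innerD sp (scomb s t) spsi') ppsi' add0r.
  rewrite (innerD (sq_integrableZ s seta) (sq_integrableZ t spsi') spsi').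
  by rewrite (innerZ _ seta spsi') (innerZ _ spsi' spsi').
have CS := cauchy_schwarz_per sr spsi'; rewrite rE -/Nrm in CS.
have rr0 := @inner_ge0 R L r.
have pE : \< p, p \> <= 3 * (\< r, r \> + s ^+ 2 * ee + t ^+ 2 * Nrm).
  have ir := integrable_on_mul sr sr; have ie := integrable_on_mul seta seta.
  have id := integrable_on_mul spsi' spsi'.
  rewrite /ee /Nrm /inner_per -(integral_onZ _ ie) -(integral_onZ _ id).
  rewrite -(integral_onD ir (integrable_onZ _ ie)).
  rewrite -(integral_onD (integrable_onD ir (integrable_onZ _ ie)) (integrable_onZ _ id)).
  rewrite -integral_onZ; last first.
    by apply: integrable_onD; [apply: integrable_onD => //|]; exact: integrable_onZ.
  apply: le_integral_on; first exact: integrable_on_mul.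
    apply: integrable_onZ.
    by apply: integrable_onD; [apply: integrable_onD => //|]; exact: integrable_onZ.
  move=> x _; rewrite (_ : p x = r x - s * eta x - t * psi' x); last by rewrite /r /comb; ring.
  rewrite [leRHS](_ : _ = 3 * (r x ^+ 2 + (s * eta x) ^+ 2 + (t * psi' x) ^+ 2)); last by ring.
  move: (r x) (s * eta x) (t * psi' x) => A B D.
  have := sqr_ge0 (A + B); have := sqr_ge0 (A + D); have := sqr_ge0 (B - D); lra.
have tE : t ^+ 2 * Nrm <= 2 * \< r, r \> + 2 * s ^+ 2 * (ed ^+ 2 / Nrm).
  rewrite -(ler_pM2r N0).
  rewrite [leRHS](_ : _ = 2 * (\< r, r \> * Nrm) + 2 * (s * ed) ^+ 2); last first.
    by field; rewrite gt_eqF.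
  have := sqr_ge0 (s * ed + (s * ed + t * Nrm)); move: CS.
  rewrite (_ : t ^+ 2 * Nrm * Nrm = (t * Nrm) ^+ 2); last by ring.
  by move: (s * ed) (t * Nrm) (\< r, r \> * Nrm) => A B D; lra.
have kE : 2 * s * kappa * \< p, psi \> <= s ^+ 2 * E / 2 + C * \< p, psi \> ^+ 2.
  have := sqr_ge0 (s * E - 2 * kappa * \< p, psi \>).
  rewrite -subr_ge0 => h; rewrite -subr_ge0.
  rewrite [leRHS](_ : _ = (s * E - 2 * kappa * \< p, psi \>) ^+ 2 / (2 * E)).
    by rewrite divr_ge0 ?sqr_ge0// mulr_ge0// ltW.
  by rewrite /C; field; rewrite gt_eqF.
have sE : s ^+ 2 * kappa * \< eta, psi \> = - (s ^+ 2 * E) by rewrite /E; ring.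
rewrite sE => h.
have d1 : d0 * (9 * \< r, r \>) <= lam * \< r, r \>.
  by rewrite mulrA ler_wpM2r// -ler_pdivlMr// ge_min lexx.
have d2 : d0 * (K * s ^+ 2) <= s ^+ 2 * E / 2.
  rewrite (_ : s ^+ 2 * E / 2 = E / (2 * K) * (K * s ^+ 2)); last by field; rewrite gt_eqF.
  apply: ler_wpM2r; last by rewrite ge_min lexx orbT.
  by rewrite mulr_ge0 ?sqr_ge0// ltW.
have d3 : d0 * \< p, p \> <= d0 * (9 * \< r, r \>) + d0 * (K * s ^+ 2).
  rewrite -mulrDr ler_wpM2l ?(ltW d00)// (le_trans pE)//.
  have := sqr_ge0 s; rewrite /K; lra.
lra.
Qed.

End Coercivity.

(** * The Lyapunov functional *)

Section Lyapunov.
Context {R : realType} {L c : R} {psi : R -> R} (L0 : 0 < L).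
Context (W : wave_profile L c psi).
Context {lam : R} {chi : R -> R} (lam0 : 0 < lam).
Context (N : two_node_solution L lam (fun x => c - psi x) chi).
Context {B1 B2 B3 B4 mu : R}.
Context (hmu : mu * (B1 + B2 * mu + B3 * mu ^+ 2)
         = 2^-1 * B2 + 2 * B3 * mu + B4 * mu ^+ 2).
Context (hxi : xi B1 B2 B3 mu != 0).
Implicit Types (w g u : R -> R) (a b : R).

Local Notation "\< f , g \>" := (inner_per L f g).
Local Notation psi' := (dpsi W).
Local Notation X := (xi B1 B2 B3 mu).
Local Notation pot := (potential B1 B2 B3 B4).
Local Notation sg := (1 + mu ^+ 2).

Definition transverse_eigenvalue : R := \det (Dmx B1 B2 B3 B4 mu).
Local Notation dd := transverse_eigenvalue.

Let sg0 : 0 < sg. Proof. by rewrite ltr_wpDr// sqr_ge0. Qed.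

Lemma det_Dmx : dd = X^-1 ^+ 2 * ((2 * B1 + mu * B2) * (2 * B3 + 2 * mu * B4)
  - (B2 + 2 * mu * B3) ^+ 2).
Proof.
rewrite /transverse_eigenvalue /Dmx detZ; congr (_ * _).
rewrite (expand_det_row _ ord0) !big_ord_recl big_ord0 /cofactor !det_mx11 !mxE/=.
by rewrite !addn0/= expr0 expr1; ring.
Qed.

(** The matrix is symmetric and, by the equation for [mu], fixes [(1, mu)]; so its
other eigenvalue is its determinant, with eigenvector [(- mu, 1)]. *)
Lemma hessian_diagonal a b :
  X^-1 * ((2 * B1 + mu * B2) * a ^+ 2 + 2 * (B2 + 2 * mu * B3) * (a * b)
    + (2 * B3 + 2 * mu * B4) * b ^+ 2) =
  sg^-1 * ((a + mu * b) ^+ 2 + dd * (b - mu * a) ^+ 2).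
Proof.
rewrite det_Dmx.
pose D11 := X^-1 * (2 * B1 + mu * B2); pose D12 := X^-1 * (B2 + 2 * mu * B3).
pose D22 := X^-1 * (2 * B3 + 2 * mu * B4).
have e1 : D11 = 1 - mu * D12.
  transitivity (X^-1 * X - mu * D12); last by rewrite mulVf.
  rewrite (_ : X^-1 * X = X^-1 * (2 * B1 + mu * B2 + mu * (B2 + 2 * mu * B3))).
    by rewrite /D11 /D12; ring.
  by congr (_ * _); rewrite /xi; ring.
have e2 : mu * D22 = mu - D12.
  transitivity (X^-1 * X * mu - D12); last by rewrite mulVf// mul1r.
  rewrite (_ : X^-1 * X * mu = X^-1 * (mu * (2 * B3 + 2 * mu * B4) + (B2 + 2 * mu * B3))).
    by rewrite /D22 /D12; ring.
  rewrite -mulrA; congr (_ * _); rewrite /xi.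
  rewrite (_ : 2 * _ * mu = 2 * (mu * (B1 + B2 * mu + B3 * mu ^+ 2))); last by ring.
  by rewrite hmu; field.
have -> : X^-1 ^+ 2 * ((2 * B1 + mu * B2) * (2 * B3 + 2 * mu * B4) - (B2 + 2 * mu * B3) ^+ 2)
  = D11 * D22 - D12 ^+ 2 by rewrite /D11 /D22 /D12; ring.
have -> : X^-1 * ((2 * B1 + mu * B2) * a ^+ 2 + 2 * (B2 + 2 * mu * B3) * (a * b)
    + (2 * B3 + 2 * mu * B4) * b ^+ 2) = D11 * a ^+ 2 + 2 * D12 * (a * b) + D22 * b ^+ 2.
  by rewrite /D11 /D22 /D12; ring.
have e3 : D11 * D22 - D12 ^+ 2 = D22 - mu * D12.
  rewrite e1 (_ : _ - _ = D22 - D12 * (mu * D22) - D12 ^+ 2); last by ring.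
  by rewrite e2; ring.
rewrite e3 e1; apply: (mulfI (lt0r_neq0 sg0)); rewrite [RHS]mulrA divff ?mul1r ?lt0r_neq0//.
apply/eqP; rewrite -subr_eq0; apply/eqP.
transitivity ((mu * D22 - (mu - D12)) * (mu * b ^+ 2 - mu * a ^+ 2 + 2 * a * b)).
  by ring.
by rewrite e2 subrr mul0r.
Qed.

Definition wave1 (x : R) : R := X^-1 * psi x.
Definition wave2 (x : R) : R := X^-1 * (mu * psi x).
Definition dwave1 (x : R) : R := X^-1 * psi' x.
Definition dwave2 (x : R) : R := X^-1 * (mu * psi' x).

Lemma H1pair_wave1 : H1pair L wave1 dwave1.
Proof. exact: H1pairZ (H1pair_psi L0 W). Qed.

Lemma H1pair_wave2 : H1pair L wave2 dwave2.
Proof. by apply: H1pairZ => //; exact: H1pairZ (H1pair_psi L0 W). Qed.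

(** Taylor's formula is exact because the potential is a cubic form. *)
Lemma potential_taylor x a b :
  pot (wave1 x + a) (wave2 x + b) = pot (wave1 x) (wave2 x)
  + X^-1 * (2^-1 * psi x ^+ 2) * (a + mu * b)
  + 2^-1 * psi x * (sg^-1 * ((a + mu * b) ^+ 2 + dd * (b - mu * a) ^+ 2))
  + pot a b.
Proof.
rewrite -hessian_diagonal.
have hX : X^-1 * X = 1 by rewrite mulVf.
have hX1 : X^-1 * (B1 + B2 * mu + B3 * mu ^+ 2) = 2^-1.
  rewrite (_ : B1 + B2 * mu + B3 * mu ^+ 2 = 2^-1 * X); last by rewrite /xi; field.
  by rewrite mulrCA hX mulr1.
have hX2 : X^-1 * (2^-1 * B2 + 2 * B3 * mu + B4 * mu ^+ 2) = 2^-1 * mu.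
  by rewrite -hmu mulrCA hX1 mulrC.
have -> : X^-1 * (2^-1 * psi x ^+ 2) * (a + mu * b) =
  X^-1 * psi x ^+ 2 * (2^-1 * a + 2^-1 * mu * b) by field.
rewrite -hX2 -[X in X * a]hX1 /potential /wave1 /wave2.
by field.
Qed.

Definition pair_energy u1 g1 u2 g2 : R :=
  \I_[0, L] (fun x => 2^-1 * (g1 x ^+ 2 + g2 x ^+ 2) - pot (u1 x) (u2 x)).

Definition pair_momentum u1 u2 : R := 2^-1 * \I_[0, L] (fun x => u1 x ^+ 2 + u2 x ^+ 2).

Lemma potential_continuous2 u1 u2 : continuous u1 -> continuous u2 ->
  continuous (fun x => pot (u1 x) (u2 x)).
Proof.
move=> c1 c2 x; rewrite /potential.
have kc (r : R) : {for x, continuous (fun=> r : R)} by exact: cvg_cst.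
have X (f : R -> R) n : {for x, continuous f} -> {for x, continuous (fun y => f y ^+ n)}.
  move=> cf; elim: n => [|n IH]; first exact: kc.
  rewrite (_ : (fun y => f y ^+ n.+1) = (fun y => f y * f y ^+ n)).
    exact: (@continuousM _ _ f (fun y => f y ^+ n)).
  by apply/funext => y; rewrite exprS.
have M (f g : R -> R) : {for x, continuous f} -> {for x, continuous g} ->
  {for x, continuous (fun y => f y * g y)} by move=> *; exact: (@continuousM _ _ f g).
have A (f g : R -> R) : {for x, continuous f} -> {for x, continuous g} ->
  {for x, continuous (fun y => f y + g y)} by move=> *; exact: (@continuousD _ _ _ f g).
have cc1 := c1 x; have cc2 := c2 x.
have m1 := M _ _ (kc (3^-1 * B1)) (X _ 3%N cc1).
have m2 := M _ _ (M _ _ (kc (2^-1 * B2)) (X _ 2%N cc1)) cc2.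
have m3 := M _ _ (M _ _ (kc B3) cc1) (X _ 2%N cc2).
have m4 := M _ _ (kc (3^-1 * B4)) (X _ 3%N cc2).
exact: (A _ _ (A _ _ (A _ _ m1 m2) m3) m4).
Qed.

Lemma potential_integrable u1 g1 u2 g2 : H1pair L u1 g1 -> H1pair L u2 g2 ->
  integrable_on 0 L (fun x => pot (u1 x) (u2 x)).
Proof.
move=> h1 h2; apply: continuous_integrable_on; apply: potential_continuous2.
  exact: H1pair_continuous h1.
exact: H1pair_continuous h2.
Qed.

Lemma sqr_integrable u1 u2 : sq_integrable 0 L u1 -> sq_integrable 0 L u2 ->
  integrable_on 0 L (fun x => u1 x ^+ 2 + u2 x ^+ 2).
Proof. by move=> [_ h1] [_ h2]; exact: integrable_onD. Qed.

Local Notation long w1 w2 := (fun x => w1 x + mu * w2 x).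
Local Notation trans w1 w2 := (fun x => w2 x - mu * w1 x).

Lemma H1pair_long w1 g1 w2 g2 : H1pair L w1 g1 -> H1pair L w2 g2 ->
  H1pair L (long w1 w2) (long g1 g2).
Proof. by move=> h1 h2; apply: (H1pairD L0 h1); exact: H1pairZ. Qed.

Lemma H1pair_trans w1 g1 w2 g2 : H1pair L w1 g1 -> H1pair L w2 g2 ->
  H1pair L (trans w1 w2) (trans g1 g2).
Proof. by move=> h1 h2; apply: (H1pairB L0 h2); exact: H1pairZ. Qed.

(** The product with [psi] of the component along the wave is prescribed by the
momentum, up to a quadratic error. *)
Lemma momentum_expansion w1 w2 : sq_integrable 0 L w1 -> sq_integrable 0 L w2 ->
  pair_momentum (fun x => wave1 x + w1 x) (fun x => wave2 x + w2 x) =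
  pair_momentum wave1 wave2 + X^-1 * \< long w1 w2, psi \>
  + 2^-1 * (\< w1, w1 \> + \< w2, w2 \>).
Proof.
move=> h1 h2.
have hp := H1pair_sqi L0 (H1pair_psi L0 W).
have s1 := H1pair_sqi L0 H1pair_wave1; have s2 := H1pair_sqi L0 H1pair_wave2.
have hl : sq_integrable 0 L (long w1 w2) by apply: sq_integrableD => //; exact: sq_integrableZ.
have i0 := sqr_integrable s1 s2.
have i1 := integrable_onZ (2 * X^-1) (integrable_on_mul hl hp).
have j1 := integrable_on_mul h1 h1; have j2 := integrable_on_mul h2 h2.
have i2 := integrable_onD j1 j2.
rewrite /pair_momentum /inner_per -(integral_onD j1 j2).
rewrite (@eq_integral_on _ _ _ (fun x => (wave1 x + w1 x) ^+ 2 + _)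
  (fun x => (wave1 x ^+ 2 + wave2 x ^+ 2) + (2 * X^-1 * ((w1 x + mu * w2 x) * psi x)
   + (w1 x * w1 x + w2 x * w2 x)))); last first.
  by move=> x _; rewrite /wave1 /wave2; ring.
rewrite (integral_onD i0 (integrable_onD i1 i2)) (integral_onD i1 i2).
by rewrite (integral_onZ _ (integrable_on_mul hl hp)); field.
Qed.

(** The wave is a critical point of energy plus [c] times momentum, by the
equation of its profile; the second variation splits along the eigenvectors of
the Hessian. *)
Lemma lyapunov_expansion w1 g1 w2 g2 : H1pair L w1 g1 -> H1pair L w2 g2 ->
  pair_energy (fun x => wave1 x + w1 x) (fun x => dwave1 x + g1 x)
    (fun x => wave2 x + w2 x) (fun x => dwave2 x + g2 x)
  + c * pair_momentum (fun x => wave1 x + w1 x) (fun x => wave2 x + w2 x) =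
  pair_energy wave1 dwave1 wave2 dwave2 + c * pair_momentum wave1 wave2
  + 2^-1 * sg^-1 * (hill_form L (fun x => c - 1 * psi x) (long w1 w2) (long g1 g2)
     + hill_form L (fun x => c - dd * psi x) (trans w1 w2) (trans g1 g2))
  - \I_[0, L] (fun x => pot (w1 x) (w2 x)).
Proof.
move=> h1 h2.
have hl := H1pair_long h1 h2; have ht := H1pair_trans h1 h2.
have iw := potential_integrable h1 h2.
have ip := potential_integrable H1pair_wave1 H1pair_wave2.
have il := hill_form_integrable L0 (potential_continuous W (r := 1)) hl.
have it := hill_form_integrable L0 (potential_continuous W (r := dd)) ht.
have parts := H1pair_parts L0 (H1pair_dpsi L0 W) hl.
have sl := H1pair_sqi L0 hl; have sl' := H1pair_sqi_deriv L0 hl.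
have sp' := H1pair_sqi_deriv L0 (H1pair_psi L0 W).
have sp2 := H1pair_sqi_deriv L0 (H1pair_dpsi L0 W).
have ipa := integrable_onD (integrable_on_mul sp2 sl) (integrable_on_mul sp' sl').
have s1 := H1pair_sqi L0 H1pair_wave1; have s2 := H1pair_sqi L0 H1pair_wave2.
have s1' := H1pair_sqi_deriv L0 H1pair_wave1; have s2' := H1pair_sqi_deriv L0 H1pair_wave2.
have i0 := sqr_integrable s1 s2.
have i0' : integrable_on 0 L (fun x => 2^-1 * (dwave1 x ^+ 2 + dwave2 x ^+ 2)
   - pot (wave1 x) (wave2 x)).
  by apply: integrable_onB => //; apply: integrable_onZ; exact: sqr_integrable.
have q1 := sq_integrableD s1 (H1pair_sqi L0 h1); have q2 := sq_integrableD s2 (H1pair_sqi L0 h2).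
have j0 := sqr_integrable q1 q2.
have q1' := H1pairD L0 H1pair_wave1 h1; have q2' := H1pairD L0 H1pair_wave2 h2.
have j0' : integrable_on 0 L (fun x => 2^-1 * ((dwave1 x + g1 x) ^+ 2 + (dwave2 x + g2 x) ^+ 2)
   - pot (wave1 x + w1 x) (wave2 x + w2 x)).
  apply: integrable_onB; last exact: potential_integrable q1' q2'.
  by apply: integrable_onZ; apply: sqr_integrable; [exact: H1pair_sqi_deriv q1'|exact: H1pair_sqi_deriv q2'].
rewrite /pair_energy /pair_momentum !mulrA.
rewrite -(integral_onZ _ j0) -(integral_onD j0' (integrable_onZ _ j0)).
rewrite -(integral_onZ _ i0) -(integral_onD i0' (integrable_onZ _ i0)).
rewrite /hill_form -(integral_onD il it) -(integral_onZ _ (integrable_onD il it)).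
have k0 := integrable_onD i0' (integrable_onZ (c * 2^-1) i0).
have k1 := integrable_onZ (2^-1 * sg^-1) (integrable_onD il it).
have k2 := integrable_onZ X^-1 ipa.
have k3 := integrable_onB (integrable_onD k0 k1) iw.
rewrite -(integral_onD k0 k1) -(integral_onB (integrable_onD k0 k1) iw).
have PZ : \I_[0, L] (fun x => X^-1 * (@ddpsi R c psi x * (w1 x + mu * w2 x)
    + psi' x * (g1 x + mu * g2 x))) = 0.
  by rewrite (integral_onZ _ ipa) parts mulr0.
rewrite -[RHS]addr0 -[X in _ = _ + X]PZ -(integral_onD k3 k2).
apply: eq_integral_on => x _; rewrite potential_taylor.
have E1 a b : a ^+ 2 + b ^+ 2 = sg^-1 * ((a + mu * b) ^+ 2 + (b - mu * a) ^+ 2).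
  by field; rewrite gt_eqF.
have -> : (dwave1 x + g1 x) ^+ 2 + (dwave2 x + g2 x) ^+ 2 =
    (dwave1 x ^+ 2 + dwave2 x ^+ 2) + 2 * X^-1 * psi' x * (g1 x + mu * g2 x)
    + (g1 x ^+ 2 + g2 x ^+ 2) by rewrite /dwave1 /dwave2; ring.
have -> : (wave1 x + w1 x) ^+ 2 + (wave2 x + w2 x) ^+ 2 =
    (wave1 x ^+ 2 + wave2 x ^+ 2) + 2 * X^-1 * psi x * (w1 x + mu * w2 x)
    + (w1 x ^+ 2 + w2 x ^+ 2) by rewrite /wave1 /wave2; ring.
rewrite (E1 (g1 x)) (E1 (w1 x)) /ddpsi.
by field; rewrite hxi gt_eqF.
Qed.

End Lyapunov.

(** * A priori estimates *)

Definition H1sqr (R : realType) (L : R) (w g : R -> R) : R :=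
  inner_per L w w + inner_per L g g.

Section APriori.
Context {R : realType} {L c : R} {psi : R -> R} (L0 : 0 < L).
Context (W : wave_profile L c psi).
Context {lam : R} {chi : R -> R} (lam0 : 0 < lam).
Context (N : two_node_solution L lam (fun x => c - psi x) chi).
Context {B1 B2 B3 B4 mu : R}.
Context (hmu : mu * (B1 + B2 * mu + B3 * mu ^+ 2)
         = 2^-1 * B2 + 2 * B3 * mu + B4 * mu ^+ 2).
Context (hxi : xi B1 B2 B3 mu != 0).
Context (hD : transverse_eigenvalue (B1 := B1) (B2 := B2) (B3 := B3) (B4 := B4)
  (mu := mu) < 2^-1).
Implicit Types (w g u : R -> R) (a b : R).

Local Notation "\< f , g \>" := (inner_per L f g).
Local Notation psi' := (dpsi W).
Local Notation X := (xi B1 B2 B3 mu).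
Local Notation pot := (potential B1 B2 B3 B4).
Local Notation sg := (1 + mu ^+ 2).
Local Notation dd := (transverse_eigenvalue (B1 := B1) (B2 := B2) (B3 := B3) (B4 := B4)
  (mu := mu)).
Local Notation long w1 w2 := (fun x => w1 x + mu * w2 x).
Local Notation trans w1 w2 := (fun x => w2 x - mu * w1 x).
Local Notation wave1 := (@wave1 R psi B1 B2 B3 mu).
Local Notation wave2 := (@wave2 R psi B1 B2 B3 mu).
Local Notation dwave1 := (@dwave1 R L c psi W B1 B2 B3 mu).
Local Notation dwave2 := (@dwave2 R L c psi W B1 B2 B3 mu).

Let sg0 : 0 < sg. Proof. by rewrite ltr_wpDr// sqr_ge0. Qed.

Let half_sg0 : 0 < 2^-1 * sg^-1.
Proof. by rewrite -invfM invr_gt0 mulr_gt0. Qed.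

Lemma H1sqr_ge0 w g : 0 <= H1sqr L w g.
Proof. by rewrite addr_ge0// inner_ge0. Qed.

(** [(1, mu)] and [(- mu, 1)] are orthogonal of the same length. *)
Lemma inner_rotate w1 w2 : sq_integrable 0 L w1 -> sq_integrable 0 L w2 ->
  \< long w1 w2, long w1 w2 \> + \< trans w1 w2, trans w1 w2 \> =
  sg * (\< w1, w1 \> + \< w2, w2 \>).
Proof.
move=> h1 h2.
have j1 := integrable_on_mul h1 h1; have j2 := integrable_on_mul h2 h2.
have hl : sq_integrable 0 L (long w1 w2) by apply: sq_integrableD => //; exact: sq_integrableZ.
have ht : sq_integrable 0 L (trans w1 w2) by apply: sq_integrableB => //; exact: sq_integrableZ.
rewrite /inner_per -(integral_onD j1 j2) -(integral_onZ _ (integrable_onD j1 j2)).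
rewrite -(integral_onD (integrable_on_mul hl hl) (integrable_on_mul ht ht)).
by apply: eq_integral_on => x _; ring.
Qed.

Lemma hill_form_upper d : exists2 M, 0 < M & forall p gp, H1pair L p gp ->
  hill_form L (fun x => c - d * psi x) p gp <= M * H1sqr L p gp.
Proof.
have [m m0 [M mM]] := psi_bounds L0 W.
have c0 := wave_c_gt0 W.
pose M' := c + `|d| * `|M| + 1.
have M'0 : 0 < M' by rewrite ltr_wpDl// addr_ge0// ?mulr_ge0// ltW.
have M'1 : 1 <= M' by rewrite lerDr addr_ge0// ?mulr_ge0// ltW.
exists M' => // p gp hp.
have sp := H1pair_sqi L0 hp; have sgp := H1pair_sqi_deriv L0 hp.
have ip := integrable_on_mul sp sp; have ig := integrable_on_mul sgp sgp.
rewrite /H1sqr /inner_per -(integral_onD ip ig) -(integral_onZ _ (integrable_onD ip ig)).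
apply: le_integral_on.
- by have := hill_form_integrable L0 (potential_continuous W (r := d)) hp.
- by apply: integrable_onZ; exact: integrable_onD.
move=> x /mM /andP[h1 h2]; rewrite -!expr2 mulrDr addrC; apply: lerD.
  rewrite ler_wpM2r ?sqr_ge0//.
  have h3 : - (d * psi x) <= `|d| * `|M|.
    rewrite (le_trans (ler_norm _))// normrN normrM ler_wpM2l// ger0_norm ?(ltW (psi_gt0 W x))//.
    by rewrite (le_trans h2)// ler_norm.
  by rewrite /M'; lra.
by rewrite ler_peMl// sqr_ge0.
Qed.

Lemma potential_bound a b :
  `|pot a b| <= (`|B1| + `|B2| + `|B3| + `|B4|) * (`|a| + `|b|) * (a ^+ 2 + b ^+ 2).
Proof.
have a2 := real_normK (num_real a); have b2 := real_normK (num_real b).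
rewrite -a2 -b2.
have A0 := normr_ge0 a; have C0 := normr_ge0 b.
have mono (K r s : R) : 0 <= K <= 1 -> 0 <= r -> r <= s -> K * r <= s.
  by move=> /andP[K0 K1] r0 rs; rewrite (le_trans _ rs)// ler_piMl.
have T1 : `|3^-1 * B1 * a ^+ 3| <= `|B1| * `|a| ^+ 3.
  rewrite 2!normrM normrX -mulrA mono ?mulr_ge0 ?exprn_ge0//.
  by rewrite ger0_norm//; apply/andP; split; lra.
have T2 : `|2^-1 * B2 * a ^+ 2 * b| <= `|B2| * (`|a| ^+ 2 * `|b|).
  rewrite 3!normrM normrX -!mulrA mono ?mulr_ge0 ?exprn_ge0//.
  by rewrite ger0_norm//; apply/andP; split; lra.
have T3 : `|B3 * a * b ^+ 2| <= `|B3| * (`|a| * `|b| ^+ 2).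
  by rewrite 2!normrM normrX mulrA.
have T4 : `|3^-1 * B4 * b ^+ 3| <= `|B4| * `|b| ^+ 3.
  rewrite 2!normrM normrX -mulrA mono ?mulr_ge0 ?exprn_ge0//.
  by rewrite ger0_norm//; apply/andP; split; lra.
rewrite /potential.
apply: (@le_trans _ _ (`|B1| * `|a| ^+ 3 + `|B2| * (`|a| ^+ 2 * `|b|)
   + `|B3| * (`|a| * `|b| ^+ 2) + `|B4| * `|b| ^+ 3)).
  apply: (le_trans (ler_normD _ _)); apply: lerD => //.
  apply: (le_trans (ler_normD _ _)); apply: lerD => //.
  by apply: (le_trans (ler_normD _ _)); apply: lerD.
move: (`|a|) (`|b|) A0 C0 => x y x0 y0.
pose S := (x + y) * (x ^+ 2 + y ^+ 2).
have x2 := sqr_ge0 x; have y2 := sqr_ge0 y.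
have xy : 0 <= x * y by rewrite mulr_ge0.
have p1 : 0 <= x * x ^+ 2 by rewrite mulr_ge0.
have p2 : 0 <= y * y ^+ 2 by rewrite mulr_ge0.
have p3 : 0 <= x * y ^+ 2 by rewrite mulr_ge0.
have p4 : 0 <= y * x ^+ 2 by rewrite mulr_ge0.
have SE : S = x * x ^+ 2 + x * y ^+ 2 + y * x ^+ 2 + y * y ^+ 2 by rewrite /S; ring.
rewrite -mulrA -/S !mulrDl.
apply: lerD; [apply: lerD; [apply: lerD|]|]; apply: ler_wpM2l => //; rewrite SE.
- rewrite (_ : x ^+ 3 = x * x ^+ 2); [lra|ring].
- rewrite (_ : x ^+ 2 * y = y * x ^+ 2); [lra|ring].
- lra.
- rewrite (_ : y ^+ 3 = y * y ^+ 2); [lra|ring].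
Qed.

(** One factor is bounded by the Sobolev inequality. *)
Lemma cubic_bound : exists2 be, 0 <= be & forall w1 g1 w2 g2,
  H1pair L w1 g1 -> H1pair L w2 g2 ->
  `|\I_[0, L] (fun x => pot (w1 x) (w2 x))| <=
  be * Num.sqrt (H1sqr L w1 g1 + H1sqr L w2 g2) * (\< w1, w1 \> + \< w2, w2 \>).
Proof.
pose K := 2 / L + 2 * L.
have K0 : 0 < K by rewrite addr_gt0 ?divr_gt0// mulr_gt0.
pose BB := `|B1| + `|B2| + `|B3| + `|B4|.
have BB0 : 0 <= BB by rewrite !addr_ge0.
exists (BB * Num.sqrt (2 * K)) => [|w1 g1 w2 g2 h1 h2].
  by rewrite mulr_ge0// sqrtr_ge0.
have ipot := potential_integrable (B1 := B1) (B2 := B2) (B3 := B3) (B4 := B4) L0 h1 h2.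
rewrite (le_trans (normr_integral_on ipot))//.
set H := H1sqr L w1 g1 + H1sqr L w2 g2.
have H0 : 0 <= H by rewrite addr_ge0// H1sqr_ge0.
have sup w g x : H1pair L w g -> w x ^+ 2 <= K * H1sqr L w g.
  move=> hw; apply: (le_trans (H1pair_sup L0 x hw)); rewrite /K /H1sqr.
  have i1 := @inner_ge0 R L w; have i2 := @inner_ge0 R L g.
  have q1 : 0 <= 2 * L * \< w, w \> by rewrite mulr_ge0// mulr_ge0// ltW.
  have q2 : 0 <= 2 / L * \< g, g \> by rewrite mulr_ge0// divr_ge0// ltW.
  lra.
have s1 := H1pair_sqi L0 h1; have s2 := H1pair_sqi L0 h2.
have j1 := integrable_on_mul s1 s1; have j2 := integrable_on_mul s2 s2.
rewrite /inner_per -(integral_onD j1 j2) -(integral_onZ _ (integrable_onD j1 j2)).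
apply: le_integral_on.
- exact: integrable_on_norm.
- by apply: integrable_onZ; exact: integrable_onD.
move=> x _; rewrite (le_trans (potential_bound _ _))// -!expr2.
rewrite ler_wpM2r ?addr_ge0 ?sqr_ge0// -/BB -mulrA ler_wpM2l//.
rewrite -sqrtrM ?mulr_ge0 ?(ltW K0)//.
rewrite -[leLHS]ger0_norm ?addr_ge0// -sqrtr_sqr ler_wsqrtr//.
have e1 := sup _ _ x h1; have e2 := sup _ _ x h2.
rewrite -(real_normK (num_real (w1 x))) in e1.
rewrite -(real_normK (num_real (w2 x))) in e2.
have := sqr_ge0 (`|w1 x| - `|w2 x|); rewrite /H.
move: e1 e2; move: (`|w1 x|) (`|w2 x|) (K) => A B C; lra.
Qed.

Local Notation dL w1 g1 w2 g2 :=
  ((@pair_energy R L B1 B2 B3 B4 (fun x => wave1 x + w1 x) (fun x => dwave1 x + g1 x)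
      (fun x => wave2 x + w2 x) (fun x => dwave2 x + g2 x)
    + c * @pair_momentum R L (fun x => wave1 x + w1 x) (fun x => wave2 x + w2 x))
   - (@pair_energy R L B1 B2 B3 B4 wave1 dwave1 wave2 dwave2
    + c * @pair_momentum R L wave1 wave2)).
Local Notation dF w1 w2 :=
  (@pair_momentum R L (fun x => wave1 x + w1 x) (fun x => wave2 x + w2 x)
   - @pair_momentum R L wave1 wave2).

(** As long as [w] is small in [L^2], the cubic term and the failure of exact
orthogonality to [psi] are absorbed by the quadratic form. *)
Lemma apriori_estimate : exists2 r, 0 < r & exists A A' : R, [/\ 0 < A, 0 <= A' &
  forall w1 g1 w2 g2, H1pair L w1 g1 -> H1pair L w2 g2 ->
  \< long w1 w2, psi' \> = 0 -> \< w1, w1 \> + \< w2, w2 \> <= r ^+ 2 ->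
  H1sqr L w1 g1 + H1sqr L w2 g2 <= A * (dL w1 g1 w2 g2 + A' * (dF w1 w2) ^+ 2)].
Proof.
have [d1 d10 [C C0 H1]] := longitudinal_coercive L0 W lam0 N.
have [d2 d20 H2] := transversal_coercive L0 W hD.
have [be be0 H3] := cubic_bound.
pose d := Num.min d1 d2.
have d0 : 0 < d by rewrite lt_min d10.
pose C1 := 2^-1 * sg^-1 * C * X ^+ 2.
have C10 : 0 <= C1.
  by rewrite mulr_ge0 ?sqr_ge0// mulr_ge0// ltW.
have Cb : 0 < C1 + be + 1 by lra.
(* below this radius the error terms cost at most half of the form *)
pose r := Num.min 1 (d / 4 / (C1 + be + 1)).
have r0 : 0 < r by rewrite lt_min ltr01/= !divr_gt0.
have r1 : r <= 1 by rewrite ge_min lexx.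
have rE : C1 * r + be * r <= d / 4.
  have : (C1 + be + 1) * r <= d / 4.
    by rewrite mulrC -ler_pdivlMr// ge_min lexx orbT.
  lra.
exists r => //; exists (4 / d), (2 * C1); split; [by rewrite divr_gt0|exact: mulr_ge0|].
move=> w1 g1 w2 g2 h1 h2 orth small.
have s1 := H1pair_sqi L0 h1; have s2 := H1pair_sqi L0 h2.
have s1' := H1pair_sqi_deriv L0 h1; have s2' := H1pair_sqi_deriv L0 h2.
have hl := H1pair_long L0 (mu := mu) h1 h2; have ht := H1pair_trans L0 (mu := mu) h1 h2.
have {}H1 := H1 _ _ hl orth; have {}H2 := H2 _ _ ht; have {}H3 := H3 _ _ _ _ h1 h2.
set h := H1sqr L w1 g1 + H1sqr L w2 g2 in H3 *.
set q := \< w1, w1 \> + \< w2, w2 \> in H3 small.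
have h0 : 0 <= h by rewrite addr_ge0// H1sqr_ge0.
have q0 : 0 <= q by rewrite addr_ge0// inner_ge0.
have qh : q <= h.
  by rewrite /q /h /H1sqr; have := @inner_ge0 R L g1; have := @inner_ge0 R L g2; lra.
have EL := lyapunov_expansion L0 W (B4 := B4) hmu hxi h1 h2.
have EF := momentum_expansion L0 W hxi s1 s2.
set DL := dL w1 g1 w2 g2; set DF := dF w1 w2.
have {}EF : X^-1 * \< long w1 w2, psi \> = DF - 2^-1 * q by rewrite /DF EF /q; ring.
have rot : H1sqr L (long w1 w2) (long g1 g2) + H1sqr L (trans w1 w2) (trans g1 g2) = sg * h.
  have R1 := inner_rotate s1 s2; have R2 := inner_rotate s1' s2'.
  by rewrite /h /H1sqr; lra.
have psiE : \< long w1 w2, psi \> = X * (DF - 2^-1 * q).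
  by rewrite -EF mulrA divff// mul1r.
have F2 : (DF - 2^-1 * q) ^+ 2 <= 2 * DF ^+ 2 + 2^-1 * (r * h).
  have := sqr_ge0 (DF + 2^-1 * q).
  have qq : q ^+ 2 <= r * h.
    rewrite expr2; apply: ler_pM => //; apply: le_trans small _.
    by rewrite expr2 ler_piMl// ltW.
  lra.
have cub : be * Num.sqrt h * q <= be * r * h.
  rewrite -!mulrA ler_wpM2l//.
  have sh := sqr_sqrtr h0; have sq := sqr_sqrtr q0.
  have shq : Num.sqrt q <= Num.sqrt h by rewrite ler_wsqrtr.
  have sqr' : Num.sqrt q <= r.
    by rewrite -[leRHS]ger0_norm ?(ltW r0)// -sqrtr_sqr ler_wsqrtr.
  rewrite -{2}sh -{1}sq; have := sqrtr_ge0 q; have := sqrtr_ge0 h.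
  move: (Num.sqrt h) (Num.sqrt q) shq sqr' => a b ba br a0 b0'.
  rewrite (_ : a * b ^+ 2 = b * (a * b)); last by ring.
  by apply: ler_pM; rewrite ?mulr_ge0// expr2 ler_wpM2l.
have H3' : \I_[0, L] (fun x => pot (w1 x) (w2 x)) <= be * r * h.
  by apply: le_trans cub; apply: le_trans H3; exact: ler_norm.
have coer : d * (sg * h) - C * X ^+ 2 * (2 * DF ^+ 2 + 2^-1 * (r * h)) <=
    hill_form L (fun x => c - 1 * psi x) (long w1 w2) (long g1 g2)
    + hill_form L (fun x => c - dd * psi x) (trans w1 w2) (trans g1 g2).
  rewrite -rot mulrDr.
  have e1 : d * H1sqr L (long w1 w2) (long g1 g2) <= d1 * H1sqr L (long w1 w2) (long g1 g2).
    by rewrite ler_wpM2r ?H1sqr_ge0// ge_min lexx.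
  have e2 : d * H1sqr L (trans w1 w2) (trans g1 g2) <= d2 * H1sqr L (trans w1 w2) (trans g1 g2).
    by rewrite ler_wpM2r ?H1sqr_ge0// ge_min lexx orbT.
  have e3 : C * X ^+ 2 * (DF - 2^-1 * q) ^+ 2 <= C * X ^+ 2 * (2 * DF ^+ 2 + 2^-1 * (r * h)).
    by rewrite ler_wpM2l// mulr_ge0// sqr_ge0.
  rewrite psiE exprMn mulrA in H1.
  rewrite /H1sqr in e1 e2 *; lra.
have coer2 := ler_wpM2l (ltW half_sg0) coer.
have DLE : DL = 2^-1 * sg^-1 *
   (hill_form L (fun x => c - 1 * psi x) (long w1 w2) (long g1 g2)
    + hill_form L (fun x => c - dd * psi x) (trans w1 w2) (trans g1 g2))
   - \I_[0, L] (fun x => pot (w1 x) (w2 x)).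
  by rewrite /DL EL; ring.
have E2 : 2^-1 * sg^-1 * (d * (sg * h) - C * X ^+ 2 * (2 * DF ^+ 2 + 2^-1 * (r * h))) =
   2^-1 * d * h - C1 * (2 * DF ^+ 2 + 2^-1 * (r * h)).
  by rewrite /C1; field; rewrite gt_eqF.
have key : d / 4 * h <= DL + 2 * C1 * DF ^+ 2.
  have := ler_wpM2r h0 rE.
  have C1rh : 0 <= C1 * r * h by rewrite mulr_ge0// mulr_ge0// ltW.
  rewrite DLE; rewrite E2 in coer2; lra.
rewrite [leLHS](_ : h = 4 / d * (d / 4 * h)); last by field; rewrite gt_eqF.
by rewrite ler_wpM2l// divr_ge0// ltW.
Qed.

Lemma initial_estimate : exists2 A, 0 < A & forall w1 g1 w2 g2,
  H1pair L w1 g1 -> H1pair L w2 g2 -> H1sqr L w1 g1 + H1sqr L w2 g2 <= 1 ->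
  dL w1 g1 w2 g2 <= A * (H1sqr L w1 g1 + H1sqr L w2 g2) /\
  (dF w1 w2) ^+ 2 <= A * (H1sqr L w1 g1 + H1sqr L w2 g2).
Proof.
have [M1 M10 H1] := hill_form_upper 1.
have [M2 M20 H2] := hill_form_upper dd.
have [be be0 H3] := cubic_bound.
pose pp := \< psi, psi \>.
have pp0 : 0 <= pp := inner_ge0 psi.
pose A1 := 2^-1 * sg^-1 * ((M1 + M2) * sg) + be.
pose A2 := 2 * (X^-1 ^+ 2 * (sg * pp)) + 1.
have A10 : 0 <= A1.
  apply: addr_ge0 => //; apply: mulr_ge0; first exact: ltW.
  by apply: mulr_ge0; apply: ltW => //; exact: addr_gt0.
have A20 : 0 <= A2 by rewrite addr_ge0// mulr_ge0// mulr_ge0 ?sqr_ge0// mulr_ge0// ltW.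
exists (A1 + A2 + 1); first by lra.
move=> w1 g1 w2 g2 h1 h2 small.
have s1 := H1pair_sqi L0 h1; have s2 := H1pair_sqi L0 h2.
have s1' := H1pair_sqi_deriv L0 h1; have s2' := H1pair_sqi_deriv L0 h2.
have hl := H1pair_long L0 (mu := mu) h1 h2; have ht := H1pair_trans L0 (mu := mu) h1 h2.
have {}H1 := H1 _ _ hl; have {}H2 := H2 _ _ ht; have {}H3 := H3 _ _ _ _ h1 h2.
have R1 := inner_rotate s1 s2; have R2 := inner_rotate s1' s2'.
have EL := lyapunov_expansion L0 W (B4 := B4) hmu hxi h1 h2.
have EF := momentum_expansion L0 W hxi s1 s2.
set DL := dL w1 g1 w2 g2; set DF := dF w1 w2.
have Pl : 0 <= H1sqr L (long w1 w2) (long g1 g2) by exact: H1sqr_ge0.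
have Pt : 0 <= H1sqr L (trans w1 w2) (trans g1 g2) by exact: H1sqr_ge0.
have rot : H1sqr L (long w1 w2) (long g1 g2) + H1sqr L (trans w1 w2) (trans g1 g2)
    = sg * (H1sqr L w1 g1 + H1sqr L w2 g2).
  by rewrite /H1sqr; lra.
set h := H1sqr L w1 g1 + H1sqr L w2 g2 in H3 small rot *.
set q := \< w1, w1 \> + \< w2, w2 \> in H3 R1.
have h0 : 0 <= h by rewrite addr_ge0// H1sqr_ge0.
have q0 : 0 <= q by rewrite addr_ge0// inner_ge0.
have qh : q <= h.
  by rewrite /q /h /H1sqr; have := @inner_ge0 R L g1; have := @inner_ge0 R L g2; lra.
split.
  have DLE : DL = 2^-1 * sg^-1 *
     (hill_form L (fun x => c - 1 * psi x) (long w1 w2) (long g1 g2)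
      + hill_form L (fun x => c - dd * psi x) (trans w1 w2) (trans g1 g2))
     - \I_[0, L] (fun x => pot (w1 x) (w2 x)).
    by rewrite /DL EL; ring.
  have is0 := ltW half_sg0.
  have e1 : hill_form L (fun x => c - 1 * psi x) (long w1 w2) (long g1 g2)
      + hill_form L (fun x => c - dd * psi x) (trans w1 w2) (trans g1 g2)
      <= (M1 + M2) * (sg * h).
    rewrite -rot.
    have f1 : 0 <= M1 * H1sqr L (trans w1 w2) (trans g1 g2) by rewrite mulr_ge0// ltW.
    have f2 : 0 <= M2 * H1sqr L (long w1 w2) (long g1 g2) by rewrite mulr_ge0// ltW.
    lra.
  have e2 := ler_wpM2l is0 e1.
  have e3 : be * Num.sqrt h * q <= be * h.
    rewrite -mulrA ler_wpM2l// (le_trans _ qh)// ler_piMl//.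
    by rewrite -[leRHS]sqrtr1 ler_wsqrtr.
  have e4 := le_trans H3 e3; rewrite ler_norml in e4; have /andP[e5 _] := e4.
  have e6 : 0 <= A2 * h by rewrite mulr_ge0.
  have e7 : A1 * h = 2^-1 * sg^-1 * ((M1 + M2) * (sg * h)) + be * h by rewrite /A1; ring.
  rewrite DLE (_ : (A1 + A2 + 1) * h = A1 * h + A2 * h + h); last by ring.
  rewrite e7; lra.
have {}EF : DF = X^-1 * \< long w1 w2, psi \> + 2^-1 * q by rewrite /DF EF /q; ring.
have CS := cauchy_schwarz_per (H1pair_sqi L0 hl) (H1pair_sqi L0 (H1pair_psi L0 W)).
rewrite -/pp in CS.
have e1 : \< long w1 w2, psi \> ^+ 2 <= sg * pp * h.
  apply: (le_trans CS); rewrite mulrAC ler_wpM2r//.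
  have := @inner_ge0 R L (trans w1 w2) => t0.
  apply: (@le_trans _ _ (sg * q)); last by rewrite ler_wpM2l// ltW.
  lra.
have e2 : (X^-1 * \< long w1 w2, psi \>) ^+ 2 <= X^-1 ^+ 2 * (sg * pp * h).
  by rewrite exprMn ler_wpM2l ?sqr_ge0.
have e3 : q ^+ 2 <= h.
  by rewrite (le_trans _ qh)// expr2 ler_piMl// (le_trans qh).
have e4 : 0 <= A1 * h by rewrite mulr_ge0.
rewrite EF; have := sqr_ge0 (X^-1 * \< long w1 w2, psi \> - 2^-1 * q).
rewrite (_ : (A1 + A2 + 1) * h = A1 * h + (2 * (X^-1 ^+ 2 * (sg * pp * h)) + h) + h); last first.
  by rewrite /A2; ring.
move: e2 e3 e4.
by move: (X^-1 * \< long w1 w2, psi \>) (X^-1 ^+ 2 * (sg * pp * h)) => a b'; lra.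
Qed.

End APriori.

(** * Modulation *)

Section Taylor.
Context {R : realType}.
Implicit Types (f g : R -> R) (x y z h : R).

Lemma mean_value_bound f g x y B : x <= y ->
  (forall z, is_derive z (1 : R) f (g z)) -> continuous g ->
  (forall z, x <= z <= y -> `|g z| <= B) -> `|f y - f x| <= B * (y - x).
Proof.
move=> xy df cg gB.
have [sg H] : primitive_on x y f g by apply: primitive_derivable => // z _; exact: cg.
have ig := sq_integrable_integrable sg.
rewrite (H x y (lexx _) xy (lexx _)) (le_trans (normr_integral_on ig))//.
rewrite -(integral_on_cst _ xy); apply: le_integral_on => //.
  exact: integrable_on_norm.
by apply: continuous_integrable_on => z; exact: cvg_cst.
Qed.

Lemma mean_value_bound_norm f g x y B :
  (forall z, is_derive z (1 : R) f (g z)) -> continuous g ->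
  (forall z, `|z - x| <= `|y - x| -> `|g z| <= B) -> `|f y - f x| <= B * `|y - x|.
Proof.
move=> df cg gB; have [xy|yx] := leP x y.
  rewrite (ger0_norm (x := y - x)) ?subr_ge0//.
  apply: (mean_value_bound xy df cg) => z /andP[xz zy].
  by apply: gB; rewrite !ger0_norm ?subr_ge0//; lra.
rewrite distrC (distrC y) (ger0_norm (x := x - y)) ?subr_ge0 ?(ltW yx)//.
apply: (mean_value_bound (ltW yx) df cg) => z /andP[yz zx].
by apply: gB; rewrite distrC (distrC y) !ger0_norm ?subr_ge0//; lra.
Qed.

Lemma taylor2 f g k M z h :
  (forall x, is_derive x (1 : R) f (g x)) -> (forall x, is_derive x (1 : R) g (k x)) ->
  continuous k -> (forall x, `|k x| <= M) ->
  `|f (z + h) - f z - h * g z| <= M * h ^+ 2.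
Proof.
move=> df dg ck kM.
have cg : continuous g by move=> x; exact: is_derive_continuous (dg x).
pose F s := f s - s * g z; pose G s := g s - g z.
have dF s : is_derive s (1 : R) F (G s) by rewrite /F; differentiate; rewrite /G; ring.
have dG s : is_derive s (1 : R) G (k s) by rewrite /G; differentiate; ring.
have cG : continuous G by move=> x; exact: is_derive_continuous (dG x).
have M0 : 0 <= M by apply: le_trans (kM 0).
have -> : f (z + h) - f z - h * g z = F (z + h) - F z by rewrite /F; ring.
have zh : z + h - z = h by rewrite addrAC subrr add0r.
have := @mean_value_bound_norm F G z (z + h) (M * `|h|) dF cG.
rewrite zh => H; have {}H : `|F (z + h) - F z| <= M * `|h| * `|h|.
  apply: H => s sh; rewrite /G.
  apply: (le_trans (mean_value_bound_norm (x := z) (y := s) dg ck (fun u _ => kM u))).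
  by rewrite ler_wpM2l.
by rewrite (le_trans H)// -mulrA -expr2 real_normK// num_real.
Qed.

End Taylor.

Section Modulation.
Context {R : realType} {L c : R} {psi : R -> R} (L0 : 0 < L).
Context (W : wave_profile L c psi).
Context {B1 B2 B3 mu : R}.
Context (hxi : xi B1 B2 B3 mu != 0).
Implicit Types (w g u v : R -> R) (x y z : R).

Local Notation "\< f , g \>" := (inner_per L f g).
Local Notation psi' := (dpsi W).
Local Notation X := (xi B1 B2 B3 mu).
Local Notation sg := (1 + mu ^+ 2).
Local Notation wave1 := (@wave1 R psi B1 B2 B3 mu).
Local Notation wave2 := (@wave2 R psi B1 B2 B3 mu).

Lemma periodic_reduce x : exists2 z, 0 <= z <= L &
  forall f : R -> R, periodic f L -> f x = f z.
Proof.
pose n := Num.Def.archi_bound (`|x| / L).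
have an : 0 <= x + L *+ n.
  have : `|x| <= L *+ n.
    by rewrite -mulr_natl -ler_pdivrMr// ltW// archi_boundP// divr_ge0// ltW.
  have := ler_norm (- x); rewrite normrN; lra.
pose m := Num.truncn ((x + L *+ n) / L).
have /andP[m1 m2] : m%:R <= (x + L *+ n) / L < m.+1%:R.
  by apply: Num.Theory.truncn_itv; rewrite divr_ge0// ltW.
exists (x + L *+ n - L *+ m).
  move: m1 m2; rewrite ler_pdivlMr// ltr_pdivrMr// -natr1 mulrDl mul1r mulr_natl => a b.
  by apply/andP; split; lra.
move=> f pf; rewrite -(periodicn pf n x) -(periodicn pf m (_ - _)); congr f; ring.
Qed.

Lemma ddpsi_bounded : exists M, forall x, `|@ddpsi R c psi x| <= M.
Proof.
have hd : H1pair L (@ddpsi R c psi) (fun x => (c - psi x) * psi' x).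
  apply: (H1pair_smooth L0 _ _ (is_derive_ddpsi W)).
  - by move=> x; rewrite /ddpsi (psi_periodic W).
  - by move=> x; rewrite (psi_periodic W) (dpsi_periodic W).
  - move=> x.
    have d1 := is_derive_psi W; have d2 := is_derive_dpsi W.
    have h : is_derive x (1 : R) (fun x => (c - psi x) * psi' x)
        ((- psi' x) * psi' x + (c - psi x) * (c * psi x - 2^-1 * psi x ^+ 2)).
      by differentiate; ring.
    exact: is_derive_continuous h.
exists (1 + (2 / L * \< @ddpsi R c psi, @ddpsi R c psi \>
  + 2 * L * \< (fun x => (c - psi x) * psi' x), (fun x => (c - psi x) * psi' x) \>)) => x.
apply: le_trans (_ : _ <= 1 + (@ddpsi R c psi x) ^+ 2) _; last first.
  by rewrite lerD2l; exact: (H1pair_sup L0 x hd).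
rewrite -(real_normK (num_real (@ddpsi R c psi x))).
have := sqr_ge0 (`|@ddpsi R c psi x| - 1); have := sqr_ge0 `|@ddpsi R c psi x|; lra.
Qed.

Let spsi : sq_integrable 0 L psi. Proof. exact: H1pair_sqi (H1pair_psi L0 W). Qed.
Let spsi' : sq_integrable 0 L psi'. Proof. exact: H1pair_sqi (H1pair_dpsi L0 W). Qed.

Let sshift y : sq_integrable 0 L (fun x => psi (x + y)).
Proof. exact: H1pair_sqi (H1pair_shift L0 y (H1pair_psi L0 W)). Qed.
Let sshift' y : sq_integrable 0 L (fun x => psi' (x + y)).
Proof. exact: H1pair_sqi (H1pair_shift L0 y (H1pair_dpsi L0 W)). Qed.

Let corr u y := \< u, (fun x => psi (x + y)) \>.
Let dcorr u y := \< u, (fun x => psi' (x + y)) \>.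

(** A second order expansion replaces differentiation under the integral. *)
Lemma correlation_taylor u : sq_integrable 0 L u -> exists2 K, 0 <= K &
  forall y h, `|corr u (y + h) - corr u y - h * dcorr u y| <= K * h ^+ 2.
Proof.
move=> su; have [M HM] := ddpsi_bounded.
have iu := sq_integrable_integrable su.
have au := integrable_on_norm iu.
have M0 : 0 <= M by apply: le_trans (HM 0).
exists (M * \I_[0, L] (fun x => `|u x|)); first by rewrite mulr_ge0// integral_on_ge0.
move=> y h; rewrite /corr /dcorr /inner_per.
have j1 := integrable_on_mul su (sshift (y + h)).
have j2 := integrable_on_mul su (sshift y).
have j3 := integrable_on_mul su (sshift' y).
rewrite -(integral_onZ _ j3) -(integral_onB j1 j2).
rewrite -(integral_onB (integrable_onB j1 j2) (integrable_onZ _ j3)).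
have j4 := integrable_onB (integrable_onB j1 j2) (integrable_onZ h j3).
rewrite (le_trans (normr_integral_on j4))// mulrAC -integral_onZ//.
apply: le_integral_on; [exact: integrable_on_norm|exact: integrable_onZ|].
move=> x _.
rewrite (_ : _ - _ = u x * (psi (x + y + h) - psi (x + y) - h * psi' (x + y))); last first.
  by rewrite addrA; ring.
rewrite normrM mulrC ler_wpM2r//.
apply: (taylor2 _ _ (is_derive_psi W) (is_derive_dpsi W)) => //.
exact: (ddpsi_continuous W).
Qed.

Lemma correlation_continuous u : sq_integrable 0 L u -> continuous (corr u).
Proof.
move=> su y; have [K K0 HK] := correlation_taylor su.
apply/cvgrPdist_lt => e e0.
pose D := `|dcorr u y| + K + 1.
have D0 : 0 < D by rewrite ltr_wpDl// addr_ge0.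
have eD : 0 < Num.min 1 (e / D) by rewrite lt_min ltr01 divr_gt0.
near=> z.
have zy : `|z - y| < Num.min 1 (e / D).
  by near: z; rewrite near_simpl; exact: cvgr_distC_lt eD.
have {zy}[z1 z2] : `|z - y| < 1 /\ `|z - y| < e / D by move: zy; rewrite lt_min => /andP.
have := HK y (z - y); rewrite (_ : y + (z - y) = z); last by ring.
move=> H; rewrite distrC.
rewrite (_ : corr u z - corr u y = (corr u z - corr u y - (z - y) * dcorr u y)
  + (z - y) * dcorr u y); last by ring.
rewrite (le_lt_trans (ler_normD _ _))// normrM.
have h0 := normr_ge0 (z - y).
have H2 : K * (z - y) ^+ 2 <= K * `|z - y|.
  by rewrite ler_wpM2l// -real_normK ?num_real// expr2 ler_piMl// ltW.
have H3 : `|z - y| * D < e by rewrite -ltr_pdivlMr.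
apply: le_lt_trans H3; rewrite /D !mulrDr mulr1.
have := le_trans H H2; lra.
Unshelve. all: by end_near. Qed.

Definition distance_at (u1 u2 : R -> R) y : R :=
  \< (fun x => u1 x - wave1 (x + y)), (fun x => u1 x - wave1 (x + y)) \>
  + \< (fun x => u2 x - wave2 (x + y)), (fun x => u2 x - wave2 (x + y)) \>.

Local Notation long w1 w2 := (fun x => w1 x + mu * w2 x).

Lemma distance_at_corr u1 u2 y : sq_integrable 0 L u1 -> sq_integrable 0 L u2 ->
  distance_at u1 u2 y = \< u1, u1 \> + \< u2, u2 \>
    - 2 * X^-1 * corr (long u1 u2) y + X^-1 ^+ 2 * sg * \< psi, psi \>.
Proof.
move=> h1 h2.
have hl : sq_integrable 0 L (long u1 u2) by apply: sq_integrableD => //; exact: sq_integrableZ.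
have pE : \< psi, psi \> = \< (fun x => psi (x + y)), (fun x => psi (x + y)) \>.
  rewrite inner_shift//; try exact: (psi_periodic W).
  - by case: (H1pair_measurable L0 (H1pair_psi L0 W)).
  - by case: (H1pair_measurable L0 (H1pair_psi L0 W)).
have s1 : sq_integrable 0 L (fun x => u1 x - wave1 (x + y)).
  by apply: sq_integrableB => //; exact: sq_integrableZ.
have s2 : sq_integrable 0 L (fun x => u2 x - wave2 (x + y)).
  by apply: sq_integrableB => //; apply: sq_integrableZ; exact: sq_integrableZ.
have j1 := integrable_on_mul h1 h1; have j2 := integrable_on_mul h2 h2.
have jl := integrable_on_mul hl (sshift y); have jp := integrable_on_mul (sshift y) (sshift y).
rewrite pE /distance_at /corr /inner_per.
rewrite -(integral_onD (integrable_on_mul s1 s1) (integrable_on_mul s2 s2)).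
rewrite -(integral_onZ _ jl) -(integral_onZ _ jp) -(integral_onD j1 j2).
have jd := integrable_onD j1 j2; have jb := integrable_onB jd (integrable_onZ (2 * X^-1) jl).
rewrite -(integral_onB jd (integrable_onZ (2 * X^-1) jl)).
rewrite -(integral_onD jb (integrable_onZ (X^-1 ^+ 2 * sg) jp)).
by apply: eq_integral_on => x _; rewrite /wave1 /wave2; ring.
Qed.

(** The distance is continuous and periodic in the translation, hence attains its
minimum; the orthogonality is the stationarity condition there. *)
Lemma best_translation u1 u2 : sq_integrable 0 L u1 -> sq_integrable 0 L u2 ->
  exists2 y, forall z, distance_at u1 u2 y <= distance_at u1 u2 z &
    \< long u1 u2, (fun x => psi' (x + y)) \> = 0.
Proof.
move=> h1 h2.
have hl : sq_integrable 0 L (long u1 u2) by apply: sq_integrableD => //; exact: sq_integrableZ.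
pose f y := X^-1 * corr (long u1 u2) y.
have cf : continuous f.
  move=> y; apply: (@continuousM _ _ (fun=> X^-1) (corr (long u1 u2))); first exact: cvg_cst.
  exact: correlation_continuous.
have pf : periodic f L.
  move=> y; rewrite /f /corr; congr (_ * inner_per L _ _).
  by apply/funext => x; rewrite addrA (psi_periodic W).
have [y _ ymax] := EVT_max (ltW L0) (continuous_subspaceT cf).
have gmax z : f z <= f y.
  by have [z' z'L ->] := periodic_reduce z; rewrite ?ymax// in_itv.
exists y => [z|].
  rewrite !distance_at_corr//; have := gmax z; rewrite /f.
  rewrite -!(mulrA 2); move: (X^-1 * corr _ z) (X^-1 * corr _ y) => a b; lra.
have [K K0 HK] := correlation_taylor hl.
pose be := X^-1 * dcorr (long u1 u2) y.
have step h : h * be <= `|X^-1| * K * h ^+ 2.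
  have := gmax (y + h); have := HK y h.
  move=> /(ler_wpM2l (normr_ge0 X^-1)); rewrite -normrM mulrA => H1 H2.
  have := ler_norm (- (X^-1 * (corr (long u1 u2) (y + h) - corr (long u1 u2) y
     - h * dcorr (long u1 u2) y))).
  rewrite normrN => H3; have := le_trans H3 H1; move: H2; rewrite /f /be; lra.
have be0 : be = 0.
  apply/eqP/negPn/negP => be0.
  pose K1 := `|X^-1| * K.
  have K10 : 0 <= K1 by rewrite mulr_ge0.
  have := step (be / (K1 + 1)).
  have b2 : 0 < be ^+ 2 by rewrite lt_def sqrf_eq0 be0 sqr_ge0.
  have K11 : 0 < K1 + 1 by lra.
  rewrite -/K1 (_ : be / (K1 + 1) * be = be ^+ 2 / (K1 + 1) ^+ 2 * (K1 + 1)); last by field; lra.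
  rewrite (_ : K1 * (be / (K1 + 1)) ^+ 2 = be ^+ 2 / (K1 + 1) ^+ 2 * K1); last by field; lra.
  have pos : 0 < be ^+ 2 / (K1 + 1) ^+ 2 by rewrite divr_gt0// exprn_gt0.
  by rewrite ler_pM2l// => ?; lra.
move/eqP: be0; rewrite mulf_eq0 invr_eq0 (negbTE hxi)/= => /eqP.
by [].
Qed.

End Modulation.

(** * Orbital stability *)

Section Orbit.
Context {R : realType} {L c : R} {psi : R -> R} (L0 : 0 < L).
Context (W : wave_profile L c psi).
Context {lam : R} {chi : R -> R} (lam0 : 0 < lam).
Context (N : two_node_solution L lam (fun x => c - psi x) chi).
Context {B1 B2 B3 B4 mu : R}.
Context (hmu : mu * (B1 + B2 * mu + B3 * mu ^+ 2)
         = 2^-1 * B2 + 2 * B3 * mu + B4 * mu ^+ 2).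
Context (hxi : xi B1 B2 B3 mu != 0).
Context (hD : transverse_eigenvalue (B1 := B1) (B2 := B2) (B3 := B3) (B4 := B4)
  (mu := mu) < 2^-1).
Implicit Types (u v : vfun R) (x y z : R).

Local Notation "\< f , g \>" := (inner_per L f g).
Local Notation psi' := (dpsi W).
Local Notation wave1 := (@wave1 R psi B1 B2 B3 mu).
Local Notation wave2 := (@wave2 R psi B1 B2 B3 mu).
Local Notation dwave1 := (@dwave1 R L c psi W B1 B2 B3 mu).
Local Notation dwave2 := (@dwave2 R L c psi W B1 B2 B3 mu).
Local Notation long w1 w2 := (fun x => w1 x + mu * w2 x).
Local Notation phi := ((wave1, wave2) : vfun R).
Local Notation dist2 u y := (@distance_at R L psi B1 B2 B3 mu u.1 u.2 y).
Local Notation energyP := (@pair_energy R L B1 B2 B3 B4).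
Local Notation momentumP := (@pair_momentum R L).

Let hw1 : H1pair L wave1 dwave1. Proof. exact: H1pair_wave1. Qed.
Let hw2 : H1pair L wave2 dwave2. Proof. exact: H1pair_wave2. Qed.

Lemma H1per_pair f : H1per L f -> H1pair L f (wderiv L f).
Proof. by move=> hf; split; [case: hf|exact: wderivP]. Qed.

Lemma H1norm2_shift w g y : H1pair L w g -> H1norm2 L (fun x => w (x + y)) = H1sqr L w g.
Proof.
move=> hw; have [_ hs] := H1pair_shift L0 y hw.
have [mw mg] := H1pair_measurable L0 hw.
rewrite (H1norm2E L0 hs) !inner_sqr /H1sqr.
have pw : periodic w L by case: hw.
have pg := H1pair_periodic_deriv hw.
have sw := H1pair_sqi L0 hw; have sgw := H1pair_sqi_deriv L0 hw.
by rewrite (inner_shift L0 y mw mw pw pw sw sw) (inner_shift L0 y mg mg pg pg sgw sgw).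
Qed.

Lemma pair_energy_shift (u1 g1 u2 g2 : R -> R) y : H1pair L u1 g1 -> H1pair L u2 g2 ->
  energyP (fun x => u1 (x + y)) (fun x => g1 (x + y)) (fun x => u2 (x + y))
    (fun x => g2 (x + y)) = energyP u1 g1 u2 g2.
Proof.
move=> h1 h2; have [m1 n1] := H1pair_measurable L0 h1; have [m2 n2] := H1pair_measurable L0 h2.
have ip := potential_integrable L0 (B1 := B1) (B2 := B2) (B3 := B3) (B4 := B4) h1 h2.
apply: (@periodic_integral_shift R L L0 y
  (fun x => 2^-1 * (g1 x ^+ 2 + g2 x ^+ 2) - potential B1 B2 B3 B4 (u1 x) (u2 x))).
- apply: measurable_funB.
    apply: measurable_funM; first exact: measurable_cst.
    by apply: measurable_funD; exact: measurable_funX.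
  apply: continuous_measurable_fun; apply: potential_continuous2.
    exact: (H1pair_continuous L0 h1).
  exact: (H1pair_continuous L0 h2).
- move=> x; rewrite (H1pair_periodic_deriv h1) (H1pair_periodic_deriv h2).
  by case: h1 => ->; case: h2 => ->.
- apply: integrable_onB => //; apply: integrable_onZ; apply: sqr_integrable.
    exact: (H1pair_sqi_deriv L0 h1).
  exact: (H1pair_sqi_deriv L0 h2).
Qed.

Lemma pair_momentum_shift (u1 g1 u2 g2 : R -> R) y : H1pair L u1 g1 -> H1pair L u2 g2 ->
  momentumP (fun x => u1 (x + y)) (fun x => u2 (x + y)) = momentumP u1 u2.
Proof.
move=> h1 h2; have [m1 _] := H1pair_measurable L0 h1; have [m2 _] := H1pair_measurable L0 h2.
rewrite /pair_momentum; congr (_ * _).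
apply: (@periodic_integral_shift R L L0 y (fun x => u1 x ^+ 2 + u2 x ^+ 2)).
- by apply: measurable_funD; exact: measurable_funX.
- by move=> x; case: h1 => ->; case: h2 => ->.
- apply: sqr_integrable; [exact: (H1pair_sqi L0 h1)|exact: (H1pair_sqi L0 h2)].
Qed.

(** The state is translated back by [y], rather than the wave forward, so that
the estimates around the untranslated wave apply. *)
Section Displacement.
Context (u : vfun R) (hu : inX L u) (y : R).

Definition disp1 x := u.1 (x - y) - wave1 x.
Definition disp2 x := u.2 (x - y) - wave2 x.
Definition ddisp1 x := wderiv L u.1 (x - y) - dwave1 x.
Definition ddisp2 x := wderiv L u.2 (x - y) - dwave2 x.

Let hu1 : H1pair L u.1 (wderiv L u.1). Proof. by case: hu => h _; exact: H1per_pair. Qed.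
Let hu2 : H1pair L u.2 (wderiv L u.2). Proof. by case: hu => _ h; exact: H1per_pair. Qed.

Lemma H1pair_disp1 : H1pair L disp1 ddisp1.
Proof. exact: (H1pairB L0 (H1pair_shift L0 (- y) hu1) hw1). Qed.

Lemma H1pair_disp2 : H1pair L disp2 ddisp2.
Proof. exact: (H1pairB L0 (H1pair_shift L0 (- y) hu2) hw2). Qed.

Lemma Xdist_disp :
  Xdist L u (translate y phi) = Num.sqrt (H1sqr L disp1 ddisp1 + H1sqr L disp2 ddisp2).
Proof.
rewrite /Xdist /Xnorm -(H1norm2_shift y H1pair_disp1) -(H1norm2_shift y H1pair_disp2).
have -> : (fun x => disp1 (x + y)) = (vsub u (translate y phi)).1.
  by apply/funext => x; rewrite /disp1 addrK.
have -> : (fun x => disp2 (x + y)) = (vsub u (translate y phi)).2.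
  by apply/funext => x; rewrite /disp2 addrK.
by [].
Qed.

Lemma distance_at_disp : dist2 u y = \< disp1, disp1 \> + \< disp2, disp2 \>.
Proof.
have key w g : H1pair L w g ->
    \< w, w \> = \< (fun x => w (x + y)), (fun x => w (x + y)) \>.
  move=> h; have [m _] := H1pair_measurable L0 h.
  by rewrite inner_shift//; [case: h|case: h|exact: (H1pair_sqi L0 h)|exact: (H1pair_sqi L0 h)].
rewrite (key _ _ H1pair_disp1) (key _ _ H1pair_disp2) /distance_at /disp1 /disp2.
by congr (_ + _); apply: eq_integral_on => x _; rewrite addrK.
Qed.

Lemma energy_disp : energyP (fun x => wave1 x + disp1 x) (fun x => dwave1 x + ddisp1 x)
  (fun x => wave2 x + disp2 x) (fun x => dwave2 x + ddisp2 x) = energy L B1 B2 B3 B4 u.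
Proof.
have e1 : (fun x => wave1 x + disp1 x) = (fun x => u.1 (x - y)).
  by apply/funext => x; rewrite /disp1 addrC subrK.
have e2 : (fun x => wave2 x + disp2 x) = (fun x => u.2 (x - y)).
  by apply/funext => x; rewrite /disp2 addrC subrK.
have d1 : (fun x => dwave1 x + ddisp1 x) = (fun x => wderiv L u.1 (x - y)).
  by apply/funext => x; rewrite /ddisp1 addrC subrK.
have d2 : (fun x => dwave2 x + ddisp2 x) = (fun x => wderiv L u.2 (x - y)).
  by apply/funext => x; rewrite /ddisp2 addrC subrK.
rewrite e1 e2 d1 d2; exact: (pair_energy_shift (- y) hu1 hu2).
Qed.

Lemma momentum_disp : momentumP (fun x => wave1 x + disp1 x) (fun x => wave2 x + disp2 x)
  = momentum L u.
Proof.
have e1 : (fun x => wave1 x + disp1 x) = (fun x => u.1 (x - y)).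
  by apply/funext => x; rewrite /disp1 addrC subrK.
have e2 : (fun x => wave2 x + disp2 x) = (fun x => u.2 (x - y)).
  by apply/funext => x; rewrite /disp2 addrC subrK.
rewrite e1 e2; exact: (pair_momentum_shift (- y) hu1 hu2).
Qed.

Lemma orthogonal_disp : \< long u.1 u.2, (fun x => psi' (x + y)) \> = 0 ->
  \< long disp1 disp2, psi' \> = 0.
Proof.
move=> orth.
have hp := H1pair_psi L0 W.
have hl := H1pair_long L0 (mu := mu) hu1 hu2.
have hl' := H1pair_shift L0 (- y) hl.
have [ml _] := H1pair_measurable L0 hl'; have [_ mp] := H1pair_measurable L0 hp.
have sl := H1pair_sqi L0 hl'; have sp := H1pair_sqi L0 hp; have sp' := H1pair_sqi_deriv L0 hp.
have orth' : \< (fun x => long u.1 u.2 (x - y)), psi' \> = 0.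
  rewrite -orth -(inner_shift L0 y ml mp _ (dpsi_periodic W) sl sp'); last by case: hl'.
  by apply: eq_integral_on => x _; rewrite addrK.
have zero : \< psi, psi' \> = 0.
  have := H1pair_parts L0 hp hp.
  rewrite (@eq_integral_on _ _ _ _ (fun x => 2 * (psi x * psi' x))); last by move=> x _; ring.
  by rewrite (integral_onZ _ (integrable_on_mul sp sp')) -/(inner_per L psi psi'); lra.
transitivity (\< (fun x => (fun x => long u.1 u.2 (x - y)) x
   + (- ((xi B1 B2 B3 mu)^-1 * (1 + mu ^+ 2))) * psi x), psi' \>).
  by apply: eq_integral_on => x _; rewrite /disp1 /disp2 /wave1 /wave2; ring.
by rewrite (innerD sl (sq_integrableZ _ sp) sp') orth' (innerZ _ sp sp') zero mulr0 addr0.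
Qed.

End Displacement.

(** The two requirements are kept together: the minimality makes the distance
Lipschitz in [u], the orthogonality feeds the a priori estimate. *)
Definition best_shift (u : vfun R) : R :=
  xget 0 [set y | (forall z, dist2 u y <= dist2 u z) /\
    \< long u.1 u.2, (fun x => psi' (x + y)) \> = 0].

Definition orbit_distance (u : vfun R) : R := Num.sqrt (dist2 u (best_shift u)).

Lemma inX_sqi u : inX L u -> sq_integrable 0 L u.1 /\ sq_integrable 0 L u.2.
Proof. by move=> [/H1per_pair h1 /H1per_pair h2]; split; [exact: (H1pair_sqi L0 h1)|exact: (H1pair_sqi L0 h2)]. Qed.

Lemma best_shiftP u : inX L u -> (forall z, dist2 u (best_shift u) <= dist2 u z) /\
  \< long u.1 u.2, (fun x => psi' (x + best_shift u)) \> = 0.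
Proof.
move=> /inX_sqi[s1 s2]; have [y H1 H2] := best_translation L0 W hxi s1 s2.
rewrite /best_shift; set A := [set y | _].
by have : A (xget 0 A) by apply: (@xgetI _ 0 A y).
Qed.

Lemma distance_at_ge0 u y : 0 <= dist2 u y.
Proof. by rewrite addr_ge0// inner_ge0. Qed.

Lemma orbit_distance_le u y : inX L u -> orbit_distance u <= Num.sqrt (dist2 u y).
Proof. by move=> /best_shiftP[H _]; rewrite ler_wsqrtr. Qed.

Lemma distance_le_Xdist u y : inX L u -> Num.sqrt (dist2 u y) <= Xdist L u (translate y phi).
Proof.
move=> hu; rewrite Xdist_disp// distance_at_disp// ler_wsqrtr// /H1sqr.
have := @inner_ge0 R L (ddisp1 u y); have := @inner_ge0 R L (ddisp2 u y); lra.
Qed.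

Lemma minkowski_pair f1 f2 g1 g2 : sq_integrable 0 L f1 -> sq_integrable 0 L f2 ->
  sq_integrable 0 L g1 -> sq_integrable 0 L g2 ->
  Num.sqrt (\< (fun x => f1 x + g1 x), (fun x => f1 x + g1 x) \>
    + \< (fun x => f2 x + g2 x), (fun x => f2 x + g2 x) \>) <=
  Num.sqrt (\< f1, f1 \> + \< f2, f2 \>) + Num.sqrt (\< g1, g1 \> + \< g2, g2 \>).
Proof.
move=> hf1 hf2 hg1 hg2.
have E f g t : sq_integrable 0 L f -> sq_integrable 0 L g ->
    \< (fun x => f x + t * g x), (fun x => f x + t * g x) \> =
    \< f, f \> + 2 * t * \< f, g \> + t ^+ 2 * \< g, g \>.
  by move=> hf hg; rewrite -!inner_sqr /inner_per -integral_on_sqD.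
set F := \< f1, f1 \> + \< f2, f2 \>; set G := \< g1, g1 \> + \< g2, g2 \>.
have F0 : 0 <= F by rewrite addr_ge0// inner_ge0.
have G0 : 0 <= G by rewrite addr_ge0// inner_ge0.
set H := \< f1, g1 \> + \< f2, g2 \>.
have CS : H ^+ 2 <= F * G.
  apply: quadratic_discriminant => // t.
  have := @inner_ge0 R L (fun x => f1 x + t * g1 x).
  have := @inner_ge0 R L (fun x => f2 x + t * g2 x).
  by rewrite !E// /F /G /H; lra.
have -> : \< (fun x => f1 x + g1 x), (fun x => f1 x + g1 x) \>
    + \< (fun x => f2 x + g2 x), (fun x => f2 x + g2 x) \> = F + 2 * H + G.
  have := E f1 g1 1 hf1 hg1; have := E f2 g2 1 hf2 hg2.
  under [X in \< X, X \>]eq_fun do rewrite mul1r.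
  move=> ->.
  under [X in \< X, X \>]eq_fun do rewrite mul1r.
  by move=> ->; rewrite /F /G /H; ring.
have rF := sqr_sqrtr F0; have rG := sqr_sqrtr G0.
have f0 := sqrtr_ge0 F; have g0 := sqrtr_ge0 G.
rewrite -[leRHS]ger0_norm ?addr_ge0// -sqrtr_sqr ler_wsqrtr//.
have HH : H <= Num.sqrt F * Num.sqrt G.
  rewrite (le_trans (ler_norm _))// -ler_sqr ?nnegrE ?mulr_ge0//.
  by rewrite real_normK ?num_real// exprMn rF rG.
by rewrite sqrrD rF rG mulr2n; lra.
Qed.

Lemma orbit_distance_lipschitz u v : inX L u -> inX L v ->
  orbit_distance u <= orbit_distance v + Xdist L u v.
Proof.
move=> hu hv; set y := best_shift v.
apply: (le_trans (orbit_distance_le y hu)).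
have [u1 u2] := inX_sqi hu; have [v1 v2] := inX_sqi hv.
have sw1 : sq_integrable 0 L (fun x => wave1 (x + y)).
  exact: (H1pair_sqi L0 (H1pair_shift L0 y hw1)).
have sw2 : sq_integrable 0 L (fun x => wave2 (x + y)).
  exact: (H1pair_sqi L0 (H1pair_shift L0 y hw2)).
have M := minkowski_pair (sq_integrableB v1 sw1) (sq_integrableB v2 sw2)
  (sq_integrableB u1 v1) (sq_integrableB u2 v2).
apply: (@le_trans _ _ (orbit_distance v + Num.sqrt
  (\< (fun x => u.1 x - v.1 x), (fun x => u.1 x - v.1 x) \>
  + \< (fun x => u.2 x - v.2 x), (fun x => u.2 x - v.2 x) \>))).
  apply: le_trans M; rewrite le_eqVlt; apply/orP; left; apply/eqP; congr Num.sqrt.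
  by rewrite /distance_at; congr (_ + _); apply: eq_integral_on => x _; ring.
rewrite lerD2l /Xdist /Xnorm ler_wsqrtr//.
case: hu => /H1per_pair hu1 /H1per_pair hu2; case: hv => /H1per_pair hv1 /H1per_pair hv2.
have [_ k1] := H1pairB L0 hu1 hv1; have [_ k2] := H1pairB L0 hu2 hv2.
rewrite /vsub (H1norm2E L0 k1) (H1norm2E L0 k2) !inner_sqr.
apply: lerD; rewrite lerDl inner_ge0//.
Qed.

Lemma norm_lt_of_le_add (a b s e : R) :
  a <= b + s -> b <= a + s -> s < e -> `|a - b| < e.
Proof. by move=> h1 h2 h3; rewrite ltr_norml; apply/andP; split; lra. Qed.

Lemma wave_inX : inX L phi.
Proof.
by case: hw1 => p1 d1; case: hw2 => p2 d2; split; split => //; [exists dwave1|exists dwave2].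
Qed.

(** The invariants of the solution stay close to those of the wave, so whenever
its [L^2] distance to the orbit is at most [r], the a priori estimate makes it
smaller than [m < r]. The distance is continuous in time and starts below [m],
hence it never reaches [r], and the estimate holds for all times. *)
Lemma wave_orbitally_stable : globally_wellposed L B1 B2 B3 B4 ->
  conserved L B1 B2 B3 B4 (energy L B1 B2 B3 B4) ->
  conserved L B1 B2 B3 B4 (momentum L) ->
  orbitally_stable L B1 B2 B3 B4 phi.
Proof.
move=> [wp _ _] hE hF; split; first exact: wave_inX.
have [r r0 [A [A' [A0 A'0 apr]]]] := apriori_estimate L0 W lam0 N hmu hxi hD.
have [A1 A10 ini] := initial_estimate L0 W (B4 := B4) hmu hxi.
pose K := A * (A1 + A' * A1).
have K0 : 0 < K.
  by rewrite mulr_gt0// ltr_wpDr// mulr_ge0// ltW.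
move=> e e0.
pose m := Num.min e r / 2.
have m0 : 0 < m by rewrite divr_gt0// lt_min e0.
have mr : m < r.
  by rewrite /m ltr_pdivrMr// (le_lt_trans (_ : _ <= r))// ?ge_min ?lexx ?orbT//; lra.
have me : m < e.
  by rewrite /m ltr_pdivrMr// (le_lt_trans (_ : _ <= e))// ?ge_min ?lexx//; lra.
pose d := Num.min (Num.min 1 m) (m / (K + 1)).
have d0 : 0 < d by rewrite !lt_min ltr01 m0/= divr_gt0//; lra.
exists d => // u0 hu0 hd; split; first exact: wp.
move=> u su u00 t t0.
have ux s : 0 <= s -> inX L (u s) by case: su => + _ _ _; exact.
have T0 v : translate 0 v = v.
  case: v => v1 v2; rewrite /translate/=.
  by under eq_fun do rewrite addr0; under [X in (_, X)]eq_fun do rewrite addr0.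
(* energy and momentum of the initial datum are close to those of the wave *)
pose h0 := H1sqr L (disp1 u0 0) (ddisp1 u0 0) + H1sqr L (disp2 u0 0) (ddisp2 u0 0).
have h00 : 0 <= h0 by rewrite addr_ge0// H1sqr_ge0.
have hd' : Num.sqrt h0 < d by rewrite /h0 -(Xdist_disp hu0 0) T0.
have [hd1 hdm hdK] : [/\ Num.sqrt h0 < 1, Num.sqrt h0 < m & Num.sqrt h0 < m / (K + 1)].
  by move: hd'; rewrite !lt_min => /andP[/andP[-> ->] ->].
have rh := sqr_sqrtr h00; have rh0 := sqrtr_ge0 h0.
have h01 : h0 <= 1 by rewrite -rh exprn_ile1// ltW.
have [iniL iniF] := ini _ _ _ _ (H1pair_disp1 hu0 0) (H1pair_disp2 hu0 0) h01.
rewrite energy_disp// momentum_disp// in iniL.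
rewrite momentum_disp// in iniF.
(* closeness in L^2 entails closeness in X *)
have close s : 0 <= s -> orbit_distance (u s) <= r ->
    Xdist L (u s) (translate (best_shift (u s)) phi) < m.
  move=> s0 sr; have us := ux s s0; have [_ orth] := best_shiftP us.
  set y := best_shift (u s) in orth *.
  have small : \< disp1 (u s) y, disp1 (u s) y \> + \< disp2 (u s) y, disp2 (u s) y \> <= r ^+ 2.
    rewrite -distance_at_disp// -(sqr_sqrtr (distance_at_ge0 _ _)).
    by rewrite ler_pXn2r ?nnegrE ?sqrtr_ge0// ltW.
  have := apr _ _ _ _ (H1pair_disp1 us y) (H1pair_disp2 us y) (orthogonal_disp us orth) small.
  rewrite energy_disp// !momentum_disp// hE// hF// u00 => est.
  rewrite Xdist_disp//; set h := H1sqr L _ _ + _ in est *.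
  have hK : h <= K * h0.
    apply: (le_trans est); rewrite /K -mulrA ler_wpM2l ?(ltW A0)// mulrDl.
    by apply: lerD => //; rewrite -mulrA ler_wpM2l.
  have hh0 : 0 <= h by rewrite addr_ge0// H1sqr_ge0.
  have K1 : K <= (K + 1) ^+ 2.
    have := sqr_ge0 K; rewrite sqrrD; move: (ltW K0); lra.
  rewrite -[ltRHS]ger0_norm ?(ltW m0)// -sqrtr_sqr ltr_sqrt ?exprn_gt0//.
  apply: (le_lt_trans hK); rewrite -rh.
  apply: (@le_lt_trans _ _ (((K + 1) * Num.sqrt h0) ^+ 2)).
    by rewrite exprMn ler_wpM2r// sqr_ge0.
  rewrite ltr_pXn2r ?nnegrE ?(ltW m0)//; last first.
    by rewrite mulr_ge0//; lra.
  by rewrite mulrC -ltr_pdivlMr//; lra.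
have close' s : 0 <= s -> orbit_distance (u s) <= r -> orbit_distance (u s) < m.
  move=> s0 sr; apply: le_lt_trans (close s s0 sr).
  exact: distance_le_Xdist (ux s s0).
have init : orbit_distance (u 0) < m.
  rewrite u00; apply: le_lt_trans hdm.
  apply: (le_trans (orbit_distance_le 0 hu0)); apply: (le_trans (distance_le_Xdist 0 hu0)).
  by rewrite Xdist_disp.
(* the intermediate value theorem would give a time at distance exactly [r] *)
have stay : orbit_distance (u t) <= r.
  rewrite leNgt; apply/negP => far.
  have cont : {within `[0, t], continuous (fun s => orbit_distance (u s))}.
    apply/subspace_continuousP => s /=; rewrite in_itv/= => /andP[s0 st].
    apply/cvgrPdist_lt => eps eps0; rewrite near_withinE.
    case: su => _ /(_ s s0 eps eps0)[del del0 Hdel] _ _.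
    near=> s'; rewrite /= in_itv/= => /andP[s'0 s't].
    have ss : `|s' - s| < del.
      by near: s'; rewrite near_simpl; exact: cvgr_distC_lt del0.
    have X1 := Hdel s' s'0 ss.
    have L1 := orbit_distance_lipschitz (ux s' s'0) (ux s s0).
    have L2 := orbit_distance_lipschitz (ux s s0) (ux s' s'0).
    have Xsym : Xdist L (u s) (u s') = Xdist L (u s') (u s).
      have [/H1per_pair a1 /H1per_pair a2] := ux s s0.
      have [/H1per_pair b1 /H1per_pair b2] := ux s' s'0.
      have [_ k1] := H1pairB L0 a1 b1; have [_ k2] := H1pairB L0 a2 b2.
      have [_ l1] := H1pairB L0 b1 a1; have [_ l2] := H1pairB L0 b2 a2.
      rewrite /Xdist /Xnorm /vsub (H1norm2E L0 k1) (H1norm2E L0 k2) (H1norm2E L0 l1) (H1norm2E L0 l2).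
      have sw (f g : R -> R) : \I_[0, L] (fun x => (f x - g x) ^+ 2) =
          \I_[0, L] (fun x => (g x - f x) ^+ 2).
        by apply: eq_integral_on => x _; rewrite -sqrrN opprB.
      rewrite (sw (u s).1 (u s').1) (sw (u s).2 (u s').2).
      by rewrite (sw (wderiv L (u s).1)) (sw (wderiv L (u s).2)).
    rewrite Xsym in L2; exact: norm_lt_of_le_add L2 L1 X1.
  have [|s] := @IVT R (fun s => orbit_distance (u s)) 0 t r t0 cont.
    apply/andP; split.
      by rewrite ge_min; apply/orP; left; exact: ltW (lt_trans init mr).
    by rewrite le_max; apply/orP; right; exact: ltW far.
  rewrite in_itv/= => /andP[s0 _] sr.
  have := close' s s0; rewrite sr lexx => /(_ isT) /(lt_trans mr).
  by rewrite ltxx.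
apply: (le_lt_trans _ (lt_trans (close t t0 stay) me)).
apply: ge_inf; last by exists (best_shift (u t)).
by exists 0 => _ [y _ <-]; exact: sqrtr_ge0.
Unshelve. all: by end_near. Qed.

End Orbit.

Theorem theorem3p3 (R : realType) (L B1 B2 B3 B4 mu k : R)
  (hL : 0 < L)
  (hwp : globally_wellposed L B1 B2 B3 B4)
  (hE : conserved L B1 B2 B3 B4 (energy L B1 B2 B3 B4))
  (hF : conserved L B1 B2 B3 B4 (momentum L))
  (hM : conserved L B1 B2 B3 B4 (mass L))
  (hmu : mu * (B1 + B2 * mu + B3 * mu ^+ 2)
         = 2^-1 * B2 + 2 * B3 * mu + B4 * mu ^+ 2)
  (hxi : xi B1 B2 B3 mu != 0)
  (hD : \det (Dmx B1 B2 B3 B4 mu) < 2^-1)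
  (hk : 0 < k < 1) :
  orbitally_stable L B1 B2 B3 B4 (cnoidal_wave L B1 B2 B3 mu k).
Proof.
have W := cnoidal_profile hk hL.
have [lam lam0 [chi [N]]] := cnoidal_two_node hk hL.
exact: (wave_orbitally_stable hL W lam0 N hmu hxi hD hwp hE hF).
Qed.
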